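(* Let $\mathcal{J}$ be a homogeneous Hopf ideal of $\mathcal{L}$ with corresponding semigroup $S$. Let $\theta:(\mathcal{L}_{\mathcal{J}})_*\to(\mathcal{L}_{\mathcal{J}})_*$ be a bounded linear map with adjoint $\theta^*:\mathcal{L}_{\mathcal{J}}\to\mathcal{L}_{\mathcal{J}}$. Then the following statements are equivalent: (i) The map $\theta$ is a Hopf convolution algebra automorphism. (ii) The adjoint map $\theta^*$ is a Hopf dual algebra automorphism. (iii) There is a unital zero-preserving semigroup isomorphism $\sigma$ of $S$ (onto itself) such that $\theta^*(L_s)=L_{\sigma(s)}$ for all $s\in S$.
   Context: Let $d$ be a fixed positive integer, $\mathbb{F}_d^*$ the unital free semigroup on $\{1,\dots,d\}$ with identity $\varnothing$, and $\mathbb{F}_d^{*0}$ the semigroup obtained by adjoining a zero $0$. Let $\ell^2(\mathbb{F}_d^* )$ have orthonormal basis $\{\xi_w\}$ and put $L_u\xi_w=\xi_{uw}$, with $L_0:=0$. $\mathcal{L}=\mathcal{L}_d$ is the unital weak-operator-closed (WOT-closed) algebra generated by $\{L_u\}$, with comultiplication $\Delta_{\mathcal{L}}:\mathcal{L}\to\mathcal{L}\overline\otimes\mathcal{L}$, the unital weak*-continuous completely contractive homomorphism with $\Delta_{\mathcal{L}}(L_w)=L_w\otimes L_w$. A Hopf ideal is a WOT-closed two-sided ideal $\mathcal{J}$ with $\Delta_{\mathcal{L}}(\mathcal{J})\subseteq\overline{\mathcal{J}\otimes\mathcal{L}+\mathcal{L}\otimes\mathcal{J}}^{w^*}$; it is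 homogeneous if generated by homogeneous polynomials in $L_1,\dots,L_d$. Put $\mathcal{N}_{\mathcal{J}}=(\mathcal{J}\xi_\varnothing)^\perp$ and $\mathcal{L}_{\mathcal{J}}=P_{\mathcal{N}_{\mathcal{J}}}\mathcal{L}|_{\mathcal{N}_{\mathcal{J}}}\cong\mathcal{L}/\mathcal{J}$. The corresponding semigroup is $S=\mathbb{F}_d^{*0}/{\sim}$, where $u\sim v$ iff $L_u-L_v\in\mathcal{J}$. For $s\in S$, write $L_s:=P_{\mathcal{N}_{\mathcal{J}}}L_w|_{\mathcal{N}_{\mathcal{J}}}\in\mathcal{L}_{\mathcal{J}}$ for any $w\in\mathbb{F}_d^{*0}$ representing $s$ (independent of the choice of $w$; zero for the zero element of $S$). These operators have weak*-dense span in $\mathcal{L}_{\mathcal{J}}$, and $\mathcal{L}_{\mathcal{J}}$ carries the comultiplication $\Delta_S:\mathcal{L}_{\mathcal{J}}\to\mathcal{L}_{\mathcal{J}}\overline\otimes\mathcal{L}_{\mathcal{J}}$ (a unital weak*-continuous completely contractive coassociative homomorphism) with $\Delta_S(L_s)=L_s\otimes L_s$. The predual $(\mathcal{L}_{\mathcal{J}})_*$ carries the product $\varphi\star\psi=(\varphi\otimes\psi)\circ\Delta_S$ and the comultiplication $(\Delta_S)_*$, the preadjoint of the multiplication of $\mathcal{L}_{\mathcal{J}}$, characterized by $\langle(\Delta_S)_*(\varphi),A\otimes B\rangle=\varphi(AB)$. A Hopf convolution algebra automorphism of $(\mathcal{L}_{\mathcal{J}})_*$ is an algebra automorphism $\theta$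 (for $\star$) that intertwines the comultiplication, i.e. $\langle(\Delta_S)_*(\theta(\varphi)),A\otimes B\rangle=\langle(\Delta_S)_*(\varphi),\theta^*(A)\otimes\theta^*(B)\rangle$ for all $\varphi\in(\mathcal{L}_{\mathcal{J}})_*$ and $A,B\in\mathcal{L}_{\mathcal{J}}$. A Hopf dual algebra automorphism of $\mathcal{L}_{\mathcal{J}}$ is a weak*-continuous algebra automorphism $\Theta$ with $\Delta_S\circ\Theta=(\Theta\otimes\Theta)\circ\Delta_S$, meaning $(\varphi\otimes\psi)(\Delta_S(\Theta(A)))=((\varphi\circ\Theta)\otimes(\psi\circ\Theta))(\Delta_S(A))$ for all $A\in\mathcal{L}_{\mathcal{J}}$ and $\varphi,\psi\in(\mathcal{L}_{\mathcal{J}})_*$. *)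

(* Defs.v *)
From HB Require Import structures.
From mathcomp Require Import all_boot all_order all_algebra complex.
From mathcomp Require Import all_classical all_reals all_analysis.
From mathcomp Require summability.
From mathcomp Require Import ring lra.

Set Implicit Arguments.
Unset Strict Implicit.
Unset Printing Implicit Defensive.
Import Order.TTheory GRing.Theory Num.Theory numFieldNormedType.Exports.

Local Open Scope classical_set_scope.
Local Open Scope ring_scope.

Definition C (R : realType) : numClosedFieldType := R[i].

Definition cabs (R : realType) (z : C R) : R := Normc.normc z.

Lemma cabs_ge0 (R : realType) (z : C R) : 0 <= cabs z.
Proof. by case: z => a b; rewrite /cabs /= sqrtr_ge0. Qed.

Lemma cabs0 (R : realType) : cabs (0 : C R) = 0.
Proof. exact: Normc.normc0. Qed.

Lemma cabsM (R : realType) (z w : C R) : cabs (z * w) = cabs z * cabs w.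
Proof. exact: Normc.normcM. Qed.

Section Ell2.
Variables (R : realType) (I : choiceType).
Implicit Types x y : I -> C R.

Definition sqsum x : \bar R := (\esum_(i in [set: I]) (cabs (x i) ^+ 2)%:E)%E.

Definition sqsummable : {pred I -> C R} := fun x => (sqsum x < +oo)%E.

Lemma sqsum_scale_le (c : R) (f : I -> R) :
  0 <= c -> (forall i, 0 <= f i) ->
  (\esum_(i in [set: I]) (c * f i)%:E <=
     c%:E * \esum_(i in [set: I]) (f i)%:E)%E.
Proof.
move=> c0 f0; apply: ge_ereal_sup => _ [A [finA _] <-].
under eq_fsbigr do rewrite EFinM.
rewrite -ge0_mule_fsumr; last by move=> i; rewrite lee_fin.
rewrite lee_pmul //; first by rewrite fsume_ge0 // => i _; rewrite lee_fin.
by apply: ereal_sup_ubound; exists A.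
Qed.

Fact sqsummable_submod_closed : submod_closed sqsummable.
Proof.
split=> [|a x y].
  rewrite /sqsummable /in_mem /= /sqsum esum1 ?ltry // => i _.
  by rewrite (_ : cabs _ = 0) ?expr0n //; exact: cabs0.
rewrite /sqsummable /in_mem /= => xfin yfin.
pose ca := 2 * cabs a ^+ 2.
have le2 i : cabs ((a *: x + y) i) ^+ 2 <=
    ca * cabs (x i) ^+ 2 + 2 * cabs (y i) ^+ 2.
  have le1 : cabs ((a *: x + y) i) <= cabs a * cabs (x i) + cabs (y i).
    by apply: le_trans (le_normcD _ _) _; rewrite -cabsM.
  apply: (@le_trans _ _ ((cabs a * cabs (x i) + cabs (y i)) ^+ 2)).
    by rewrite ler_pXn2r ?nnegrE ?addr_ge0 ?mulr_ge0 ?cabs_ge0.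
  rewrite /ca -mulrA -exprMn; set s := _ * _; set t := cabs _.
  rewrite -subr_ge0 (_ : _ - _ = (s - t) ^+ 2) ?sqr_ge0 //.
  rewrite sqrrB sqrrD; rewrite !mulr2n !mulrDl !mul1r; ring.
have nn z i : 0 <= cabs (z i) ^+ 2 by rewrite sqr_ge0.
have ca0 : 0 <= ca by rewrite mulr_ge0 ?sqr_ge0.
apply: (@le_lt_trans _ _ (ca%:E * sqsum x + 2%:E * sqsum y)%E).
  apply: (@le_trans _ _ (\esum_(i in [set: I])
      ((ca * cabs (x i) ^+ 2)%:E + (2 * cabs (y i) ^+ 2)%:E))%E).
    by apply: le_esum => i _; rewrite -EFinD lee_fin le2.
  rewrite esumD; last 2 first.
  - by move=> i _; rewrite lee_fin mulr_ge0 ?sqr_ge0.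
  - by move=> i _; rewrite lee_fin mulr_ge0 ?sqr_ge0.
  apply: leeD; first exact: sqsum_scale_le.
  exact: (@sqsum_scale_le 2 (fun i => cabs (y i) ^+ 2)).
by rewrite lte_add_pinfty // lte_mul_pinfty // lee_fin.
Qed.

HB.instance Definition _ := GRing.isSubmodClosed.Build (C R) (I -> C R)
  sqsummable sqsummable_submod_closed.

Record ell2 := Ell2 { ell2_val :> I -> C R ; ell2P : ell2_val \in sqsummable }.

HB.instance Definition _ := [isSub for ell2_val].
HB.instance Definition _ := [Choice of ell2 by <:].
HB.instance Definition _ := [SubChoice_isSubLmodule of ell2 by <:].

End Ell2.

Section Hilbert.
Variables (R : realType) (I : choiceType).
Implicit Types x y : ell2 R I.

(* Linear in the first variable; the sum is the limit of the net of finite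
   partial sums. *)
Definition dot x y : C R := summability.sum (fun i => x i * (y i)^*).

Definition l2norm x : R := Num.sqrt (fine (sqsum x)).

Fact delta_sqsummable (i : I) :
  (fun j => (j == i)%:R : C R) \in @sqsummable R I.
Proof.
rewrite /sqsummable /in_mem /= /sqsum (esumID [set i]) => [|j _]; last first.
  by rewrite lee_fin sqr_ge0.
rewrite setTI setTI [X in (_ + X)%E]esum1 ?adde0 => [|j /= /eqP/negPf ->].
  by rewrite esum_set1 ?ltry // lee_fin sqr_ge0.
by rewrite [cabs _]cabs0 expr0n.
Qed.

Definition delta (i : I) : ell2 R I := Ell2 (delta_sqsummable i).

(* Operators are arbitrary maps, with the pointwise linear structure; the
   algebra B(ell2 I) is the set [bounded_op]. *)
Definition op := ell2 R I -> ell2 R I.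

HB.instance Definition _ := Choice.on op.
HB.instance Definition _ := GRing.Lmodule.on op.

Definition opnorm (T : op) : \bar R :=
  ereal_sup [set (l2norm (T x))%:E | x in [set x | l2norm x <= 1]].

Definition bounded_op : set op :=
  [set T | linear (T : ell2 R I -> ell2 R I) /\ (opnorm T < +oo)%E].

Definition colnorm n (v : 'I_n -> ell2 R I) : R :=
  Num.sqrt (\sum_j l2norm (v j) ^+ 2).

Definition mxopnorm n (a : 'I_n -> 'I_n -> op) : \bar R :=
  ereal_sup [set (colnorm (fun i => \sum_j a i j (v j)))%:E
            | v in [set v | colnorm v <= 1]].

(* P is the orthogonal projection onto N; it exists, uniquely, when N is a
   closed subspace. *)
Definition is_proj (N : set (ell2 R I)) : set op :=
  [set P | bounded_op P /\
           forall x, N (P x) /\ forall y, N y -> dot (x - P x) y = 0].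

Definition proj (N : set (ell2 R I)) : op := xget 0 (is_proj N).

End Hilbert.
Arguments op : clear implicits.
Arguments bounded_op : clear implicits.
Arguments delta {R I}.

Section WeakTopologies.
Variable R : realType.

(* The coarsest topology on [E] making all the functionals in [F] continuous *)
Definition weakly (E : choiceType) (F : set (E -> C R)) : Type :=
  initial_topology ((fun T w => sval w T) : E -> {ptws F -> C R}).

HB.instance Definition _ (E : choiceType) (F : set (E -> C R)) :=
  Topological.copy (weakly F)
    (initial_topology ((fun T w => sval w T) : E -> {ptws F -> C R})).

Variable I : choiceType.

Definition vector_functional : set (op R I -> C R) :=
  [set f | exists x y, f = fun T => dot (T x) y].

Definition normal_functional : set (op R I -> C R) :=
  [set f | exists x y : nat -> ell2 R I,
    [/\ (\sum_(0 <= n <oo) (l2norm (x n) ^+ 2)%:E < +oo)%E,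
        (\sum_(0 <= n <oo) (l2norm (y n) ^+ 2)%:E < +oo)%E
      & f = fun T => summability.sum (fun n => dot (T (x n)) (y n))]].

Definition wot := weakly vector_functional.
Definition wstar := weakly normal_functional.
HB.instance Definition _ := Topological.on wot.
HB.instance Definition _ := Topological.on wstar.

(* Closures in B(ell2 I) *)
Definition wot_closure (X : set (op R I)) : set (op R I) :=
  bounded_op R I `&` closure (X : set wot).

Definition wstar_closure (X : set (op R I)) : set (op R I) :=
  bounded_op R I `&` closure (X : set wstar).

Definition wot_closed (X : set (op R I)) := wot_closure X `<=` X.

(* The predual of a weak*-closed space X of operators: weak*-continuous
   functionals on X, each represented by its extension by 0 off X. *)
Definition predual (X : set (op R I)) : set (op R I -> C R) :=
  [set patch (fun=> 0) X f | f in normal_functional].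

Definition predual_norm (X : set (op R I)) (phi : op R I -> C R) : \bar R :=
  ereal_sup [set (cabs (phi A))%:E
            | A in X `&` [set A | (opnorm A <= 1%:E)%E]].

End WeakTopologies.

Definition wstar_continuous_on (R : realType) (I J : choiceType)
    (X : set (op R I)) (f : op R I -> op R J) : Prop :=
  {within (X : set (wstar R I)), continuous (f : wstar R I -> wstar R J)}.

Definition linear_on (R : realType) (U V : lmodType (C R)) (X : set U)
    (f : U -> V) : Prop :=
  forall (a : C R) u v, X u -> X v -> f (a *: u + v) = a *: f u + f v.

Definition multiplicative_on (R : realType) (I J : choiceType)
    (X : set (op R I)) (f : op R I -> op R J) : Prop :=
  forall A B, X A -> X B -> f (A \o B) = f A \o f B.

Definition lin_span (R : realType) (U : lmodType (C R)) (G : set U) : set U :=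
  [set u | exists n (a : 'I_n -> C R) (g : 'I_n -> U),
     (forall i, G (g i)) /\ u = \sum_i a i *: g i].

Section Tensor.
Variables (R : realType) (I J : choiceType).

(* ell2 I (x) ell2 J is realized as ell2 (I * J). *)
Fact tensor_vec_sqsummable (x : ell2 R I) (y : ell2 R J) :
  (fun ij => x ij.1 * y ij.2) \in @sqsummable R (I * J)%type.
Proof.
rewrite /sqsummable /in_mem /= /sqsum.
have xfin : (sqsum x < +oo)%E := ell2P x.
have yfin : (sqsum y < +oo)%E := ell2P y.
have y0 : (0 <= sqsum y)%E by apply: esum_ge0 => j _; rewrite lee_fin sqr_ge0.
have yE : sqsum y = (fine (sqsum y))%:E by rewrite fineK // ge0_fin_numE.
have c0 : 0 <= fine (sqsum y) by rewrite fine_ge0.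
pose a i j : \bar R := (cabs (x i) ^+ 2 * cabs (y j) ^+ 2)%:E.
have -> : (\esum_(ij in [set: (I * J)%type]) (cabs (x ij.1 * y ij.2) ^+ 2)%:E =
    \esum_(i in [set: I]) \esum_(j in [set: J]) a i j)%E.
  rewrite esum_esum => [|i j _ _]; last by rewrite lee_fin mulr_ge0 ?sqr_ge0.
  rewrite (_ : _ `*`` _ = setT); last by apply/seteqP; split.
  by apply: eq_esum => ij _; rewrite cabsM exprMn.
apply: (@le_lt_trans _ _
    (\esum_(i in [set: I]) (fine (sqsum y) * cabs (x i) ^+ 2)%:E)%E).
  apply: le_esum => i _; rewrite mulrC EFinM -yE.
  by apply: sqsum_scale_le => *; rewrite sqr_ge0.
apply: le_lt_trans (sqsum_scale_le c0 (fun i => sqr_ge0 (cabs (x i)))) _.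
by rewrite lte_mul_pinfty // lee_fin.
Qed.

Definition tensor_vec x y : ell2 R (I * J)%type :=
  Ell2 (tensor_vec_sqsummable x y).

(* A (x) B, the unique such T when A and B are bounded *)
Definition tensor_op (A : op R I) (B : op R J) : op R (I * J)%type :=
  xget 0 [set T | bounded_op R (I * J)%type T /\
    forall x y, T (tensor_vec x y) = tensor_vec (A x) (B y)].

Definition elementary_tensors (X : set (op R I)) (Y : set (op R J)) :
    set (op R (I * J)%type) :=
  [set T | exists A B, [/\ X A, Y B & T = tensor_op A B]].

(* The weak*-closed spatial tensor product of X and Y *)
Definition wstar_tensor (X : set (op R I)) (Y : set (op R J)) :
    set (op R (I * J)%type) :=
  wstar_closure (lin_span (elementary_tensors X Y)).

(* phi (x) psi : the weak*-continuous functional on [wstar_tensor X Y] with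
   (phi (x) psi)(A (x) B) = phi(A) psi(B) *)
Definition tensor_functional (X : set (op R I)) (Y : set (op R J))
    (phi : op R I -> C R) (psi : op R J -> C R) : op R (I * J)%type -> C R :=
  xget 0 [set w | predual (wstar_tensor X Y) w /\
    forall A B, X A -> Y B -> w (tensor_op A B) = phi A * psi B].

End Tensor.

(* Unital weak*-continuous completely contractive homomorphisms from the
   operator algebra X, with unit e, into the weak*-closed tensor square of X *)
Record is_comultiplication (R : realType) (I : choiceType) (X : set (op R I))
    (e : op R I) (Delta : op R I -> op R (I * I)%type) : Prop :=
  IsComultiplication {
    comult_maps : forall A, X A -> wstar_tensor X X (Delta A) ;
    comult_linear : linear_on X Delta ;
    comult_multiplicative : multiplicative_on X Delta ;
    comult_unital : Delta e = tensor_op e e ;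
    comult_wstar : wstar_continuous_on X Delta ;
    comult_contractive : forall n (a : 'I_n -> 'I_n -> op R I),
      (forall i j, X (a i j)) ->
      (mxopnorm (fun i j => Delta (a i j)) <= mxopnorm a)%E }.

Section FreeSemigroupAlgebra.
Variables (R : realType) (d : nat).

Local Notation word := (seq 'I_d).
Local Notation opF := (op R word).

(* The free semigroup with a zero adjoined: [None] is the zero. *)
Definition word0 : Type := option word.
HB.instance Definition _ := Choice.on word0.

Definition word0_mul (u v : word0) : word0 :=
  if u is Some u' then if v is Some v' then Some (u' ++ v') else None else None.

Fact shift_sqsummable (u : word) (x : ell2 R word) :
  (fun v => if prefix u v then x (drop (size u) v) else 0)
    \in @sqsummable R word.
Proof.
rewrite /sqsummable /in_mem /= /sqsum.
rewrite (esumID (cat u @` setT)) => [|v _]; last by rewrite lee_fin sqr_ge0.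
rewrite !setTI [X in (_ + X)%E]esum1 ?adde0 => [|v /= vu].
  rewrite esum_image => [|v w _ _ /eqP]; last by rewrite eqseq_cat // eqxx => /eqP.
  under eq_esum do rewrite prefix_prefix drop_size_cat //.
  exact: (ell2P x).
case: ifP => [/prefixP[w vE]|_]; last by rewrite cabs0 expr0n.
by case: vu; exists w.
Qed.

Definition shift (u : word) : opF := fun x => Ell2 (shift_sqsummable u x).

Lemma shift_delta u w : shift u (delta w) = delta (u ++ w).
Proof.
apply/val_inj/funext => v /=.
case: ifPn => [/prefixP[v' ->]|uv].
  by rewrite drop_size_cat // eqseq_cat // eqxx.
by case: eqP => // vE; rewrite vE prefix_prefix in uv.
Qed.

Definition shift0 (u : word0) : opF := if u is Some u' then shift u' else 0.

Record is_unital_wot_algebra (M : set opF) : Prop := IsUnitalWotAlgebra {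
  alg_bounded : M `<=` bounded_op R word ;
  alg_unit : M idfun ;
  alg_linear : forall (a : C R) A B, M A -> M B -> M (a *: A + B) ;
  alg_mul : forall A B, M A -> M B -> M (A \o B) ;
  alg_wot : wot_closed M }.

Definition LL : set opF := smallest is_unital_wot_algebra (range shift).

Definition comultiplication_LL (Delta : opF -> op R (word * word)%type) : Prop :=
  is_comultiplication LL idfun Delta /\
  forall w, Delta (shift w) = tensor_op (shift w) (shift w).

Record is_wot_ideal (J : set opF) : Prop := IsWotIdeal {
  ideal_sub : J `<=` LL ;
  ideal_zero : J 0 ;
  ideal_linear : forall (a : C R) A B, J A -> J B -> J (a *: A + B) ;
  ideal_left : forall A B, LL A -> J B -> J (A \o B) ;
  ideal_right : forall A B, J A -> LL B -> J (A \o B) ;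
  ideal_wot : wot_closed J }.

Definition Hopf_ideal (Delta : opF -> op R (word * word)%type) (J : set opF) :=
  is_wot_ideal J /\
  forall A, J A -> wstar_closure
    (lin_span (elementary_tensors J LL `|` elementary_tensors LL J)) (Delta A).

Definition homogeneous_poly : set opF :=
  [set p | exists n (c : n.-tuple 'I_d -> C R), p = \sum_w c w *: shift w].

Definition homogeneous (J : set opF) : Prop :=
  exists2 G, G `<=` homogeneous_poly & J = smallest is_wot_ideal G.

Section Quotient.
Variable J : set opF.

Definition NJ : set (ell2 R word) :=
  [set x | forall A, J A -> dot (A (delta [::])) x = 0].

(* Operators on the subspace NJ are identified with the operators T on
   ell2 word such that P T P = T, where P is the projection onto NJ; thus the
   compression of A to NJ is P A P, and the identity of NJ is P. Likewise
   operators on NJ (x) NJ are operators on ell2 (word * word). *)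
Definition compression (A : opF) : opF := proj NJ \o A \o proj NJ.

Definition LJ : set opF := compression @` LL.

Definition word_equiv (u v : word0) : Prop := J (shift0 u - shift0 v).

Definition word_class (u : word0) : set word0 := [set v | word_equiv u v].

(* The quotient semigroup, as the set of equivalence classes *)
Definition SJ : set (set word0) := range word_class.

Definition class_repr (s : set word0) : word0 := xget None s.

Definition mulS (s t : set word0) : set word0 :=
  word_class (word0_mul (class_repr s) (class_repr t)).

Definition LS (s : set word0) : opF := compression (shift0 (class_repr s)).

Record semigroup_automorphism (sigma : set word0 -> set word0) : Prop :=
  SemigroupAutomorphism {
    sg_bij : set_bij SJ SJ sigma ;
    sg_mul : forall s t, SJ s -> SJ t ->
      sigma (mulS s t) = mulS (sigma s) (sigma t) ;
    sg_unit : sigma (word_class (Some [::])) = word_class (Some [::]) ;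
    sg_zero : sigma (word_class None) = word_class None }.

Definition predLJ : set (opF -> C R) := predual LJ.

Variable Delta : opF -> op R (word * word)%type.

(* The product of the predual *)
Definition conv (phi psi : opF -> C R) : opF -> C R :=
  patch (fun=> 0) LJ (fun A => tensor_functional LJ LJ phi psi (Delta A)).

(* Coassociativity is stated through slices: evaluating
   (Delta (x) id) Delta = (id (x) Delta) Delta at phi (x) psi (x) chi. *)
Definition coassociative : Prop := forall phi psi chi,
  predLJ phi -> predLJ psi -> predLJ chi ->
  conv (conv phi psi) chi = conv phi (conv psi chi).

Definition comultiplication_LJ : Prop :=
  [/\ is_comultiplication LJ (proj NJ) Delta, coassociative
    & forall s, SJ s -> Delta (LS s) = tensor_op (LS s) (LS s)].

(* The pairing of the preadjoint of the multiplication, applied to phi, with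
   the elementary tensor A (x) B *)
Definition predual_comult (phi : opF -> C R) (A B : opF) : C R := phi (A \o B).

Record bounded_linear_predual (theta : (opF -> C R) -> (opF -> C R)) : Prop :=
  BoundedLinearPredual {
    theta_maps : forall phi, predLJ phi -> predLJ (theta phi) ;
    theta_linear : linear_on predLJ theta ;
    theta_bounded : exists M : R, forall phi, predLJ phi ->
      (predual_norm LJ (theta phi) <= M%:E * predual_norm LJ phi)%E }.

Definition is_adjoint (theta : (opF -> C R) -> (opF -> C R))
    (Theta : opF -> opF) : Prop :=
  (forall A, LJ A -> LJ (Theta A)) /\
  (forall phi A, predLJ phi -> LJ A -> theta phi A = phi (Theta A)).

Record Hopf_convolution_automorphism (theta : (opF -> C R) -> (opF -> C R))
    (Theta : opF -> opF) : Prop := HopfConvolutionAutomorphism {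
  conv_bij : set_bij predLJ predLJ theta ;
  conv_linear : linear_on predLJ theta ;
  conv_mul : forall phi psi, predLJ phi -> predLJ psi ->
    theta (conv phi psi) = conv (theta phi) (theta psi) ;
  conv_comult : forall phi A B, predLJ phi -> LJ A -> LJ B ->
    predual_comult (theta phi) A B =
    predual_comult phi (Theta A) (Theta B) }.

Record Hopf_dual_automorphism (Theta : opF -> opF) : Prop :=
  HopfDualAutomorphism {
    dual_bij : set_bij LJ LJ Theta ;
    dual_linear : linear_on LJ Theta ;
    dual_mul : multiplicative_on LJ Theta ;
    dual_wstar : wstar_continuous_on LJ Theta ;
    dual_comult : forall A phi psi, LJ A -> predLJ phi -> predLJ psi ->
      tensor_functional LJ LJ phi psi (Delta (Theta A)) =
      tensor_functional LJ LJ (phi \o Theta) (psi \o Theta) (Delta A) }.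

End Quotient.
End FreeSemigroupAlgebra.

(* Main.v *)
Require Import Defs.
From mathcomp Require Import all_boot all_order all_algebra complex.
From mathcomp Require Import all_classical all_reals all_analysis.
From mathcomp Require Import finmap.
From mathcomp Require summability.
From mathcomp Require Import ring lra.

(** Write P for the projection onto NJ, so that LJ is the algebra P LL P and L_s is the
    compression of a word in the class s. The bridge between the three conditions is the
    set of group-like elements of LJ, the A on which all products of functionals
    evaluate multiplicatively, that is Delta A = A (x) A.

    Group-like elements are exactly the L_s (group_like_Lw). The L_s are characters of
    the convolution algebra of the predual, and distinct non-zero characters can be
    interpolated (interpolate). Since a homogeneous ideal contains the homogeneous
    components of its elements (homogeneous_hpart), classes of words are finite sets of
    words of one length, up to the zero class, and interpolation shows that the
    indicator vector of a class lies in NJ (NJ_eta). Pairing with it gives a functional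
    phi_class with phi_class u (L_t) equal to 1 or 0 as t is the class of u or not.
    These functionals are orthogonal idempotents that separate the points of LJ, which
    leaves a group-like element no choice but to be some L_s.

    All identities between functionals are checked on the L_s, by weak-star density of
    their span. Density rests on the Cesaro means of the Fourier series of B in LL: such
    a mean averages the compressions of B to windows of consecutive degrees
    (fejer_windows), so it has norm at most that of B (norm_le_fejer), and normal
    functionals converge along the means (LL_normal_vanish). That the convolution of two
    elements of the predual is again in the predual (conv_predual) comes from the fact
    that weak-star continuous functionals are normal (wstar_continuous_predual).

    From (i) or (ii) one obtains that the adjoint Theta of theta is multiplicative,
    injective, and sends each L_s to a group-like element, so Theta (L_s) = L_(sigma s).
    Injectivity of Theta and theta and multiplicativity make sigma an automorphism
    (semigroup_automorphism_of_grouplike); here one uses that L_s = L_t forces s = t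
    (Lw_inj), which holds because a finite-dimensional separation argument produces
    enough vectors in NJ (NJ_separation).

    From (iii), density shows that Theta is multiplicative and compatible with Delta.
    The remaining point is bijectivity. The linear extension of the inverse of sigma
    could a priori be unbounded, but sigma permutes the finitely many classes of letters
    that generate the semigroup, so some positive power of sigma is the identity
    (sigma_finite_order); by density the same power of Theta and of theta is the
    identity, which inverts both (Theta_finite_order). *)

Set Implicit Arguments.
Unset Strict Implicit.
Unset Printing Implicit Defensive.
Import Order.TTheory GRing.Theory Num.Theory numFieldNormedType.Exports.

Local Open Scope classical_set_scope.
Local Open Scope ring_scope.
(** * Complex moduli *)

Section ComplexModulus.
Variable R : realType.
Implicit Types (r s : R) (z w : C R).

Definition rc r : C R := real_complex R r.

Lemma normE z : `|z| = rc (cabs z). Proof. by []. Qed.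
Lemma rc0 : rc 0 = 0. Proof. exact: rmorph0. Qed.
Lemma rcD r s : rc (r + s) = rc r + rc s. Proof. exact: rmorphD. Qed.
Lemma rcB r s : rc (r - s) = rc r - rc s. Proof. exact: rmorphB. Qed.
Lemma rcM r s : rc (r * s) = rc r * rc s. Proof. exact: rmorphM. Qed.
Lemma rcX r n : rc (r ^+ n) = rc r ^+ n. Proof. exact: rmorphXn. Qed.
Lemma rc_nat n : rc (n%:R : R) = n%:R :> C R.
Proof. exact: rmorph_nat. Qed.

Lemma rc_sum (T : Type) (s : seq T) (f : T -> R) :
  rc (\sum_(i <- s) f i) = \sum_(i <- s) rc (f i).
Proof. exact: rmorph_sum. Qed.
Lemma rc_le r s : (rc r <= rc s) = (r <= s). Proof. exact: lecR. Qed.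
Lemma rc_lt r s : (rc r < rc s) = (r < s). Proof. exact: ltcR. Qed.
Lemma rc_inj : injective rc. Proof. exact: fmorph_inj. Qed.

Lemma rc_sqr_inj r s : 0 <= r -> 0 <= s -> rc (r ^+ 2) = rc (s ^+ 2) -> r = s.
Proof.
move=> r0 s0 /rc_inj /eqP; rewrite eqrXn2 // => /eqP; exact.
Qed.

Lemma cabsD z w : cabs (z + w) <= cabs z + cabs w.
Proof. by rewrite -rc_le rcD -!normE ler_normD. Qed.

Lemma cabsB z w : cabs (z - w) = cabs (w - z).
Proof. by apply: rc_inj; rewrite -!normE distrC. Qed.

Lemma cabs_rc r : cabs (rc r) = `|r|.
Proof. by apply: rc_inj; rewrite -normE /rc normc_def /= expr0n addr0 sqrtr_sqr. Qed.

Lemma cabs_eq0 z : cabs z = 0 -> z = 0.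
Proof. by move=> z0; apply/eqP; rewrite -normr_eq0 normE z0 rc0. Qed.

Lemma cabs_sum (T : Type) (s : seq T) (f : T -> C R) :
  cabs (\sum_(i <- s) f i) <= \sum_(i <- s) cabs (f i).
Proof.
rewrite -rc_le rc_sum -normE; apply: le_trans (ler_norm_sum _ _ _) _.
by rewrite ler_sum.
Qed.

Lemma cabs_conj z : cabs (z^*) = cabs z.
Proof. by apply: rc_inj; rewrite -!normE norm_conjC. Qed.

Lemma mulCconj z : z * z^* = rc (cabs z ^+ 2).
Proof. by rewrite -normCK rcX normE. Qed.

Lemma conj_rc r : (rc r)^* = rc r.
Proof. by apply/CrealP; rewrite /rc complex_real. Qed.

Lemma cabs_small z : (forall e : R, 0 < e -> cabs z <= e) -> z = 0.
Proof.
move=> h; apply: cabs_eq0; apply/eqP; rewrite eq_le cabs_ge0 andbT.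
by apply/ler_addgt0Pr => e e0; rewrite add0r h.
Qed.

Lemma cvgCP T (F : set_system T) (FF : Filter F) (f : T -> C R) z :
  f @ F --> z <-> forall e : R, 0 < e -> \forall t \near F, cabs (z - f t) < e.
Proof.
split=> [/cvgrPdist_lt cf e e0|cf].
  have := cf (rc e); rewrite -rc0 rc_lt => /(_ e0).
  by apply: filterS => t; rewrite normE rc_lt.
apply/cvgrPdist_lt => e e0.
have eE : e = rc (complex.Re e) by rewrite /rc /= RRe_real // gtr0_real.
move: e0; rewrite eE -rc0 rc_lt => /cf.
by apply: filterS => t; rewrite normE rc_lt.
Qed.

End ComplexModulus.

(** * Unconditional sums *)

Section UnconditionalSums.
Variable R : realType.

(** Unconditional convergence, packaged as a record so that it does not unfold to
    an inclusion of filters, which would make arguments of the lemmas below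
    implicit. *)
Record hsum (I : choiceType) (f : I -> C R) (s : C R) : Prop := Hsum {
  hsum_cvg : summability.partial_sum f @ summability.totally --> s }.

Lemma hsumP (I : choiceType) (f : I -> C R) s : hsum f s <->
  forall e : R, 0 < e -> exists A : {fset I}, forall B : {fset I},
    (A `<=` B)%fset -> cabs (s - \sum_(i <- B) f i) < e.
Proof.
have FF : Filter (@summability.totally I) := @filter_filter _ _ summability.totally_filter.
split=> [[/(cvgCP FF) h] e /h|h].
  move=> [A _ hA]; exists A => B /hA /=.
  by rewrite /summability.partial_sum big_seq_fsetE.
split; apply/(cvgCP FF) => e /h [A hA]; exists A => // B /hA /=.
by rewrite /summability.partial_sum big_seq_fsetE.
Qed.

Lemma hsum_sum (I : choiceType) (f : I -> C R) s :
  hsum f s -> summability.sum f = s.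
Proof.
case=> h; have FF := @summability.totally_filter I.
by apply: cvg_lim => //; exact: norm_hausdorff.
Qed.

Lemma hsum_unique (I : choiceType) (f : I -> C R) s t :
  hsum f s -> hsum f t -> s = t.
Proof. by move=> /hsum_sum <- /hsum_sum. Qed.

Lemma hsumD (I : choiceType) (f g : I -> C R) s t :
  hsum f s -> hsum g t -> hsum (fun i => f i + g i) (s + t).
Proof.
move=> /hsumP fs /hsumP gt; apply/hsumP => e e0.
have e20 : 0 < e / 2 by rewrite divr_gt0.
have [A hA] := fs _ e20; have [B hB] := gt _ e20.
exists (A `|` B)%fset => D; rewrite fsubUset => /andP[/hA h1 /hB h2].
rewrite big_split /= opprD addrACA (le_lt_trans (cabsD _ _)) //.
by rewrite (splitr e) ltrD.
Qed.

Lemma hsumZ (I : choiceType) (f : I -> C R) s (a : C R) :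
  hsum f s -> hsum (fun i => a * f i) (a * s).
Proof.
move=> /hsumP fs; apply/hsumP => e e0.
have c0 : 0 < cabs a + 1 by rewrite ltr_wpDl ?cabs_ge0.
have [A hA] := fs _ (divr_gt0 e0 c0); exists A => B /hA h.
rewrite -mulr_sumr -mulrBr cabsM.
apply: (@le_lt_trans _ _ ((cabs a + 1) * cabs (s - \sum_(i <- B) f i))).
  by rewrite ler_wpM2r ?cabs_ge0 // lerDl.
by rewrite mulrC -ltr_pdivlMr.
Qed.

Lemma hsum_conj (I : choiceType) (f : I -> C R) s :
  hsum f s -> hsum (fun i => (f i)^*) s^*.
Proof.
move=> /hsumP fs; apply/hsumP => e /fs[A hA]; exists A => B /hA.
by rewrite -rmorph_sum -rmorphB cabs_conj.
Qed.

Lemma eq_hsum (I : choiceType) (f g : I -> C R) s :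
  f =1 g -> hsum f s -> hsum g s.
Proof. by move=> /funext ->. Qed.

Lemma hsum_fset (I : choiceType) (A : {fset I}) (f : I -> C R) :
  (forall i, i \notin A -> f i = 0) -> hsum f (\sum_(i <- A) f i).
Proof.
move=> f0; apply/hsumP => e e0; exists A => B AB.
rewrite (big_fset_incl _ AB) ?subrr ?cabs0 // => i _; exact: f0.
Qed.

(** A finite subset whose sum is e-close to the supremum does the job. *)
Lemma hsum_esum (I : choiceType) (f : I -> R) (r : R) :
  (forall i, 0 <= f i) -> (\esum_(i in [set: I]) (f i)%:E = r%:E)%E ->
  hsum (fun i => rc (f i)) (rc r).
Proof.
move=> f0 fr; apply/hsumP => e e0.
have le_r (B : {fset I}) : \sum_(i <- B) f i <= r.
  rewrite -lee_fin -fr -sumEFin; apply: esum_ge; exists [set` B].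
    by split=> //; exact: finite_fset.
  by rewrite fsbig_finite ?set_fsetK //=; exact: finite_fset.
have : ereal_sup [set (\sum_(x \in A) (f x)%:E)%E | A in fsets [set: I]]
    \is a fin_num by rewrite -[ereal_sup _]/(esum _ _) fr.
move=> /(ub_ereal_sup_adherent e0)[_ [A [finA _] <-]].
rewrite -/(esum _ _) [esum _ _]fr -EFinB fsbig_finite //= sumEFin lte_fin => ltA.
exists (fset_set A) => B AB.
rewrite -rc_sum -rcB cabs_rc ger0_norm ?subr_ge0 // ltrBlDl -ltrBlDr.
apply: lt_le_trans ltA _; rewrite (big_fsetID _ (mem (fset_set A)) B) /=.
rewrite [X in X + _](_ : _ = \sum_(i <- fset_set A) f i).
  by rewrite lerDl sumr_ge0.
apply: eq_fbigl => i; rewrite !inE /=.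
by rewrite andb_idl // => /(fsubsetP AB).
Qed.

End UnconditionalSums.

(** * The Hilbert space structure of ell2 *)

Section Ell2Space.
Variables (R : realType) (I : choiceType).
Implicit Types (x y z : ell2 R I) (a : C R).

Lemma ell2_ext x y : (forall i, x i = y i) -> x = y.
Proof. by move=> h; apply/val_inj/funext. Qed.

Lemma ell2D x y i : (x + y) i = x i + y i. Proof. by []. Qed.
Lemma ell2Z a x i : (a *: x) i = a * x i. Proof. by []. Qed.
Lemma ell20 i : (0 : ell2 R I) i = 0. Proof. by []. Qed.
Lemma ell2_sum (T : Type) (s : seq T) (f : T -> ell2 R I) i :
  (\sum_(t <- s) f t) i = \sum_(t <- s) f t i.
Proof. by elim/big_rec2: _ => // t u v _ <-. Qed.
Lemma deltaE (i j : I) : (delta i : ell2 R I) j = (j == i)%:R. Proof. by []. Qed.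

Lemma l2norm_ge0 x : 0 <= l2norm x. Proof. exact: sqrtr_ge0. Qed.

Lemma sqsum_ge0 (f : I -> C R) : (0 <= sqsum f)%E.
Proof. by apply: esum_ge0 => i _; rewrite lee_fin sqr_ge0. Qed.

Lemma sqsumE x : sqsum x = (l2norm x ^+ 2)%:E.
Proof.
rewrite sqr_sqrtr ?fine_ge0 ?sqsum_ge0 // fineK // ge0_fin_numE ?sqsum_ge0 //.
exact: (ell2P x).
Qed.

Lemma sqsummable_le (J : choiceType) (f : J -> C R) (r : R) :
  (sqsum f <= r%:E)%E -> f \in @sqsummable R J.
Proof. by move=> h; apply: le_lt_trans h _; rewrite ltry. Qed.

Lemma hsum_sqnorm x : hsum (fun i => rc (cabs (x i) ^+ 2)) (rc (l2norm x ^+ 2)).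
Proof. by apply: hsum_esum (sqsumE x) => i; rewrite sqr_ge0. Qed.

Let n2 x : C R := rc (l2norm x ^+ 2).

Definition polarization x y : C R :=
  4^-1 * (n2 (x + y) + (-1) * n2 (x - y) +
          ('i * n2 (x + 'i *: y) + - 'i * n2 (x - 'i *: y))).

(** Polarization writes x i * (y i)^* as a combination of squared moduli, whose
    sums are the squared norms; this is how the series defining the inner product
    is seen to converge unconditionally. *)
Lemma polar4 (u v : C R) : u * v^* =
  4^-1 * (rc (cabs (u + v) ^+ 2) + (-1) * rc (cabs (u - v) ^+ 2) +
  ('i * rc (cabs (u + 'i * v) ^+ 2) + - 'i * rc (cabs (u - 'i * v) ^+ 2))).
Proof.
rewrite -!mulCconj !rmorphD !rmorphN !rmorphM /= !conjCi.
have i2 : ('i : C R) * 'i = -1 by rewrite -expr2 sqrCi.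
set uc := u^*; set vc := v^*.
transitivity (4^-1 * (2 * u * vc + 2 * v * uc + ('i * 'i) * (2 * v * uc)
   - ('i * 'i) * (2 * u * vc))); last by congr (_ * _); ring.
by rewrite i2; field.
Qed.

Lemma dot_hsum_polar x y :
  hsum (fun i => x i * (y i)^*) (polarization x y).
Proof.
apply: eq_hsum (fun i => esym (polar4 (x i) (y i))) _.
rewrite /polarization; apply: hsumZ.
have h1 := hsumD (hsum_sqnorm (x + y)) (hsumZ (-1) (hsum_sqnorm (x - y))).
have h2 := hsumD (hsumZ 'i (hsum_sqnorm (x + 'i *: y)))
  (hsumZ (- 'i) (hsum_sqnorm (x - 'i *: y))).
by apply: eq_hsum (hsumD h1 h2) => i.
Qed.

Lemma dot_polar x y : dot x y = polarization x y.
Proof. exact/hsum_sum/dot_hsum_polar. Qed.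

Lemma dot_hsum x y : hsum (fun i => x i * (y i)^*) (dot x y).
Proof. by rewrite dot_polar; exact: dot_hsum_polar. Qed.

Lemma dotDl x y z : dot (x + y) z = dot x z + dot y z.
Proof.
apply: hsum_unique (dot_hsum _ _) _.
by apply: eq_hsum (hsumD (dot_hsum x z) (dot_hsum y z)) => i; rewrite -mulrDl.
Qed.

Lemma dotZl a x y : dot (a *: x) y = a * dot x y.
Proof.
apply: hsum_unique (dot_hsum _ _) _.
by apply: eq_hsum (hsumZ a (dot_hsum x y)) => i; rewrite mulrA.
Qed.

Lemma dotC x y : dot y x = (dot x y)^*.
Proof.
apply: hsum_unique (dot_hsum _ _) _.
apply: eq_hsum (hsum_conj (dot_hsum x y)) => i.
by rewrite rmorphM /= conjCK mulrC.
Qed.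

Lemma dotDr x y z : dot z (x + y) = dot z x + dot z y.
Proof. by rewrite dotC dotDl rmorphD /= -!dotC. Qed.

Lemma dotZr a x y : dot x (a *: y) = a^* * dot x y.
Proof. by rewrite dotC dotZl rmorphM /= -dotC. Qed.

Lemma dotNl x y : dot (- x) y = - dot x y.
Proof. by rewrite -scaleN1r dotZl mulN1r. Qed.
Lemma dotNr x y : dot x (- y) = - dot x y.
Proof. by rewrite -scaleN1r dotZr rmorphN rmorph1 mulN1r. Qed.
Lemma dotBl x y z : dot (x - y) z = dot x z - dot y z.
Proof. by rewrite dotDl dotNl. Qed.
Lemma dotBr x y z : dot z (x - y) = dot z x - dot z y.
Proof. by rewrite dotDr dotNr. Qed.
Lemma dot0l x : dot 0 x = 0.
Proof. by rewrite -(scale0r (0 : ell2 R I)) dotZl mul0r. Qed.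
Lemma dot0r x : dot x 0 = 0.
Proof. by rewrite dotC dot0l rmorph0. Qed.
Lemma dot_suml (T : Type) (s : seq T) (f : T -> ell2 R I) y :
  dot (\sum_(t <- s) f t) y = \sum_(t <- s) dot (f t) y.
Proof. exact: (big_morph (fun u => dot u y) (fun u v => dotDl u v y) (dot0l y)). Qed.
Lemma dot_sumr (T : Type) (s : seq T) (f : T -> ell2 R I) y :
  dot y (\sum_(t <- s) f t) = \sum_(t <- s) dot y (f t).
Proof. exact: (big_morph (dot y) (fun u v => dotDr u v y) (dot0r y)). Qed.

Lemma dotxx x : dot x x = rc (l2norm x ^+ 2).
Proof.
apply: hsum_unique (dot_hsum _ _) _.
by apply: eq_hsum (hsum_sqnorm x) => i; rewrite mulCconj.
Qed.

Lemma dot_fset (A : {fset I}) x y : (forall i, i \notin A -> y i = 0) ->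
  dot x y = \sum_(i <- A) x i * (y i)^*.
Proof.
move=> y0; apply: hsum_unique (dot_hsum x y) _; apply: hsum_fset => i /y0 ->.
by rewrite rmorph0 mulr0.
Qed.

Lemma dot_delta x i : dot x (delta i) = x i.
Proof.
rewrite (@dot_fset [fset i]%fset) => [|j].
  by rewrite big_seq_fset1 deltaE eqxx rmorph1 mulr1.
by rewrite in_fset1 deltaE => /negPf ->.
Qed.

Lemma l2norm_eq0 x : l2norm x = 0 -> x = 0.
Proof.
move=> x0; have s0 : sqsum x = 0%E by rewrite sqsumE x0 expr0n.
apply: ell2_ext => i; apply: cabs_eq0; apply/eqP; rewrite -sqrf_eq0.
rewrite eq_le sqr_ge0 andbT -lee_fin -[leRHS]s0; apply: esum_ge.
by exists [set i]; [split; [exact: finite_set1|] | rewrite fsbig_set1].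
Qed.

(** Expand the squared norm of |y|^2 x - <x, y> y. *)
Lemma cauchy_schwarz x y : cabs (dot x y) <= l2norm x * l2norm y.
Proof.
have [y0|y_neq0] := eqVneq (l2norm y) 0.
  by rewrite (l2norm_eq0 y0) dot0r cabs0 mulr_ge0 ?l2norm_ge0.
have ny : 0 < l2norm y ^+ 2 by rewrite exprn_gt0 // lt0r y_neq0 l2norm_ge0.
pose n := l2norm y ^+ 2; pose c := dot x y.
have : rc 0 <= dot (rc n *: x - c *: y) (rc n *: x - c *: y).
  by rewrite dotxx rc_le sqr_ge0.
rewrite dotBl !dotBr !dotZl !dotZr !dotxx conj_rc.
rewrite (dotC x y) -/c -/n.
set t := (X in rc 0 <= X).
have -> : t = rc (n * (n * l2norm x ^+ 2 - cabs c ^+ 2)).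
  by rewrite (rcM n) rcB (rcM n) -mulCconj /t; ring.
rewrite rc_le pmulr_rge0 // subr_ge0 /n -exprMn => h.
by rewrite -(ler_pXn2r (n := 2)) ?nnegrE ?cabs_ge0 ?mulr_ge0 ?l2norm_ge0 // mulrC.
Qed.

Lemma l2normZ a x : l2norm (a *: x) = cabs a * l2norm x.
Proof.
apply: rc_sqr_inj; rewrite ?mulr_ge0 ?cabs_ge0 ?l2norm_ge0 //.
rewrite -dotxx dotZl dotZr mulrA mulCconj dotxx.
by rewrite -rcM -exprMn.
Qed.

Lemma l2norm0 : l2norm (0 : ell2 R I) = 0.
Proof. by rewrite -(scale0r (0 : ell2 R I)) l2normZ cabs0 mul0r. Qed.

Lemma re_le_cabs (z : C R) : complex.Re z <= cabs z.
Proof.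
case: z => u v; rewrite /cabs /= (le_trans (ler_norm u)) // -sqrtr_sqr.
by rewrite ler_wsqrtr // lerDl sqr_ge0.
Qed.

Lemma l2normD x y : l2norm (x + y) <= l2norm x + l2norm y.
Proof.
rewrite -(ler_pXn2r (n := 2)) ?nnegrE ?addr_ge0 ?l2norm_ge0 //.
have -> : l2norm (x + y) ^+ 2 =
  l2norm x ^+ 2 + l2norm y ^+ 2 + complex.Re (dot x y + dot y x).
  apply: rc_inj; rewrite rcD -dotxx dotDl !dotDr !dotxx rcD.
  have -> : rc (complex.Re (dot x y + dot y x)) = dot x y + dot y x.
    rewrite /rc /= RRe_real // (dotC x y); apply/CrealP.
    by rewrite rmorphD /= conjCK addrC.
  by ring.
have h : complex.Re (dot x y + dot y x) <= 2 * (l2norm x * l2norm y).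
  apply: le_trans (re_le_cabs _) _; apply: le_trans (cabsD _ _) _.
  by rewrite mulr2n mulrDl mul1r lerD ?cauchy_schwarz // mulrC cauchy_schwarz.
by rewrite sqrrD; lra.
Qed.

Lemma l2norm_le x (r : R) : 0 <= r -> l2norm x ^+ 2 <= r ^+ 2 -> l2norm x <= r.
Proof. by move=> r0; rewrite ler_pXn2r ?nnegrE ?l2norm_ge0. Qed.

Lemma dot_eq0 x : (forall y, dot x y = 0) -> x = 0.
Proof. by move=> h; apply: ell2_ext => i; rewrite -dot_delta h. Qed.

End Ell2Space.
(** * Truncation, bounded forms and the Riesz theorem *)

Section Truncation.
Variables (R : realType) (I : choiceType).
Implicit Types (x y z : ell2 R I) (a : C R) (p : pred I).
Local Notation dl i := (delta i : ell2 R I).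

Fact cutoff_sqsummable p x :
  (fun i => if p i then x i else 0) \in @sqsummable R I.
Proof.
apply: (@sqsummable_le _ _ _ (l2norm x ^+ 2)); rewrite -sqsumE.
apply: le_esum => i _; rewrite lee_fin; case: ifP => // _.
by rewrite cabs0 expr0n sqr_ge0.
Qed.

Definition cutoff p x : ell2 R I := Ell2 (cutoff_sqsummable p x).

Lemma cutoffE p x i : cutoff p x i = if p i then x i else 0. Proof. by []. Qed.

Lemma cutoff_linear p a x y : cutoff p (a *: x + y) = a *: cutoff p x + cutoff p y.
Proof.
apply: ell2_ext => i; rewrite ell2D ell2Z !cutoffE ell2D ell2Z.
by case: ifP; rewrite ?mulr0 ?addr0.
Qed.

Lemma dot_cutoff p x y : dot (cutoff p x) y = dot x (cutoff p y).
Proof.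
apply: hsum_unique (dot_hsum _ _) _; apply: eq_hsum (dot_hsum _ _) => i.
by rewrite !cutoffE; case: ifP; rewrite ?mul0r ?rmorph0 ?mulr0.
Qed.

Lemma cutoff_id p x : cutoff p (cutoff p x) = cutoff p x.
Proof. by apply: ell2_ext => i; rewrite !cutoffE; case: (p i). Qed.

Lemma l2norm_cutoff p x : l2norm (cutoff p x) <= l2norm x.
Proof.
apply: l2norm_le; first exact: l2norm_ge0.
rewrite -lee_fin -!sqsumE; apply: le_esum => i _; rewrite lee_fin cutoffE.
by case: ifP => // _; rewrite cabs0 expr0n sqr_ge0.
Qed.

Definition trunc (A : {fset I}) x := cutoff (mem A) x.

Lemma trunc_sum (A : {fset I}) x : trunc A x = \sum_(i <- A) x i *: dl i :> ell2 R I.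
Proof.
apply: ell2_ext => j; rewrite ell2_sum cutoffE -[mem A j]/(j \in A).
rewrite (eq_bigr (fun i => if i == j then x j else 0)); last first.
  move=> i _; rewrite ell2Z deltaE eq_sym; case: eqP => [->|_];
  by rewrite ?mulr1 ?mulr0.
rewrite -big_mkcond -big_filter; case: ifPn => jA.
  rewrite (_ : seq.filter _ _ = [:: j]) ?big_seq1 //.
  exact: filter_pred1_uniq (fset_uniq A) jA.
rewrite (_ : seq.filter _ _ = [::]) ?big_nil //.
by apply/eqP; rewrite -(negbK (_ == _)) -has_filter has_pred1.
Qed.

Lemma l2norm_trunc (A : {fset I}) x :
  l2norm (trunc A x) ^+ 2 = \sum_(i <- A) cabs (x i) ^+ 2.
Proof.
apply: rc_inj; rewrite -dotxx (@dot_fset _ _ A); last first.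
  by move=> i /negPf iA; rewrite cutoffE /= iA.
rewrite rc_sum !big_seq; apply: eq_bigr => i iA.
by rewrite mulCconj cutoffE /= iA.
Qed.

Lemma trunc_approx x (e : R) : 0 < e ->
  exists A : {fset I}, forall B : {fset I}, (A `<=` B)%fset ->
    l2norm (x - trunc B x) <= e.
Proof.
move=> e0; have e20 : 0 < e ^+ 2 by rewrite exprn_gt0.
have [A hA] := (hsumP _ _).1 (hsum_sqnorm x) _ e20.
exists A => B /hA h; apply: l2norm_le; first exact: ltW.
have E : rc (l2norm (x - trunc B x) ^+ 2) =
    rc (l2norm x ^+ 2) - \sum_(i <- B) rc (cabs (x i) ^+ 2).
  rewrite -!dotxx dotBl !dotBr !dot_cutoff cutoff_id -/(trunc B x) subrr subr0.
  congr (_ - _); rewrite (@dot_fset _ _ B); last first.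
    by move=> i /negPf iB; rewrite cutoffE /= iB.
  rewrite !big_seq; apply: eq_bigr => i iB.
  by rewrite -mulCconj cutoffE /= iB.
have [|lt0] := leP 0 (l2norm (x - trunc B x) ^+ 2); last first.
  by rewrite (le_trans (ltW lt0)) // ltW.
move=> ge0; apply: ltW; move: h; rewrite -E cabs_rc ger0_norm //.
Qed.

Definition bounded_form (g : ell2 R I -> C R) :=
  (forall a u v, g (a *: u + v) = a * g u + g v) /\
  exists2 c : R, 0 <= c & forall u, cabs (g u) <= c * l2norm u.

Section BoundedForm.
Variables (g : ell2 R I -> C R) (gB : bounded_form g).

Let gL : forall a u v, g (a *: u + v) = a * g u + g v. Proof. by case: gB. Qed.

Lemma form0 : g 0 = 0.
Proof.
have := gL (-1) 0 0; rewrite scaler0 addr0 mulN1r addNr.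
by [].
Qed.

Lemma formD u v : g (u + v) = g u + g v.
Proof. by rewrite -{1}(scale1r u) gL mul1r. Qed.

Lemma formZ a u : g (a *: u) = a * g u.
Proof. by rewrite -(addr0 (a *: u)) gL form0 addr0. Qed.

Lemma form_sum (T : Type) (s : seq T) (f : T -> ell2 R I) :
  g (\sum_(t <- s) f t) = \sum_(t <- s) g (f t).
Proof. exact: (big_morph g formD form0). Qed.

(** Truncations are finite combinations of basis vectors and are norm dense. *)
Lemma form_delta_eq0 x : (forall i, g (dl i) = 0) -> g x = 0.
Proof.
move=> g0; apply: cabs_small => e e0; have [_ [c c0 hc]] := gB.
have c1 : 0 < c + 1 by rewrite ltr_wpDl.
have [A /(_ A (fsubset_refl _)) hA] := trunc_approx x (divr_gt0 e0 c1).
have -> : g x = g (x - trunc A x).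
  rewrite formD -scaleN1r formZ trunc_sum form_sum big1 ?mulr0 ?addr0 // => i _.
  by rewrite formZ g0 mulr0.
apply: le_trans (hc _) _; apply: (@le_trans _ _ ((c + 1) * (e / (c + 1)))).
  by apply: ler_pM => //; rewrite ?l2norm_ge0 // lerDl.
by rewrite mulrC divfK // gt_eqF.
Qed.

(** Testing g on the truncations of the prospective vector bounds its squared norm
    by the square of the constant of g. *)
Lemma riesz_vector : exists z : ell2 R I, forall i, z i = (g (dl i))^*.
Proof.
have [_ [c c0 hc]] := gB.
have zP : (fun i => (g (dl i))^*) \in @sqsummable R I.
  apply: (@sqsummable_le _ _ _ (c ^+ 2)); apply: ge_ereal_sup => _ [A [finA _] <-].
  rewrite fsbig_finite //= sumEFin lee_fin; set B := fset_set A.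
  pose u : ell2 R I := \sum_(i <- B) (g (dl i))^* *: dl i.
  set S := \sum_(i <- B) _.
  have gu : g u = rc S.
    rewrite form_sum /S rc_sum; apply: eq_bigr => i _.
    by rewrite formZ cabs_conj mulrC mulCconj.
  have ui i : u i = if i \in B then (g (dl i))^* else 0.
    have -> : u = trunc B u.
      apply: ell2_ext => j; rewrite cutoffE /=; case: ifPn => // jB.
      rewrite ell2_sum big_seq big1 // => k kB; rewrite ell2Z deltaE.
      by case: eqP jB => [->|]; rewrite ?kB ?mulr0.
    rewrite cutoffE /=; case: ifP => // iB.
    rewrite ell2_sum (big_fsetD1 i) // ell2Z deltaE eqxx mulr1 big_seq big1; first exact: addr0.
    by move=> k; rewrite !inE ell2Z deltaE eq_sym => /andP[/negPf -> _]; rewrite mulr0.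
  have S0 : 0 <= S by apply: sumr_ge0 => i _; rewrite sqr_ge0.
  have nu : l2norm u ^+ 2 = S.
    apply: rc_inj; rewrite -dotxx -gu form_sum (@dot_fset _ _ B); last first.
      by move=> i /negPf iB; rewrite ui iB.
    rewrite !big_seq; apply: eq_bigr => i iB.
    by rewrite ui iB formZ conjCK.
  have := hc u; rewrite gu cabs_rc ger0_norm // -nu => h.
  have [->|n0] := eqVneq (l2norm u) 0; first by rewrite expr0n sqr_ge0.
  rewrite ler_pXn2r ?nnegrE ?l2norm_ge0 //.
  by rewrite -(ler_pM2r (x := l2norm u)) // lt0r n0 l2norm_ge0.
by exists (Ell2 zP).
Qed.
End BoundedForm.

Lemma bounded_dot z : bounded_form (fun x => dot x z).
Proof.
split=> [a u v|]; first by rewrite dotDl dotZl.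
exists (l2norm z) => [|u]; first exact: l2norm_ge0.
by rewrite mulrC cauchy_schwarz.
Qed.

Lemma bounded_formB g h : bounded_form g -> bounded_form h ->
  bounded_form (fun x => g x - h x).
Proof.
move=> [gL [c c0 gc]] [hL [e e0 he]]; split=> [a u v|].
  by rewrite gL hL; ring.
exists (c + e) => [|u]; first exact: addr_ge0.
rewrite mulrDl (le_trans (cabsD _ _)) //.
by rewrite (_ : cabs (- h u) = cabs (h u)) ?lerD //; exact: normcN.
Qed.

Lemma eq_bounded_form g h : bounded_form g -> bounded_form h ->
  (forall i, g (dl i) = h (dl i)) -> g =1 h.
Proof.
move=> gB hB gh x; apply/eqP; rewrite -subr_eq0; apply/eqP.
by apply: (form_delta_eq0 (bounded_formB gB hB)) => i; rewrite gh subrr.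
Qed.

(** Riesz representation: both sides are bounded and agree on the basis. *)
Lemma riesz g : bounded_form g -> exists z, forall x, g x = dot x z.
Proof.
move=> gB; have [z hz] := riesz_vector gB; exists z.
apply: eq_bounded_form gB (bounded_dot z) _ => i.
by rewrite dotC dot_delta hz conjCK.
Qed.

End Truncation.
(** * Bounded operators *)

Section BoundedOperators.
Variables (R : realType) (I : choiceType).
Implicit Types (S T : op R I) (x y : ell2 R I) (a : C R).
Local Notation dl i := (delta i : ell2 R I).

Lemma bounded_opP T : bounded_op R I T <->
  (forall a x y, T (a *: x + y) = a *: T x + T y) /\
  exists2 c : R, 0 <= c & forall x, l2norm (T x) <= c * l2norm x.
Proof.
split=> [[TL Tfin]|[TL [c c0 hc]]]; split=> //; last first.
  apply: (@le_lt_trans _ _ c%:E); last exact: ltry.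
  apply: ge_ereal_sup => _ [x /= x1 <-]; rewrite lee_fin.
  by apply: le_trans (hc x) _; rewrite ler_piMr.
have T0 : T 0 = 0 by have := TL (-1) 0 0; rewrite scaler0 addr0 scaleN1r addNr.
have le_op x : l2norm x <= 1 -> ((l2norm (T x))%:E <= opnorm T)%E.
  by move=> x1; apply: ereal_sup_ubound; exists x.
have op0 : (0%:E <= opnorm T)%E.
  by have := le_op 0; rewrite T0 l2norm0 => /(_ ler01).
have opE : opnorm T = (fine (opnorm T))%:E by rewrite fineK // ge0_fin_numE.
exists (fine (opnorm T)) => [|x]; first exact: fine_ge0.
have [x0|x0] := eqVneq (l2norm x) 0.
  by rewrite (l2norm_eq0 x0) T0 l2norm0 mulr0.
have nx : 0 < l2norm x by rewrite lt0r x0 l2norm_ge0.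
have nV : cabs (rc (l2norm x)^-1) = (l2norm x)^-1.
  by rewrite cabs_rc ger0_norm // invr_ge0 ltW.
have TZ b : T (b *: x) = b *: T x by rewrite -[b *: x]addr0 TL T0 addr0.
have := le_op (rc (l2norm x)^-1 *: x); rewrite TZ !l2normZ nV mulVf // lexx.
move=> /(_ isT); rewrite opE lee_fin => h.
by rewrite -ler_pdivrMr // mulrC.
Qed.

Section Theory.
Variables (T : op R I) (TB : bounded_op R I T).

Lemma opP a x y : T (a *: x + y) = a *: T x + T y.
Proof. by have [/bounded_opP[]] := (conj TB TB). Qed.
Lemma op0 : T 0 = 0.
Proof. by have := opP (-1) 0 0; rewrite scaler0 addr0 scaleN1r addNr. Qed.
Lemma opD x y : T (x + y) = T x + T y.
Proof. by rewrite -{1}(scale1r x) opP scale1r. Qed.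
Lemma opZ a x : T (a *: x) = a *: T x.
Proof. by rewrite -(addr0 (a *: x)) opP op0 addr0. Qed.
Lemma opB x y : T (x - y) = T x - T y.
Proof. by rewrite opD -scaleN1r opZ scaleN1r. Qed.
Lemma op_sum (U : Type) (s : seq U) (f : U -> ell2 R I) :
  T (\sum_(t <- s) f t) = \sum_(t <- s) T (f t).
Proof. exact: (big_morph T opD op0). Qed.

Lemma op_form y : bounded_form (fun x => dot (T x) y).
Proof.
have [_ [c c0 hc]] := (bounded_opP T).1 TB; split=> [a u v|].
  by rewrite opP dotDl dotZl.
exists (c * l2norm y) => [|u]; first by rewrite mulr_ge0 ?l2norm_ge0.
apply: le_trans (cauchy_schwarz _ _) _.
by rewrite mulrAC ler_wpM2r ?l2norm_ge0.
Qed.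

(** The value at y of the adjoint of T. *)
Lemma adjoint_vector y : exists z, forall x, dot (T x) y = dot x z.
Proof. exact: riesz (op_form y). Qed.

End Theory.

Lemma eq_bounded_op S T : bounded_op R I S -> bounded_op R I T ->
  (forall i, S (dl i) = T (dl i)) -> S = T.
Proof.
move=> SB TB ST; apply/funext => x; apply: ell2_ext => j.
rewrite -(dot_delta (S x)) -(dot_delta (T x)).
apply: (eq_bounded_form (op_form SB _) (op_form TB _)).
by move=> i; rewrite ST.
Qed.

Lemma bounded_id : bounded_op R I idfun.
Proof. by apply/bounded_opP; split=> //; exists 1 => // x; rewrite mul1r. Qed.

Lemma bounded_0 : bounded_op R I (0 : op R I).
Proof.
apply/bounded_opP; split=> [a x y|]; first by rewrite [LHS]/= scaler0 addr0.
by exists 0 => // x; rewrite mul0r -(@l2norm0 R I).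
Qed.

Lemma bounded_comp S T :
  bounded_op R I S -> bounded_op R I T -> bounded_op R I (S \o T).
Proof.
move=> /bounded_opP[SL [c c0 hc]] /bounded_opP[TL [e e0 he]].
apply/bounded_opP; split=> [a x y|]; first by rewrite /= TL SL.
exists (c * e) => [|x]; first exact: mulr_ge0.
by apply: le_trans (hc _) _; rewrite -mulrA ler_wpM2l.
Qed.

Lemma bounded_lin a S T :
  bounded_op R I S -> bounded_op R I T -> bounded_op R I (a *: S + T).
Proof.
move=> /bounded_opP[SL [c c0 hc]] /bounded_opP[TL [e e0 he]].
apply/bounded_opP; split=> [b x y|].
  rewrite -[(a *: S + T) _]/(a *: S (b *: x + y) + T (b *: x + y)).
  rewrite -[(a *: S + T) x]/(a *: S x + T x) -[(a *: S + T) y]/(a *: S y + T y).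
  rewrite SL TL !scalerDr !scalerA (mulrC a b) -!addrA; congr (_ + _).
  by rewrite addrCA.
exists (cabs a * c + e) => [|x]; first by rewrite addr_ge0 ?mulr_ge0 ?cabs_ge0.
rewrite -[(a *: S + T) x]/(a *: S x + T x).
apply: le_trans (l2normD _ _) _; rewrite l2normZ mulrDl lerD // -mulrA.
by rewrite ler_wpM2l ?cabs_ge0.
Qed.

Lemma bounded_sum (U : Type) (s : seq U) (a : U -> C R) (f : U -> op R I) :
  (forall t, bounded_op R I (f t)) -> bounded_op R I (\sum_(t <- s) a t *: f t).
Proof.
move=> fB; elim: s => [|t s IHs]; first by rewrite big_nil; exact: bounded_0.
by rewrite big_cons; exact: bounded_lin.
Qed.

Lemma op_lin_appl a S T x : (a *: S + T) x = a *: S x + T x.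
Proof. by []. Qed.

Lemma op_scale_appl a T x : (a *: T) x = a *: T x.
Proof. by []. Qed.

Lemma op_sum_appl (U : Type) (s : seq U) (f : U -> op R I) x :
  (\sum_(t <- s) f t) x = \sum_(t <- s) f t x.
Proof. by elim/big_rec2: _ => // t u v _ <-. Qed.

End BoundedOperators.

(** * Change of index set *)

Section Reindexing.
Variables (R : realType) (I J : choiceType) (h : I -> J).
Hypothesis hI : injective h.
Implicit Types (x : ell2 R I) (y : ell2 R J).

Fact pull_sqsummable y : (y \o h) \in @sqsummable R I.
Proof.
apply: (@sqsummable_le _ _ _ (l2norm y ^+ 2)); rewrite -sqsumE.
rewrite -[leLHS](@esum_image _ _ _ setT h (fun j => (cabs (y j) ^+ 2)%:E)).
  rewrite [leRHS](esumID (range h)) => [|j _]; last by rewrite lee_fin sqr_ge0.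
  by rewrite setTI leeDl // esum_ge0 // => j _; rewrite lee_fin sqr_ge0.
by move=> i i' _ _ /hI.
Qed.

Definition pull y : ell2 R I := Ell2 (pull_sqsummable y).

(** Extension by 0 of a vector along an injection of index sets; it is isometric
    with adjoint pull. *)
Definition push_fun x (j : J) : C R :=
  if pselect (exists i, h i = j) is left e then x (projT1 (cid e)) else 0.

Lemma push_funE x i : push_fun x (h i) = x i.
Proof.
rewrite /push_fun; case: pselect => [e|[]]; last by exists i.
by congr (x _); apply: hI; exact: (projT2 (cid e)).
Qed.

Lemma push_fun_out x j : (forall i, h i <> j) -> push_fun x j = 0.
Proof. by rewrite /push_fun; case: pselect => // -[i hi] /(_ i). Qed.

Lemma sqsum_push x : sqsum (push_fun x) = sqsum x.
Proof.
rewrite [LHS](esumID (range h)) => [|j _]; last by rewrite lee_fin sqr_ge0.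
rewrite !setTI [X in (_ + X)%E]esum1 ?adde0 => [|j /= hj].
  rewrite esum_image; last by move=> i i' _ _ /hI.
  by apply: eq_esum => i _; rewrite push_funE.
rewrite push_fun_out ?cabs0 ?expr0n // => i hi; apply: hj; by exists i.
Qed.

Fact push_sqsummable x : push_fun x \in @sqsummable R J.
Proof. by apply: (@sqsummable_le _ _ _ (l2norm x ^+ 2)); rewrite -sqsumE sqsum_push. Qed.

Definition push x : ell2 R J := Ell2 (push_sqsummable x).

Lemma pushE x i : push x (h i) = x i. Proof. exact: push_funE. Qed.
Lemma push_out x j : (forall i, h i <> j) -> push x j = 0.
Proof. exact: push_fun_out. Qed.
Lemma pullE y i : pull y i = y (h i). Proof. by []. Qed.

Lemma pushP a x x' : push (a *: x + x') = a *: push x + push x'.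
Proof.
apply: ell2_ext => j; have [[i <-]|nj] := pselect (exists i, h i = j).
  by rewrite ell2D ell2Z !pushE.
rewrite ell2D ell2Z !push_out ?mulr0 ?addr0 // => i hi; apply: nj; by exists i.
Qed.

Lemma l2norm_push x : l2norm (push x) = l2norm x.
Proof. by rewrite /l2norm -(sqsum_push x). Qed.

Lemma push_dot x x' : dot (push x) (push x') = dot x x'.
Proof.
have pD u v : push (u + v) = push u + push v by rewrite -{1}(scale1r u) pushP scale1r.
have pZ a u : push (a *: u) = a *: push u.
  have p0 : push 0 = 0.
    by have := pushP (-1) 0 0; rewrite scaler0 addr0 scaleN1r addNr.
  by rewrite -(addr0 (a *: u)) pushP p0 addr0.
have pB u v : push (u - v) = push u - push v by rewrite pD -scaleN1r pZ scaleN1r.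
by rewrite !dot_polar /polarization -!pZ -!pD -!pB !l2norm_push.
Qed.

Lemma push_pull y : (forall j, (forall i, h i <> j) -> y j = 0) -> push (pull y) = y.
Proof.
move=> y0; apply: ell2_ext => j; have [[i <-]|nj] := pselect (exists i, h i = j).
  by rewrite pushE.
have nj' i : h i <> j by move=> hi; apply: nj; exists i.
by rewrite push_out // y0.
Qed.

End Reindexing.

Lemma dot_push_pull (R : realType) (I J : choiceType) (h : I -> J) (hI : injective h)
    (x : ell2 R I) (y : ell2 R J) : dot (push hI x) y = dot x (pull hI y).
Proof.
rewrite -(push_dot hI); apply: hsum_unique (dot_hsum _ _) _.
apply: eq_hsum (dot_hsum _ _) => j.
have [[i <-]|ni] := pselect (exists i, h i = j); first by rewrite !pushE.
by rewrite [push hI x _]push_out ?mul0r // => i hi; apply: ni; exists i.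
Qed.

(** * Ampliations *)

Section Ampliation.
Variables (R : realType) (I K : choiceType).
Implicit Types (T : op R I) (X Y : ell2 R (I * K)%type) (k : K).

Lemma pair_injl k : injective (fun i : I => (i, k)).
Proof. by move=> i j []. Qed.

Definition fiber X k : ell2 R I := pull (pair_injl (k := k)) X.

Lemma fiberE X k i : fiber X k i = X (i, k). Proof. by []. Qed.
Lemma fiberP a X Y k : fiber (a *: X + Y) k = a *: fiber X k + fiber Y k.
Proof. exact: ell2_ext. Qed.

Lemma sqsum_fibers (f : I * K -> C R) :
  sqsum f = (\esum_(k in [set: K]) sqsum (fun i => f (i, k)))%E.
Proof.
rewrite /sqsum [RHS]esum_esum => [|k i _ _]; last by rewrite lee_fin sqr_ge0.
rewrite (reindex_esum setT setT (fun ki : K * I => (ki.2, ki.1))).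
  by rewrite (_ : _ `*`` _ = setT) //; apply/seteqP; split.
by split=> [|[k i] [k' i'] _ _ [-> ->]|[i k] _] //; exists (k, i).
Qed.

Lemma hsum_fiber_norm X :
  hsum (fun k => rc (l2norm (fiber X k) ^+ 2)) (rc (l2norm X ^+ 2)).
Proof.
apply: hsum_esum => [k|]; first by rewrite sqr_ge0.
rewrite -sqsumE sqsum_fibers; apply: eq_esum => k _.
exact: (esym (sqsumE (fiber X k))).
Qed.

(** Fubini; polarization reduces it to the additivity of squared norms. *)
Lemma dot_fibers X Y : hsum (fun k => dot (fiber X k) (fiber Y k)) (dot X Y).
Proof.
have fD U V k : fiber (U + V) k = fiber U k + fiber V k by exact: ell2_ext.
have fN V k : fiber (- V) k = - fiber V k by exact: ell2_ext.
have fZ a V k : fiber (a *: V) k = a *: fiber V k by exact: ell2_ext.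
have h b V : hsum (fun k => b * rc (l2norm (fiber V k) ^+ 2)) (b * rc (l2norm V ^+ 2)).
  exact/hsumZ/hsum_fiber_norm.
rewrite dot_polar /polarization; have := hsumZ 4^-1
  (hsumD (hsumD (hsum_fiber_norm (X + Y)) (h (-1) (X - Y)))
    (hsumD (h 'i (X + 'i *: Y)) (h (- 'i) (X - 'i *: Y)))).
apply: eq_hsum => k; rewrite dot_polar /polarization.
by rewrite !fD !fN !fZ.
Qed.

Definition amp_fun T X (ik : I * K) : C R := T (fiber X ik.2) ik.1.

(** The operator T (x) 1, acting on each fiber; for bounded T the result is square
    summable and the default value 0 is not reached. *)
Definition amp T X : ell2 R (I * K)%type := insubd 0 (amp_fun T X).

Lemma sqsum_amp T (c : R) X : 0 <= c -> (forall x, l2norm (T x) <= c * l2norm x) ->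
  (sqsum (amp_fun T X) <= (c ^+ 2 * l2norm X ^+ 2)%:E)%E.
Proof.
move=> c0 hc; rewrite sqsum_fibers.
apply: (@le_trans _ _ (\esum_(k in [set: K]) (c ^+ 2 * l2norm (fiber X k) ^+ 2)%:E)%E).
  apply: le_esum => k _; rewrite -[leLHS]/(sqsum (T (fiber X k))) sqsumE lee_fin.
  by rewrite -exprMn ler_pXn2r ?nnegrE ?mulr_ge0 ?l2norm_ge0.
apply: le_trans (sqsum_scale_le _ (fun k => sqr_ge0 (l2norm (fiber X k)))) _.
  exact: sqr_ge0.
have -> : ((c ^+ 2 * l2norm X ^+ 2)%:E = (c ^+ 2)%:E * sqsum X)%E.
  by rewrite sqsumE.
rewrite sqsum_fibers; apply: lee_pmul => //.
- by rewrite lee_fin sqr_ge0.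
- by apply: esum_ge0 => k _; rewrite lee_fin sqr_ge0.
- by apply: le_esum => k _; rewrite -sqsumE.
Qed.

Section BoundedAmp.
Variables (T : op R I) (TB : bounded_op R I T).

Lemma ampE X i k : amp T X (i, k) = T (fiber X k) i.
Proof.
have [_ [c c0 hc]] := (bounded_opP T).1 TB.
by rewrite /amp insubdK //; apply: sqsummable_le (sqsum_amp X c0 hc).
Qed.

Lemma fiber_amp X k : fiber (amp T X) k = T (fiber X k).
Proof. by apply: ell2_ext => i; rewrite fiberE ampE. Qed.

Lemma l2norm_amp (c : R) X : 0 <= c -> (forall x, l2norm (T x) <= c * l2norm x) ->
  l2norm (amp T X) <= c * l2norm X.
Proof.
move=> c0 hc; apply: l2norm_le; first by rewrite mulr_ge0 ?l2norm_ge0.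
rewrite -lee_fin -sqsumE exprMn; apply: le_trans (sqsum_amp X c0 hc).
rewrite le_eqVlt; apply/orP; left; apply/eqP; congr sqsum.
by apply/funext => -[i k]; exact: ampE.
Qed.

Lemma bounded_amp : bounded_op R (I * K)%type (amp T).
Proof.
have [_ [c c0 hc]] := (bounded_opP T).1 TB; apply/bounded_opP; split.
  by move=> a X Y; apply: ell2_ext => -[i k]; rewrite ell2D ell2Z !ampE fiberP opP.
by exists c => // X; apply: l2norm_amp.
Qed.

End BoundedAmp.

Lemma amp_comp S T X : bounded_op R I S -> bounded_op R I T ->
  amp (S \o T) X = amp S (amp T X).
Proof.
move=> SB TB; apply: ell2_ext => -[i k].
by rewrite !ampE ?fiber_amp //; exact: bounded_comp.
Qed.

Lemma amp_lin a S T X : bounded_op R I S -> bounded_op R I T ->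
  amp (a *: S + T) X = a *: amp S X + amp T X.
Proof.
move=> SB TB; apply: ell2_ext => -[i k]; rewrite ell2D ell2Z.
by rewrite !ampE //; exact: bounded_lin.
Qed.

End Ampliation.

(** * Tensor products of operators *)

Section TensorProduct.
Variables (R : realType) (I J : choiceType).
Implicit Types (x : ell2 R I) (y : ell2 R J).

Lemma tensorE x y i j : tensor_vec x y (i, j) = x i * y j. Proof. by []. Qed.

Lemma fiber_tensor x y j : fiber (tensor_vec x y) j = y j *: x.
Proof. by apply: ell2_ext => i; rewrite fiberE tensorE ell2Z mulrC. Qed.

Lemma dot_tensor x x' y y' :
  dot (tensor_vec x y) (tensor_vec x' y') = dot x x' * dot y y'.
Proof.
apply: hsum_unique (dot_fibers _ _) _; apply: eq_hsum (hsumZ _ (dot_hsum y y')) => j.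
by rewrite !fiber_tensor dotZl dotZr; ring.
Qed.

Lemma swap_inj (A B : Type) : injective (fun ab : A * B => (ab.2, ab.1)).
Proof. by move=> [a b] [a' b'] [-> ->]. Qed.

(** A (x) B is the product of A (x) 1 and 1 (x) B; the latter is an ampliation
    conjugated by the flip of the two factors. *)
Lemma tensor_op_exists (A : op R I) (B : op R J) :
  bounded_op R I A -> bounded_op R J B ->
  exists T, bounded_op R (I * J)%type T /\
    forall x y, T (tensor_vec x y) = tensor_vec (A x) (B y).
Proof.
move=> AB BB.
pose swJ := pull (@swap_inj I J) : ell2 R (J * I)%type -> ell2 R (I * J)%type.
pose swI := pull (@swap_inj J I) : ell2 R (I * J)%type -> ell2 R (J * I)%type.
have nJ Z : l2norm (swJ Z) <= l2norm Z.
  apply: l2norm_le; first exact: l2norm_ge0.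
  by rewrite -(l2norm_push (@swap_inj I J) (swJ Z)) push_pull // => -[j i] /(_ (i, j)).
have nI Z : l2norm (swI Z) <= l2norm Z.
  apply: l2norm_le; first exact: l2norm_ge0.
  by rewrite -(l2norm_push (@swap_inj J I) (swI Z)) push_pull // => -[j i] /(_ (i, j)).
pose T1 : op R (I * J)%type := fun Z => swJ (amp B (swI Z)).
have T1B : bounded_op R (I * J)%type T1; rewrite /T1.
  have [_ [c c0 hc]] := (bounded_opP _).1 (bounded_amp I BB).
  apply/bounded_opP; split=> [a X Y|].
    have -> : swI (a *: X + Y) = a *: swI X + swI Y by exact: ell2_ext.
    by rewrite (opP (bounded_amp I BB)); exact: ell2_ext.
  exists c => // Z; apply: le_trans (nJ _) _; apply: le_trans (hc _) _.
  by rewrite ler_wpM2l.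
exists (amp A \o T1); split; first exact/bounded_comp/T1B/bounded_amp.
move=> x y; rewrite /= (_ : T1 _ = tensor_vec x (B y)).
  apply: ell2_ext => -[i j]; rewrite ampE // fiber_tensor (opZ AB) ell2Z.
  by rewrite tensorE mulrC.
apply: ell2_ext => -[i j]; rewrite /T1 pullE /= ampE //.
rewrite (_ : fiber _ _ = x i *: y) ?(opZ BB) ?ell2Z ?tensorE //.
by apply: ell2_ext => j'; rewrite fiberE pullE ell2Z /=.
Qed.

Lemma tensor_opP (A : op R I) (B : op R J) :
  bounded_op R I A -> bounded_op R J B ->
  bounded_op R (I * J)%type (tensor_op A B) /\
    forall x y, tensor_op A B (tensor_vec x y) = tensor_vec (A x) (B y).
Proof.
move=> AB BB; have [T PT] := tensor_op_exists AB BB.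
rewrite /tensor_op; case: xgetP => [T' _ //|noT].
by case: (noT T PT).
Qed.

End TensorProduct.
(** * Weak topologies *)

Lemma cvg_sumC (R : realType) (T U : Type) (F : set_system T) (FF : Filter F)
    (s : seq U) (g : U -> T -> C R) (l : U -> C R) :
  (forall t, g t @ F --> l t) ->
  (fun x => \sum_(t <- s) g t x) @ F --> \sum_(t <- s) l t.
Proof.
move=> gl; elim: s => [|t s IH].
  under eq_fun do rewrite big_nil.
  by rewrite big_nil; exact: cvg_cst.
under eq_fun do rewrite big_cons.
by rewrite big_cons; exact: cvgD (gl t) IH.
Qed.

Section WeakTopology.
Variables (R : realType) (E : choiceType) (F : set (E -> C R)).
Let ev (T : E) : {ptws F -> C R} := fun w => sval w T.

(** Evaluation at a coordinate is continuous for pointwise convergence. *)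
Lemma weakly_continuous f : F f -> continuous (f : weakly F -> C R).
Proof.
move=> Ff A V; pose w : F := exist _ f (mem_set Ff).
have evA : nbhs (ev A) --> ev A by [].
have /cvg_sup/(_ w)/cvg_image wA := evA.
have surj : (fun g : F -> C R => g w) @` setT = setT.
  by rewrite eqEsubset; split=> v // _; exists (fun=> v).
have {surj}wA := wA surj.
move=> /wA[W AW WV]; have := @initial_continuous E {ptws F -> C R} ev A W AW.
apply: (@filterS _ (nbhs (A : weakly F))) => T TW.
by change (V (ev T w)); rewrite -WV; exists (ev T).
Qed.

(** Applied to the filter generated by prospective neighbourhoods of A, this shows
    that they contain the neighbourhoods of the topology. *)
Lemma cvg_weakly (G : set_system E) (A : E) : Filter G ->
  (forall f, F f -> f @ G --> f A) -> G --> (A : weakly F).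
Proof.
move=> FG Gf U; rewrite nbhsE => -[V1 [[V2 V2op <-] V2A] VU].
have evG : ev @ G --> ev A.
  apply/cvg_sup => w; apply/cvg_image.
    by rewrite eqEsubset; split=> v // _; exists (fun=> v).
  move=> V; rewrite nbhs_simpl => /(Gf _ (set_mem (svalP w))) GV.
  exists ((fun g => g w) @^-1` V) => //.
  rewrite eqEsubset; split=> [_ [g gV <-] //|v Vv]; by exists (fun=> v).
apply: filterS VU _; apply: evG.
exact: open_nbhs_nbhs.
Qed.

End WeakTopology.

Lemma weakly_closure_eq (R : realType) (E : choiceType) (F : set (E -> C R))
    (X : set E) f g (A : E) :
  F f -> F g -> (forall B : E, X B -> f B = g B) -> closure (X : set (weakly F)) A ->
  f A = g A.
Proof.
move=> Ff Fg fg clA; apply/eqP; rewrite -subr_eq0; apply/eqP.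
apply: cabs_small => e e0; have e20 : 0 < e / 2 by rewrite divr_gt0.
have cf h : F h -> nbhs (A : weakly F) [set B | cabs (h A - h B) < e / 2].
  move=> Fh; have FF : Filter (nbhs (A : weakly F)) by apply: nbhs_filter.
  by have := (cvgCP FF h (h A)).1 (weakly_continuous Fh (x := A)) _ e20.
have [B [XB [/= h1 h2]]] := clA _ (filterI (cf f Ff) (cf g Fg)).
have -> : f A - g A = (f A - f B) + (g B - g A) by rewrite (fg _ XB); ring.
rewrite (le_trans (cabsD _ _)) // (splitr e) lerD ?(ltW h1) //.
by rewrite cabsB ltW.
Qed.

(** * Normal functionals and preduals *)

Section NormalFunctionals.
Variables (R : realType) (I : choiceType).
Implicit Types (T : op R I) (S : set (op R I)).

(** On bounded operators the normal functionals are the vector functionals of the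
    ampliations: two square-summable sequences of vectors are the same thing as two
    vectors over a product index set. Sums and tensor products of functionals then
    become operations on vectors. *)
Definition nform (K : choiceType) (X Y : ell2 R (I * K)%type) T : C R :=
  dot (amp T X) Y.

Lemma nform_lin (K : choiceType) (X Y : ell2 R (I * K)%type) a (T' T : op R I) :
  bounded_op R I T' -> bounded_op R I T ->
  nform X Y (a *: T' + T) = a * nform X Y T' + nform X Y T.
Proof. by move=> SB TB; rewrite /nform amp_lin // dotDl dotZl. Qed.

Lemma nform_sum (K : choiceType) (X Y : ell2 R (I * K)%type) (U : Type)
    (s : seq U) (a : U -> C R) (f : U -> op R I) :
  (forall t, bounded_op R I (f t)) ->
  nform X Y (\sum_(t <- s) a t *: f t) = \sum_(t <- s) a t * nform X Y (f t).
Proof.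
move=> fB; elim: s => [|t s IH].
  rewrite !big_nil; have := nform_lin X Y (-1) (@bounded_0 R I) (@bounded_0 R I).
  rewrite scaler0 addr0 mulN1r addNr; exact.
by rewrite !big_cons nform_lin ?IH //; exact: bounded_sum.
Qed.

Fact glue_sqsummable (x : nat -> ell2 R I) :
  (\sum_(0 <= n <oo) (l2norm (x n) ^+ 2)%:E < +oo)%E ->
  (fun ik : I * nat => x ik.2 ik.1) \in @sqsummable R (I * nat)%type.
Proof.
rewrite /sqsummable /in_mem /= sqsum_fibers nneseries_esumT => [h|n].
  by rewrite (eq_esum (b := fun n => (l2norm (x n) ^+ 2)%:E)) // => n _;
     rewrite -sqsumE.
by rewrite lee_fin sqr_ge0.
Qed.

Lemma normal_nform f : normal_functional f ->
  exists X Y : ell2 R (I * nat)%type, forall T, bounded_op R I T -> f T = nform X Y T.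
Proof.
move=> [x [y [xs ys ->]]].
exists (Ell2 (glue_sqsummable xs)), (Ell2 (glue_sqsummable ys)) => T TB.
apply: hsum_sum; apply: eq_hsum (dot_fibers _ _) => n.
rewrite fiber_amp //; congr (dot (T _) _); exact: ell2_ext.
Qed.

Lemma nform_nat_normal (X Y : ell2 R (I * nat)%type) :
  exists2 f, normal_functional f & forall T, bounded_op R I T -> f T = nform X Y T.
Proof.
have fin (Z : ell2 R (I * nat)%type) :
    (\sum_(0 <= n <oo) (l2norm (fiber Z n) ^+ 2)%:E < +oo)%E.
  rewrite nneseries_esumT => [|n]; last by rewrite lee_fin sqr_ge0.
  rewrite (eq_esum (b := fun n => sqsum (fiber Z n))) => [|n _]; last by rewrite sqsumE.
  by rewrite -[X in (X < _)%E](sqsum_fibers Z); exact: (ell2P Z).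
exists (fun T => summability.sum (fun n => dot (T (fiber X n)) (fiber Y n))).
  by exists (fiber X), (fiber Y); split.
move=> T TB; apply: hsum_sum; apply: eq_hsum (dot_fibers _ _) => n.
by rewrite fiber_amp.
Qed.

Section Relabel.
Variables (K L : choiceType) (h : K -> L) (hI : injective h).

Lemma relabel_inj : injective (fun ik : I * K => (ik.1, h ik.2)).
Proof. by move=> [i k] [i' k'] [-> /hI ->]. Qed.

Lemma amp_push T (X : ell2 R (I * K)%type) : bounded_op R I T ->
  amp T (push relabel_inj X) = push relabel_inj (amp T X).
Proof.
move=> TB; apply: ell2_ext => -[i l]; rewrite ampE //.
have [[k <-]|nl] := pselect (exists k, h k = l).
  rewrite (pushE relabel_inj _ (i, k)) ampE //; congr (T _ _).
  by apply: ell2_ext => j; rewrite fiberE (pushE relabel_inj _ (j, k)).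
rewrite [RHS]push_out => [|[j k] [_ kl]]; last by apply: nl; exists k.
rewrite (_ : fiber _ _ = 0) ?op0 //; apply: ell2_ext => j.
by rewrite fiberE push_out // => -[j' k] [_ kl]; apply: nl; exists k.
Qed.

End Relabel.

Lemma dot_push_disjoint (A B J : choiceType) (g : A -> J) (h : B -> J)
    (gI : injective g) (hI : injective h) (x : ell2 R A) (y : ell2 R B) :
  (forall a b, g a <> h b) -> dot (push gI x) (push hI y) = 0.
Proof.
move=> gh; apply: hsum_unique (dot_hsum _ _) _.
apply: (@eq_hsum _ _ (fun=> 0)); last by have := @hsum_fset R J fset0 (fun=> 0);
  rewrite big_nil; apply.
move=> j; have [[a <-]|na] := pselect (exists a, g a = j).
  by rewrite [push hI y _]push_out ?rmorph0 ?mulr0 // => b /esym /gh.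
by rewrite push_out ?mul0r // => a ga; apply: na; exists a.
Qed.

Section Predual.
Variables (S : set (op R I)) (SB : S `<=` bounded_op R I).

Lemma predualP phi : predual S phi ->
  exists X Y : ell2 R (I * nat)%type, phi = patch (fun=> 0) S (nform X Y).
Proof.
move=> [f /normal_nform[X [Y fE]] <-]; exists X, Y; apply/funext => T.
by rewrite /patch; case: ifPn => // /set_mem/SB/fE.
Qed.

(** A countable index set embeds into nat, and T (x) 1 commutes with the
    relabelling. *)
Lemma predual_nform (K : countType) (X Y : ell2 R (I * K)%type) :
  predual S (patch (fun=> 0) S (nform X Y)).
Proof.
pose p := relabel_inj (pcan_inj (@choice.pickleK K)).
have [f fn fE] := nform_nat_normal (push p X) (push p Y).
exists f => //; apply/funext => T; rewrite /patch; case: ifPn => // /set_mem/SB TB.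
by rewrite fE // /nform amp_push // push_dot.
Qed.

Lemma predual_ext phi psi : predual S phi -> predual S psi ->
  (forall A, S A -> phi A = psi A) -> phi = psi.
Proof.
move=> [f _ <-] [g _ <-] h; apply/funext => A.
by have := h A; rewrite /patch; case: ifPn => // /set_mem SA; apply.
Qed.

Lemma predual_out phi A : predual S phi -> ~ S A -> phi A = 0.
Proof. by move=> [f _ <-] SA; rewrite /patch memNset. Qed.

Lemma patch_in (f : op R I -> C R) A : S A -> patch (fun=> 0) S f A = f A.
Proof. by move=> SA; rewrite /patch mem_set. Qed.

(** The two pairs of vectors are placed side by side on disjoint copies of nat. *)
Lemma predual_lin a phi psi : predual S phi -> predual S psi ->
  predual S (fun A => a * phi A + psi A).
Proof.
move=> /predualP[X [Y ->]] /predualP[X' [Y' ->]].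
pose h b : injective (fun n : nat => (b, n) : bool * nat) := fun n m e => congr1 snd e.
pose p b := relabel_inj (h b).
have disj (u v : I * nat) b : (u.1, (b, u.2)) <> (v.1, (~~ b, v.2)) :> I * (bool * nat).
  by move=> [_]; case: b.
rewrite (_ : (fun A => _) = patch (fun=> 0) S
    (nform (a *: push (p true) X + push (p false) X') (push (p true) Y + push (p false) Y'))).
  exact: predual_nform.
apply/funext => A; rewrite /patch; case: ifPn => [/set_mem/SB AB|_]; last first.
  by rewrite mulr0 addr0.
rewrite /nform (opP (bounded_amp _ AB)) !amp_push //.
rewrite dotDl !dotDr !dotZl !push_dot.
rewrite (dot_push_disjoint (p true) (p false)) => [|u v]; last exact: (disj u v true).
rewrite (dot_push_disjoint (p false) (p true)) => [|u v]; last exact: (disj u v false).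
by rewrite mulr0 addr0 add0r.
Qed.

Lemma predual0 : predual S (fun=> 0).
Proof.
rewrite (_ : (fun=> 0) = patch (fun=> 0) S (nform (0 : ell2 R (I * nat)%type) 0)).
  exact: predual_nform.
by apply/funext => A; rewrite /patch /nform dot0r; case: ifP.
Qed.

Lemma predual_scale a phi : predual S phi -> predual S (fun A => a * phi A).
Proof.
move=> /(predual_lin a)/(_ predual0); congr predual.
by apply/funext => A; rewrite addr0.
Qed.

Lemma predual_mulr phi B : predual S phi -> bounded_op R I B ->
  (forall A, S A -> S (A \o B)) ->
  predual S (patch (fun=> 0) S (fun A => phi (A \o B))).
Proof.
move=> /predualP[X [Y ->]] BB SBc.
rewrite (_ : patch _ _ _ = patch (fun=> 0) S (nform (amp B X) Y)).
  exact: predual_nform.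
apply/funext => A; rewrite /patch; case: ifPn => // /set_mem SA.
by rewrite (mem_set (SBc _ SA)) /nform (amp_comp X (SB SA) BB).
Qed.

Lemma predual_mull phi B : predual S phi -> bounded_op R I B ->
  (forall A, S A -> S (B \o A)) ->
  predual S (patch (fun=> 0) S (fun A => phi (B \o A))).
Proof.
move=> /predualP[X [Y ->]] BB SBc; have [Z YZ] := adjoint_vector (bounded_amp _ BB) Y.
rewrite (_ : patch _ _ _ = patch (fun=> 0) S (nform X Z)); first exact: predual_nform.
apply/funext => A; rewrite /patch; case: ifPn => // /set_mem SA.
by rewrite (mem_set (SBc _ SA)) /nform (amp_comp X BB (SB SA)) YZ.
Qed.

Lemma predual_vector x y : predual S (patch (fun=> 0) S (fun A => dot (A x) y)).
Proof.
rewrite (_ : patch _ _ _ = patch (fun=> 0) S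
   (nform (tensor_vec x (delta tt : ell2 R unit)) (tensor_vec y (delta tt)))).
  exact: predual_nform.
apply/funext => A; rewrite /patch; case: ifPn => // /set_mem/SB AB.
rewrite /nform (_ : amp A _ = tensor_vec (A x) (delta tt)).
  by rewrite dot_tensor dot_delta deltaE eqxx mulr1.
apply: ell2_ext => -[i []]; rewrite ampE // fiber_tensor (opZ AB) tensorE ell2Z.
by rewrite deltaE eqxx mulr1 mul1r.
Qed.

Lemma predual_separates A B : S A -> S B ->
  (forall phi, predual S phi -> phi A = phi B) -> A = B.
Proof.
move=> SA SB' h; apply/funext => x; apply/eqP; rewrite -subr_eq0; apply/eqP.
apply: dot_eq0 => y; rewrite dotBl; apply/eqP; rewrite subr_eq0; apply/eqP.
by have := h _ (predual_vector x y); rewrite !patch_in.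
Qed.

Lemma predual_linear phi a A B : predual S phi -> S A -> S B -> S (a *: A + B) ->
  phi (a *: A + B) = a * phi A + phi B.
Proof.
move=> /predualP[X [Y ->]] SA SB' SAB; rewrite !patch_in // nform_lin //; exact: SB.
Qed.

End Predual.
End NormalFunctionals.
(** * Weak-star continuous functionals are normal *)

Section ContinuousFunctionals.
Variables (R : realType) (I : choiceType).
Variables (S : set (op R I)) (SB : S `<=` bounded_op R I).
Hypotheses (S0 : S 0) (SL : forall a A B, S A -> S B -> S (a *: A + B)).

(** A functional vanishing on a common kernel is a combination of the functionals
    that cut it out. Induction on their number: restrict to the kernel of the first
    one, then correct by a multiple of it. *)
Lemma predual_ker (fs : seq (op R I -> C R)) (S' : set (op R I)) (g : op R I -> C R) :
  S' `<=` S -> S' 0 -> (forall a A B, S' A -> S' B -> S' (a *: A + B)) ->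
  (forall f, f \in fs -> predual S f) -> linear_on S' g ->
  (forall A, S' A -> (forall f, f \in fs -> f A = 0) -> g A = 0) ->
  exists2 psi, predual S psi & forall A, S' A -> psi A = g A.
Proof.
elim: fs S' => [|f fs IH] S' sub z lin fsP gL g0.
  by exists (fun=> 0) => [|A SA]; [exact: predual0 | rewrite g0].
have fP : predual S f by apply: fsP; rewrite mem_head.
have fL a A B : S' A -> S' B -> f (a *: A + B) = a * f A + f B.
  by move=> /sub SA /sub SB'; apply: (predual_linear SB) => //; exact: SL.
pose S'' := [set A | S' A /\ f A = 0].
have f0 : f 0 = 0.
  have := fL (-1) 0 0 z z; rewrite scaler0 addr0 mulN1r addNr.
  by [].
have [psi psiP psig] : exists2 psi, predual S psi & forall A, S'' A -> psi A = g A.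
  apply: IH => [A [/sub] //| |a A B [SA fA] [SB' fB]|h hf|a A B [SA _] [SB' _]|A [SA fA] hA].
  - by [].
  - by split; [exact: lin | rewrite fL // fA fB mulr0 addr0].
  - by apply: fsP; rewrite in_cons hf orbT.
  - exact: gL.
  - by apply: g0 => // h; rewrite in_cons => /orP[/eqP ->|/hA].
have [[T [ST fT]]|nT] := pselect (exists T, S' T /\ f T <> 0); last first.
  exists psi => // A SA; apply: psig; split=> //; apply: contrapT => fA.
  by apply: nT; exists A.
(* The coefficient of f is the one that makes both sides agree at T. *)
exists (fun A => (g T - psi T) / f T * f A + psi A); first exact: predual_lin.
move=> A SA; pose c := - (f A / f T).
have fT0 : f T != 0 by apply/eqP.
have SD : S'' (c *: T + A) by split; [exact: lin | rewrite fL // /c; field].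
have := psig _ SD; rewrite gL // (predual_linear SB) //; last 3 first.
- exact: sub.
- exact: sub.
- by apply: SL; exact: sub.
move=> h; have -> : psi A = c * g T + g A - c * psi T by rewrite -h; ring.
rewrite /c; field.
by [].
Qed.

(** The sets on the right form a filter along which every normal functional tends
    to its value at 0; hence this filter converges to 0. *)
Lemma wstar_nbhs0 (U : set (op R I)) : nbhs (0 : wstar R I) U ->
  exists2 fs : seq (op R I -> C R), (forall f, f \in fs -> normal_functional f) &
  exists2 e : R, 0 < e &
  forall T, (forall f, f \in fs -> cabs (f 0 - f T) < e) -> U T.
Proof.
pose B : set_system (op R I) := [set U |
  exists2 fs : seq (op R I -> C R), (forall f, f \in fs -> normal_functional f) &
  exists2 e : R, 0 < e &
  forall T, (forall f, f \in fs -> cabs (f 0 - f T) < e) -> U T].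
have BF : Filter B.
  split.
  - by exists [::] => //; exists 1.
  - move=> V W [fs fsn [e e0 eV]] [gs gsn [r r0 rW]]; exists (fs ++ gs).
      by move=> f; rewrite mem_cat => /orP[/fsn|/gsn].
    exists (Num.min e r); first by rewrite lt_min e0.
    move=> T hT; split; [apply: eV | apply: rW] => f fi.
      by have := hT f; rewrite mem_cat fi lt_min => /(_ isT)/andP[].
    by have := hT f; rewrite mem_cat fi orbT lt_min => /(_ isT)/andP[].
  - move=> V W VW [fs fsn [e e0 eV]]; exists fs => //; exists e => // T /eV.
    exact: VW.
have B0 : B --> (0 : weakly (@normal_functional R I)).
  apply: cvg_weakly => f fn; apply/cvgCP => e e0; exists [:: f].
    by move=> h; rewrite inE => /eqP ->.
  by exists e => // T; apply; rewrite mem_head.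
exact: B0.
Qed.

(** The unit ball of g contains a basic neighbourhood of 0 in S; by homogeneity g
    vanishes on the common kernel of the finitely many functionals defining it. *)
Lemma wstar_continuous_predual (g : op R I -> C R) : linear_on S g ->
  g @ within S (nbhs (0 : wstar R I)) --> g 0 ->
  predual S (patch (fun=> 0) S g).
Proof.
move=> gL gc; have g0 : g 0 = 0.
  have := gL (-1) 0 0 S0 S0; rewrite scaler0 addr0 scaleN1r addNr.
  by [].
have {gc} : nbhs (0 : wstar R I) [set T | S T -> cabs (g 0 - g T) < 1].
  have FF : Filter (within S (nbhs (0 : wstar R I))) by exact: within_filter.
  by have := (cvgCP FF g (g 0)).1 gc 1 ltr01.
move=> /wstar_nbhs0[fs fsn [e e0 he]].
pose rs f : op R I -> C R := patch (fun=> 0) S f.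
have [|||f|||psi psiP psig] := @predual_ker (map rs fs) S g => //.
- by move=> /mapP[h /fsn hn ->]; exists h.
- move=> A SA fA; apply: cabs_eq0; apply/eqP; rewrite eq_le cabs_ge0 andbT.
  rewrite leNgt; apply/negP => gA.
  pose c := rc (cabs (g A))^-1.
  have ScA : S (c *: A) by rewrite -(addr0 (c *: A)); exact: SL.
  have gZ : g (c *: A) = c * g A.
    by rewrite -[c *: A]addr0 gL // g0 addr0.
  have : (forall f, f \in fs -> cabs (f 0 - f (c *: A)) < e) ->
      cabs (g 0 - g (c *: A)) < 1 by move=> /he; apply.
  rewrite g0 sub0r gZ.
  rewrite (_ : cabs (- (c * g A)) = 1) ?ltxx; last first.
    rewrite [cabs _]normcN -[Normc.normc _]/(cabs _) cabsM cabs_rc ger0_norm.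
      by rewrite mulVf // gt_eqF.
    by rewrite invr_ge0 cabs_ge0.
  move=> h; suff : false by []; apply: h => // f ff.
  have rP : predual S (rs f) by exists f => //; exact: fsn.
  have r0 : rs f 0 = 0.
    have := predual_linear SB rP (a := -1) S0 S0.
    rewrite scaler0 addr0 mulN1r addNr; exact.
  have fA0 : rs f A = 0 by apply: fA; apply: map_f.
  have := predual_linear SB rP (a := c) SA S0; rewrite addr0 => /(_ ScA).
  rewrite fA0 r0 mulr0 addr0 /rs patch_in // => ->.
  by move: r0; rewrite /rs patch_in // => ->; rewrite subrr cabs0.
rewrite (_ : patch _ _ _ = psi) //; apply/funext => A; rewrite /patch.
case: ifPn => [/set_mem/psig //|/negP nS]; rewrite (predual_out psiP) // => SA.
by apply: nS; exact: mem_set.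
Qed.

Lemma normal_comp_cvg (J : choiceType) (D : op R I -> op R J) f A :
  wstar_continuous_on S D -> S A -> normal_functional f ->
  (f \o D) @ within S (nbhs (A : wstar R I)) --> f (D A).
Proof.
move=> /subspace_continuousP Dc SA fn.
apply: (@cvg_comp _ _ _ D f _ (nbhs (D A : wstar R J))); first exact: (Dc A SA).
exact: (@weakly_continuous R (op R J) (@normal_functional R J) f fn (D A)).
Qed.

End ContinuousFunctionals.

(** * Tensor products of functionals *)

Section TensorFunctional.
Variables (R : realType) (I : choiceType).
Variables (S : set (op R I)) (SB : S `<=` bounded_op R I).

Lemma eq_tensor_functional phi phi' psi psi' :
  (forall A, S A -> phi A = phi' A) -> (forall A, S A -> psi A = psi' A) ->
  tensor_functional S S phi psi = tensor_functional S S phi' psi'.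
Proof.
move=> e1 e2; congr xget; apply/funext => w; apply/propext.
by split=> -[wP wE]; split=> // A B SA SB'; rewrite wE // ?e1 ?e2.
Qed.

Lemma wstar_tensor_bounded : wstar_tensor S S `<=` bounded_op R (I * I)%type.
Proof. by move=> T []. Qed.

Lemma tensor_in_wstar_tensor A B : S A -> S B -> wstar_tensor S S (tensor_op A B).
Proof.
move=> SA SB'; split; first by have [] := tensor_opP (SB SA) (SB SB').
apply: subset_closure; exists 1%N, (fun=> 1), (fun=> tensor_op A B).
by split=> [_|]; [exists A, B | rewrite big_ord_recl big_ord0 addr0 scale1r].
Qed.

Lemma mid_swap_inj (A B A' B' : Type) :
  injective (fun p : (A * B) * (A' * B') => ((p.1.1, p.2.1), (p.1.2, p.2.2))).
Proof. by move=> [[a b] [a' b']] [[c e] [c' e']] [-> -> -> ->]. Qed.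

(** On an elementary tensor the vector functional of the ampliation given by
    X (x) X' and Y (x) Y' factors, once the four tensor legs are regrouped. *)
Lemma tensor_functionalP phi psi : predual S phi -> predual S psi ->
  predual (wstar_tensor S S) (tensor_functional S S phi psi) /\
  forall A B, S A -> S B ->
    tensor_functional S S phi psi (tensor_op A B) = phi A * psi B.
Proof.
move=> /(predualP SB)[X [Y ->]] /(predualP SB)[X' [Y' ->]].
pose mid := @mid_swap_inj I I nat nat.
pose m (U V : ell2 R (I * nat)%type) : ell2 R ((I * I) * (nat * nat))%type :=
  pull mid (tensor_vec U V).
have dot_m U V U' V' : dot (m U V) (m U' V') = dot U U' * dot V V'.
  rewrite -(push_dot mid) !push_pull ?dot_tensor // => -[[i k] [j l]];
  by move=> /(_ ((i, j), (k, l))).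
suff ex : exists w, predual (wstar_tensor S S) w /\ forall A B, S A -> S B ->
    w (tensor_op A B) = patch (fun=> 0) S (nform X Y) A * patch (fun=> 0) S (nform X' Y') B.
  rewrite /tensor_functional; case: xgetP => [w _ //|now].
  by have [w wP] := ex; case: (now w wP).
exists (patch (fun=> 0) (wstar_tensor S S) (nform (m X X') (m Y Y'))).
split; first exact/predual_nform/wstar_tensor_bounded.
move=> A B SA SB'; rewrite !patch_in //; last exact: tensor_in_wstar_tensor.
have [TB TE] := tensor_opP (SB SA) (SB SB').
rewrite /nform -dot_m; congr dot; apply: ell2_ext => -[[i j] [k l]].
rewrite [RHS](_ : _ = amp A X (i, k) * amp B X' (j, l)) // ampE //.
rewrite (ampE (SB SA)) (ampE (SB SB')) -tensorE -TE.
congr (ell2_val (tensor_op A B _) (i, j)); by apply: ell2_ext => -[i' j'].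
Qed.

End TensorFunctional.
(** * Uniform approximation of bounded operators *)

Section UniformApproximation.
Variables (R : realType) (I : choiceType).
Implicit Types (x y : ell2 R I) (T : op R I).

Definition norm_le T (c : R) := forall x, l2norm (T x) <= c * l2norm x.

(** The finite set A depends on T only through the bound c. *)
Lemma trunc_form_approx (c e : R) x y : 0 <= c -> 0 < e ->
  exists A : {fset I}, forall T, bounded_op R I T -> norm_le T c ->
    cabs (dot (T x) y - dot (T (trunc A x)) (trunc A y)) <= e.
Proof.
move=> c0 e0; pose M := c * (l2norm x + l2norm y) + 1.
have M0 : 0 < M by rewrite ltr_wpDl // mulr_ge0 // addr_ge0 ?l2norm_ge0.
have [A hA] := trunc_approx x (divr_gt0 e0 M0).
have [B hB] := trunc_approx y (divr_gt0 e0 M0).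
exists (A `|` B)%fset => T TB Tc; set D := (A `|` B)%fset.
have {}hA := hA D (fsubsetUl _ _); have {}hB := hB D (fsubsetUr _ _).
have -> : dot (T x) y - dot (T (trunc D x)) (trunc D y) =
    dot (T (x - trunc D x)) (trunc D y) + dot (T x) (y - trunc D y).
  by rewrite (opB TB) dotBl dotBr; ring.
apply: le_trans (cabsD _ _) _.
have h1 : cabs (dot (T (x - trunc D x)) (trunc D y)) <= c * (e / M) * l2norm y.
  apply: le_trans (cauchy_schwarz _ _) _; apply: ler_pM; rewrite ?l2norm_ge0 //.
    by apply: le_trans (Tc _) _; rewrite ler_wpM2l.
  exact: l2norm_cutoff.
have h2 : cabs (dot (T x) (y - trunc D y)) <= c * l2norm x * (e / M).
  by apply: le_trans (cauchy_schwarz _ _) _; apply: ler_pM; rewrite ?l2norm_ge0.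
apply: le_trans (lerD h1 h2) _.
have -> : c * (e / M) * l2norm y + c * l2norm x * (e / M) = (M - 1) * (e / M).
  by rewrite /M; ring.
apply: (@le_trans _ _ (M * (e / M))); last by rewrite mulrC divfK // gt_eqF.
by rewrite ler_wpM2r ?divr_ge0 ?(ltW e0) ?(ltW M0) // gerBl.
Qed.

Lemma trunc_form T (A : {fset I}) x y : bounded_op R I T ->
  dot (T (trunc A x)) (trunc A y) =
  \sum_(i <- A) \sum_(j <- A) x i * (y j)^* * T (delta i) j.
Proof.
move=> TB; rewrite trunc_sum (op_sum TB) dot_suml; apply: eq_bigr => i _.
rewrite (opZ TB) dotZl trunc_sum dot_sumr mulr_sumr; apply: eq_bigr => j _.
by rewrite dotZr dot_delta mulrA.
Qed.

(** Test against the multiple of T x that has the same norm as x. *)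
Lemma norm_le_form T (c : R) : bounded_op R I T -> 0 <= c ->
  (forall x y, cabs (dot (T x) y) <= c * (l2norm x ^+ 2 + l2norm y ^+ 2) / 2) ->
  norm_le T c.
Proof.
move=> TB c0 h x; have [x0|x0] := eqVneq (l2norm x) 0.
  by rewrite (l2norm_eq0 x0) (op0 TB) !l2norm0 mulr0.
have nx : 0 < l2norm x by rewrite lt0r x0 l2norm_ge0.
have [t0|t0] := eqVneq (l2norm (T x)) 0; first by rewrite t0 mulr_ge0 // ltW.
have nt : 0 < l2norm (T x) by rewrite lt0r t0 l2norm_ge0.
have := h x (rc (l2norm x / l2norm (T x)) *: T x).
rewrite dotZr dotxx conj_rc -rcM cabs_rc ger0_norm; last first.
  by rewrite mulr_ge0 ?sqr_ge0 // divr_ge0 // ltW.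
rewrite l2normZ cabs_rc ger0_norm; last by rewrite divr_ge0 // ltW.
rewrite divfK // -[_ + _]mulr2n -[_ *+ 2]mulr_natr mulrA mulfK ?pnatr_eq0 //.
rewrite (_ : l2norm x / l2norm (T x) * l2norm (T x) ^+ 2 = l2norm (T x) * l2norm x).
  by rewrite expr2 mulrA ler_pM2r.
by field.
Qed.

End UniformApproximation.

(** * The free semigroup algebra *)

Section FreeSemigroupAlgebraTheory.
Variables (R : realType) (d : nat).
Local Notation word := (seq 'I_d).
Local Notation opF := (op R word).
Local Notation shift := (@Defs.shift R d).
Local Notation dl w := (delta w : ell2 R word).
Local Notation vac := (delta [::] : ell2 R word).
Implicit Types (A B T : opF) (u v w : word) (x y : ell2 R word).

Lemma cat_inj_l u : injective (fun v => u ++ v).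
Proof. by move=> v w /eqP; rewrite eqseq_cat // eqxx => /eqP. Qed.

Lemma cat_inj_r u : injective (fun v => v ++ u).
Proof. by move=> v w /(congr1 rev); rewrite !rev_cat => /cat_inj_l /(can_inj revK). Qed.

Lemma push_catl u x w : push (@cat_inj_l u) x (u ++ w) = x w.
Proof. exact: (pushE (@cat_inj_l u)). Qed.

Lemma shiftE u x v :
  shift u x v = if prefix u v then x (drop (size u) v) else 0.
Proof. by []. Qed.

Lemma shift_cat u x w : shift u x (u ++ w) = x w.
Proof. by rewrite shiftE prefix_prefix drop_size_cat. Qed.

Lemma shift_out u x v : ~~ prefix u v -> shift u x v = 0.
Proof. by rewrite shiftE => /negPf ->. Qed.

Lemma shift_push u x : shift u x = push (@cat_inj_l u) x :> ell2 R word.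
Proof.
apply: ell2_ext => v; have [[w <-]|nw] := pselect (exists w, u ++ w = v).
  by rewrite shift_cat push_catl.
rewrite push_out => [|w hw]; last by apply: nw; exists w.
by rewrite shift_out //; apply/negP => /prefixP[w hw]; case: nw; exists w.
Qed.

Lemma bounded_shift u : bounded_op R word (shift u).
Proof.
apply/bounded_opP; split=> [a x y|]; first by rewrite !shift_push pushP.
by exists 1 => // x; rewrite shift_push l2norm_push mul1r.
Qed.

Definition rshift u (x : ell2 R word) : ell2 R word := push (@cat_inj_r u) x.

Lemma rshiftE u x w : rshift u x (w ++ u) = x w.
Proof. exact: (pushE (@cat_inj_r u)). Qed.

Lemma rshift_out u x v : ~ (exists w, w ++ u = v) -> rshift u x v = 0.
Proof. by move=> nw; rewrite /rshift push_out // => w hw; apply: nw; exists w. Qed.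

Lemma rshift_vac u : rshift u vac = dl u.
Proof.
apply: ell2_ext => v; have [[w <-]|nw] := pselect (exists w, w ++ u = v).
  rewrite rshiftE !deltaE.
  by rewrite -(inj_eq (@cat_inj_r u) w [::]).
by rewrite rshift_out // deltaE; case: eqP => // vu; case: nw; exists [::].
Qed.

(** The commutant of the right translations; being a unital WOT-closed algebra that
    contains the shifts, it contains LL. *)
Definition rcomm : set opF := [set T | bounded_op R word T /\
  forall u x, T (rshift u x) = rshift u (T x)].

Lemma rcomm_algebra : is_unital_wot_algebra rcomm.
Proof.
split.
- by move=> T [].
- by split=> //; exact: bounded_id.
- move=> a A B [AB Ac] [BB Bc]; split; first exact: bounded_lin.
  by move=> u x; rewrite !op_lin_appl Ac Bc /rshift pushP.
- move=> A B [AB Ac] [BB Bc]; split; first exact: bounded_comp.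
  by move=> u x; rewrite /= Bc Ac.
- move=> T [TB clT]; split=> // u x; apply/eqP; rewrite -subr_eq0; apply/eqP.
  apply: dot_eq0 => y; rewrite dotBl dot_push_pull; apply/eqP; rewrite subr_eq0.
  apply/eqP; apply: (weakly_closure_eq (f := fun T => dot (T (rshift u x)) y)
    (g := fun T => dot (T x) (pull (@cat_inj_r u) y)) _ _ _ clT).
  + by exists (rshift u x), y.
  + by exists x, (pull (@cat_inj_r u) y).
  + by move=> B [_ Bc]; rewrite Bc dot_push_pull.
Qed.

Lemma shift_rcomm : range shift `<=` rcomm.
Proof.
move=> _ [u _ <-]; split; first exact: bounded_shift.
move=> v x; apply: ell2_ext => w.
have [/prefixP[w' ->]|nw] := boolP (prefix u w).
  rewrite shift_cat; have [[t <-]|nt] := pselect (exists t, t ++ v = w').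
    by rewrite rshiftE catA rshiftE shift_cat.
  rewrite (rshift_out _ nt).
  have [[t tE]|nt'] := pselect (exists t, t ++ v = u ++ w'); last first.
    by rewrite rshift_out.
  rewrite -tE rshiftE shift_out //; apply/negP => /prefixP[t' t'E].
  by case: nt; exists t'; apply: (@cat_inj_l u); rewrite /= -tE t'E catA.
rewrite shift_out //; have [[t tE]|nt'] := pselect (exists t, t ++ v = w); last first.
  by rewrite rshift_out.
rewrite -tE rshiftE shift_out //; apply/negP => /prefixP[t' t'E].
by move: nw; rewrite -tE t'E -catA prefix_prefix.
Qed.

Lemma LL_rcomm : @LL R d `<=` rcomm.
Proof. by move=> T; apply; split; [exact: rcomm_algebra | exact: shift_rcomm]. Qed.

Lemma closureS_wot (X Y : set opF) : X `<=` Y -> wot_closure X `<=` wot_closure Y.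
Proof.
move=> XY T [TB clT]; split=> // U /clT[A [XA UA]]; exists A; split=> //.
exact: XY.
Qed.

Lemma LL_algebra : is_unital_wot_algebra (@LL R d).
Proof.
split.
- by move=> T /LL_rcomm[].
- by move=> M [/alg_unit].
- by move=> a A B LA LB M MP; have [MA _] := MP; apply: (alg_linear MA); [exact: LA|exact: LB].
- by move=> A B LA LB M MP; have [MA _] := MP; apply: (alg_mul MA); [exact: LA|exact: LB].
- move=> T clT M MP; have [MA _] := MP; apply: (alg_wot MA).
  by apply: closureS_wot clT => A; exact.
Qed.

Lemma LL_shift u : @LL R d (shift u).
Proof. by move=> M [_]; apply; exists u. Qed.

Lemma LL_bounded : @LL R d `<=` bounded_op R word.
Proof. exact: alg_bounded LL_algebra. Qed.

Lemma LL0 : @LL R d 0.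
Proof.
have h := alg_linear LL_algebra (-1) (LL_shift [::]) (LL_shift [::]).
by move: h; rewrite scaleN1r addNr.
Qed.

Lemma LL_sum (U : Type) (s : seq U) (a : U -> C R) (f : U -> opF) :
  (forall t, @LL R d (f t)) -> @LL R d (\sum_(t <- s) a t *: f t).
Proof.
move=> fL; elim: s => [|t s IHs]; first by rewrite big_nil; exact: LL0.
by rewrite big_cons; exact: (alg_linear LL_algebra).
Qed.

Lemma LL_delta B u : @LL R d B -> B (dl u) = rshift u (B vac).
Proof. by move=> /LL_rcomm[_ Bc]; rewrite -rshift_vac Bc. Qed.

(** The n-th homogeneous component: the coefficients of B are the coordinates of
    its value at the vacuum vector. *)
Definition hpart n B : opF := \sum_(w : n.-tuple 'I_d) B vac (tval w) *: shift w.

Lemma LL_hpart n B : @LL R d (hpart n B).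
Proof. by apply: LL_sum => w; exact: LL_shift. Qed.

Lemma hpartE n B u v : @LL R d B ->
  hpart n B (dl u) v = if size v == (n + size u)%N then B (dl u) v else 0.
Proof.
move=> LB; rewrite /hpart op_sum_appl ell2_sum (LL_delta u LB).
rewrite (eq_bigr (fun w : n.-tuple 'I_d => B vac w * (v == w ++ u)%:R)); last first.
  by move=> w _; rewrite op_scale_appl ell2Z shift_delta deltaE.
have [[w wE]|nw] := pselect (exists w, w ++ u = v); last first.
  rewrite rshift_out // if_same big1 // => w _; case: eqP => [wE|_]; last by rewrite mulr0.
  by case: nw; exists (tval w).
rewrite -wE rshiftE size_cat eqn_add2r.
case: ifPn => [sw|nsw].
  rewrite (bigD1 (Tuple sw)) //= eqxx mulr1 big1 ?addr0 // => w' w'w.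
  rewrite (inj_eq (@cat_inj_r u)); case: eqP => [ww'|_]; last by rewrite mulr0.
  by case/eqP: w'w; apply: val_inj.
rewrite big1 // => w' _; rewrite (inj_eq (@cat_inj_r u)).
case: eqP => [ww'|_]; last by rewrite mulr0.
by rewrite ww' size_tuple eqxx in nsw.
Qed.

Lemma LL_lower B u v : @LL R d B -> (size v < size u)%N -> B (dl u) v = 0.
Proof.
move=> LB vu; rewrite (LL_delta u LB) rshift_out // => -[w wE].
by move: vu; rewrite -wE size_cat ltnNge leq_addl.
Qed.

(** The Cesaro means of the Fourier series of B, weighted by the Fejer kernel. *)
Definition fejer k B : opF := \sum_(n < k) rc (1 - n%:R / k%:R) *: hpart n B.

Lemma bounded_fejer k B : bounded_op R word (fejer k B).
Proof. by apply: bounded_sum => n; apply: LL_bounded; exact: LL_hpart. Qed.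

Lemma fejerE k B u v : @LL R d B -> (0 < k)%N ->
  fejer k B (dl u) v = rc ((k - (size v - size u))%:R / k%:R) * B (dl u) v.
Proof.
move=> LB k0; have [vu|uv] := ltnP (size v) (size u).
  rewrite (LL_lower LB vu) mulr0 /fejer op_sum_appl ell2_sum big1 // => n _.
  by rewrite op_scale_appl ell2Z hpartE // (LL_lower LB vu) if_same mulr0.
rewrite /fejer op_sum_appl ell2_sum.
rewrite (eq_bigr (fun n : 'I_k => if (size v - size u == n)%N
    then rc (1 - n%:R / k%:R) * B (dl u) v else 0)); last first.
  move=> n _; rewrite op_scale_appl ell2Z hpartE //.
  rewrite -{1}(subnK uv) eqn_add2r; case: ifP; by rewrite ?mulr0.
have kR : k%:R != 0 :> R by rewrite pnatr_eq0 -lt0n.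
have [jk|kj] := ltnP (size v - size u) k.
  rewrite (bigD1 (Ordinal jk)) //= eqxx big1 ?addr0 => [|n nj].
    rewrite [in RHS](_ : _ / _ = 1 - (size v - size u)%:R / k%:R) //.
    by rewrite natrB ?(ltnW jk) //; field.
  by case: eqP => // jn; case/eqP: nj; apply: val_inj; rewrite /= jn.
rewrite (_ : k - _ = 0)%N; last by apply/eqP; rewrite subn_eq0.
rewrite mul0r rc0 mul0r big1 // => n _; case: eqP => // jn.
by move: kj; rewrite jn leqNgt ltn_ord.
Qed.

End FreeSemigroupAlgebraTheory.
(** * Fejer's theorem *)

Lemma sum_between (a b M : nat) : (b <= M)%N ->
  (\sum_(m < M) (a <= m < b))%N = (b - a)%N.
Proof.
move=> bM; rewrite -(big_mkord xpredT (fun m => nat_of_bool (a <= m < b)%N)).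
rewrite (@big_cat_nat _ _ _ b) //= [X in (_ + X)%N]big1_seq ?addn0; last first.
  by move=> m /=; rewrite mem_index_iota => /andP[bm _]; rewrite ltnNge bm andbF.
have [ab|ba] := leqP a b; last first.
  rewrite big1_seq; first by apply/esym/eqP; rewrite subn_eq0 ltnW.
  move=> m /=; rewrite mem_index_iota => /= mb.
  by rewrite leqNgt (ltn_trans mb ba).
rewrite (@big_cat_nat _ _ _ a) //= big1_seq ?add0n; last first.
  by move=> m /=; rewrite mem_index_iota => /= ma; rewrite leqNgt ma.
rewrite (@eq_big_nat _ _ _ _ _ _ (fun=> 1%N)) => [|m /andP[-> ->] //].
by rewrite sum_nat_const_nat muln1.
Qed.

Section Fejer.
Variables (R : realType) (d : nat).
Local Notation word := (seq 'I_d).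
Local Notation opF := (op R word).
Local Notation shift := (@Defs.shift R d).
Local Notation dl w := (delta w : ell2 R word).
Implicit Types (A B T : opF) (u v w : word) (x y : ell2 R word).

Definition window k m : pred word := fun v => (size v <= m < size v + k)%N.

Lemma sum_window k M (A : {fset word}) x :
  (forall v, v \in A -> size v + k <= M)%N ->
  \sum_(m < M) l2norm (trunc A (cutoff (window k m) x)) ^+ 2
    <= k%:R * l2norm x ^+ 2.
Proof.
move=> AM; apply: (@le_trans _ _ (k%:R * l2norm (trunc A x) ^+ 2)); last first.
  by rewrite ler_wpM2l // ler_pXn2r ?nnegrE ?l2norm_ge0 // l2norm_cutoff.
rewrite (eq_bigr (fun m : 'I_M => \sum_(v <- A) (window k m v)%:R * cabs (x v) ^+ 2)).
  rewrite exchange_big /= l2norm_trunc mulr_sumr big_seq [leRHS]big_seq.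
  apply: ler_sum => v vA; rewrite -mulr_suml -natr_sum /window sum_between ?AM //.
  by rewrite addKn.
move=> m _; rewrite l2norm_trunc; apply: eq_bigr => v _; rewrite cutoffE.
by case: (window k m v); rewrite ?mul1r // mul0r cabs0 expr0n.
Qed.

(** The Cesaro mean is the average of the compressions of B to the windows of k
    consecutive degrees: the degrees of u and v share k - (size v - size u)
    windows. This is why Cesaro means do not increase the norm. *)
Lemma fejer_windows k M B (A : {fset word}) x y : @LL R d B -> (0 < k)%N ->
  (forall v, v \in A -> size v + k <= M)%N ->
  k%:R * dot (fejer k B (trunc A x)) (trunc A y) =
  \sum_(m < M) dot (B (trunc A (cutoff (window k m) x))) (trunc A (cutoff (window k m) y)).
Proof.
move=> LB k0 AM; have BB := LL_bounded LB.
have kC : k%:R != 0 :> R by rewrite pnatr_eq0 -lt0n.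
rewrite (trunc_form _ _ _ (bounded_fejer k B)).
rewrite (eq_bigr (fun m : 'I_M => \sum_(u <- A) \sum_(v <- A)
   ((size u <= m < size u + k) && (size v <= m < size v + k))%N%:R
     * (x u * (y v)^* * B (dl u) v))); last first.
  move=> m _; rewrite (trunc_form _ _ _ BB); apply: eq_bigr => u _.
  apply: eq_bigr => v _; rewrite !cutoffE /window.
  case: (_ <= _ < _)%N; case: (_ <= _ < _)%N; rewrite /= ?mul1r ?mul0r //.
  by rewrite rmorph0 mulr0 mul0r.
rewrite [RHS]exchange_big mulr_sumr; apply: eq_big_seq => u uA.
rewrite [RHS]exchange_big mulr_sumr; apply: eq_big_seq => v vA.
rewrite -mulr_suml -natr_sum fejerE //.
have [vu|uv] := ltnP (size v) (size u); first by rewrite (LL_lower LB vu) !mulr0.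
rewrite (eq_bigr (fun m : 'I_M => nat_of_bool (size v <= m < size u + k)%N)).
  rewrite sum_between ?AM // subnBA // (addnC k).
  have <- : k%:R * rc ((size u + k - size v)%:R / k%:R) = (size u + k - size v)%:R :> C R.
    by rewrite -!rc_nat -rcM mulrC divfK.
  by ring.
move=> m _; congr nat_of_bool; apply/idP/idP.
  by move=> /andP[/andP[_ ->] /andP[-> _]].
move=> /andP[vm mu]; rewrite vm mu (leq_trans uv vm) /=.
by rewrite (leq_trans mu) // leq_add2r.
Qed.

(** Each degree lies in k windows, so the squared norms of the k-fold overlapping
    pieces of a vector add up to at most k times its squared norm. *)
Lemma norm_le_fejer k B c : @LL R d B -> (0 < k)%N -> 0 <= c -> norm_le B c ->
  norm_le (fejer k B) c.
Proof.
move=> LB k0 c0 Bc; have SB := bounded_fejer k B.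
apply: (norm_le_form SB c0) => x y; apply/ler_addgt0Pr => e e0.
have [_ [c' c'0 Sc']] := (bounded_opP _).1 SB.
have [A /(_ _ SB Sc') hA] := trunc_form_approx x y c'0 e0.
set t := dot (fejer k B (trunc A x)) (trunc A y) in hA.
rewrite -(subrK t (dot _ y)) addrC (le_trans (cabsD _ _)) // lerD //.
pose M := (\max_(v <- A) size v + k)%N.
have AM v : v \in A -> (size v + k <= M)%N.
  by move=> vA; rewrite leq_add2r leq_bigmax_seq.
have kR : 0 < k%:R :> R by rewrite ltr0n.
rewrite -(ler_pM2l kR) -[X in X * cabs t](ger0_norm (ltW kR)) -cabs_rc -cabsM.
have -> : rc (k%:R : R) * t = k%:R * t by rewrite rc_nat.
rewrite (fejer_windows x y LB k0 AM) (le_trans (cabs_sum _ _)) //.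
apply: (@le_trans _ _ (\sum_(m < M) c / 2 *
    (l2norm (trunc A (cutoff (window k m) x)) ^+ 2 +
     l2norm (trunc A (cutoff (window k m) y)) ^+ 2))).
  apply: ler_sum => m _; apply: le_trans (cauchy_schwarz _ _) _.
  set a := trunc A _; set b := trunc A _.
  apply: (@le_trans _ _ (c * l2norm a * l2norm b)).
    by rewrite ler_wpM2r ?l2norm_ge0.
  rewrite -subr_ge0 (_ : _ - _ = c / 2 * (l2norm a - l2norm b) ^+ 2); last by field.
  by rewrite mulr_ge0 ?sqr_ge0 // divr_ge0.
rewrite -mulr_sumr big_split /=.
have -> : k%:R * (c * (l2norm x ^+ 2 + l2norm y ^+ 2) / 2) =
  c / 2 * (k%:R * l2norm x ^+ 2 + k%:R * l2norm y ^+ 2) by field.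
by rewrite ler_wpM2l ?divr_ge0 // lerD // sum_window.
Qed.

Lemma amp_delta (K : choiceType) T u v (n m : K) : bounded_op R word T ->
  amp T (delta (u, n) : ell2 R (word * K)%type) (v, m) =
  if m == n then T (dl u) v else 0.
Proof.
move=> TB; rewrite ampE //; case: eqP => [->|mn].
  congr (ell2_val (T _) v); apply: ell2_ext => w.
  by rewrite fiberE !deltaE xpair_eqE eqxx andbT.
rewrite (_ : fiber _ _ = 0) ?(op0 TB) //; apply: ell2_ext => w.
by rewrite fiberE deltaE xpair_eqE; case: (m == n) (introN eqP mn) => // _; rewrite andbF.
Qed.

(** Weak-star density of the polynomials in LL: the Cesaro means of B have norms
    bounded by that of B and converge entrywise, so every normal functional converges
    along them. *)
Lemma LL_normal_vanish (X Y : ell2 R (word * nat)%type) B : @LL R d B ->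
  (forall n, nform X Y (hpart n B) = 0) -> nform X Y B = 0.
Proof.
move=> LB XY0; have BB := LL_bounded LB.
have [_ [c c0 Bc]] := (bounded_opP _).1 BB.
have ces0 k : nform X Y (fejer k B) = 0.
  rewrite nform_sum => [|n]; last by apply: LL_bounded; exact: LL_hpart.
  by rewrite big1 // => n _; rewrite XY0 mulr0.
apply: cabs_small => e e0; have e30 : 0 < e / 3 by rewrite divr_gt0.
have [A hA] := trunc_form_approx X Y c0 e30.
pose K := \sum_(p <- A) \sum_(q <- A)
  cabs (X p * (Y q)^*) * ((size q.1)%:R * cabs (amp B (delta p) q)).
have K0 : 0 <= K.
  apply: sumr_ge0 => p _; apply: sumr_ge0 => q _.
  by rewrite !mulr_ge0 ?cabs_ge0.
(* The entry at (u, v) of B minus its k-th mean is at most size v / k times that of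
   B; for this k the errors over A x A add up to at most e / 3. *)
pose k := (Num.bound (K / (e / 3))).+1.
have k0 : 0 < k%:R :> R by rewrite ltr0n.
have Kk : K / k%:R <= e / 3.
  rewrite ler_pdivrMr // -ler_pdivrMl // mulrC ltW //.
  apply: le_lt_trans (ler_norm _) _.
  rewrite (ger0_norm (divr_ge0 K0 (ltW e30))).
  apply: lt_le_trans (archi_boundP _) _; first by rewrite divr_ge0 // ltW.
  by rewrite ler_nat.
have SB := bounded_fejer k B.
have Sc : norm_le (fejer k B) c by exact: norm_le_fejer.
have hB := hA _ (bounded_amp _ BB) (fun Z => l2norm_amp BB Z c0 Bc).
have hS := hA _ (bounded_amp _ SB) (fun Z => l2norm_amp SB Z c0 Sc).
have := ces0 k; rewrite /nform in hB hS * => S0; rewrite S0 sub0r in hS.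
set tB := dot (amp B (trunc A X)) _ in hB.
set tS := dot (amp (fejer k B) (trunc A X)) _ in hS.
have hBS : cabs (tB - tS) <= K / k%:R.
  rewrite /tB /tS (trunc_form _ _ _ (bounded_amp _ BB))
    (trunc_form _ _ _ (bounded_amp _ SB)) -sumrB /K [leRHS]mulr_suml.
  apply: le_trans (cabs_sum _ _) _; apply: ler_sum => -[u n] _.
  rewrite -sumrB [leRHS]mulr_suml; apply: le_trans (cabs_sum _ _) _.
  apply: ler_sum => -[v m] _; rewrite -mulrBr [leLHS]cabsM -[leRHS]mulrA ler_wpM2l ?cabs_ge0 //.
  rewrite !amp_delta //; case: eqP => _; last first.
    by rewrite subrr cabs0 mulr0 mul0r.
  rewrite fejerE // -[X in X - _]mul1r -mulrBl cabsM mulrAC ler_wpM2r ?cabs_ge0 //.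
  have -> : 1 - rc ((k - (size v - size u))%:R / k%:R : R) =
      rc (1 - (k - (size v - size u))%:R / k%:R).
    by rewrite rcB /rc rmorph1.
  have kle : (k - (size v - size u))%:R / k%:R <= 1 :> R.
    by rewrite ler_pdivrMr // mul1r ler_nat leq_subr.
  rewrite cabs_rc ger0_norm ?subr_ge0 //.
  rewrite lerBlDr -mulrDl ler_pdivlMr // mul1r -natrD ler_nat.
  by rewrite -leq_subLR leq_sub2l // leq_subr.
move: hB; set t0 := (X in cabs (X - tB)) => hB; change (cabs t0 <= e).
have -> : t0 = (t0 - tB) + ((tB - tS) + tS) by ring.
have hS' : cabs tS <= e / 3 by rewrite -[tS]opprK -[cabs _]/(Normc.normc (- (- tS))) normcN.
apply: le_trans (cabsD _ _) _.
have h3 : cabs (tB - tS + tS) <= e / 3 + e / 3.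
  by apply: le_trans (cabsD _ _) _; apply: lerD => //; apply: le_trans hBS _.
by apply: le_trans (lerD hB h3) _; lra.
Qed.

End Fejer.
(** * Homogeneous components and ideals *)

(** A square matrix of maximal rank among those with all rows in M has M as its row
    space; a suitable column of its cokernel is the required form. *)
Lemma row_separation (F : fieldType) m (M : set 'rV[F]_m) v :
  M 0 -> (forall a u w, M u -> M w -> M (a *: u + w)) -> ~ M v ->
  exists c : 'cV[F]_m, (forall u, M u -> u *m c = 0) /\ v *m c != 0.
Proof.
move=> M0 ML Mv.
pose P k := `[< exists A : 'M[F]_m, (forall i, M (row i A)) /\ \rank A = k >].
have Pm k : P k -> (k <= m)%N by move=> /asboolP[A [_ <-]]; exact: rank_leq_row.
have P0 : exists k, P k.
  by exists 0%N; apply/asboolP; exists 0; split=> [i|]; rewrite ?row0 ?mxrank0.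
have [k /asboolP[A [AM rA]] kmax] := ex_maxnP P0 Pm.
have subM u : (u <= A)%MS -> M u.
  move=> /submxP[D ->]; rewrite mulmx_sum_row.
  elim/big_rec: _ => // i w _ Mw; exact: ML.
have Msub u : M u -> (u <= A)%MS.
  move=> Mu; apply/negPn/negP => nuA.
  have ltA : (A < A + u)%MS.
    by rewrite ltmxE addsmxSl /= addsmx_sub submx_refl.
  have /kmax : P (\rank (A + u)%MS).
    apply/asboolP; exists (A + u)%MS; split=> // i.
    have /sub_addsmxP[[D D'] /= ->] := row_sub i (A + u)%MS.
    rewrite [D' *m u](_ : _ = (D' 0 0) *: u); last first.
      by rewrite [D' in LHS]mx11_scalar mul_scalar_mx.
    by rewrite addrC; apply: ML => //; apply: subM; exact: submxMl.
  by rewrite -rA leqNgt rank_ltmx.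
have nvA : ~~ (v <= A)%MS by apply/negP => /subM.
rewrite submxE in nvA.
have [j vj] : exists j, (v *m cokermx A) 0 j != 0.
  apply: contrapT => h; case/eqP: nvA; apply/rowP => j; rewrite [RHS]mxE.
  by apply/eqP; apply: contrapT => /negP hj; apply: h; exists j.
exists (col j (cokermx A)); split=> [u /Msub|]; rewrite colE mulmxA.
  by rewrite submxE => /eqP ->; rewrite mul0mx.
by apply: contra vj; rewrite -colE => /eqP/colP/(_ 0); rewrite !mxE => ->.
Qed.

Section Components.
Variables (R : realType) (d : nat).
Local Notation word := (seq 'I_d).
Local Notation opF := (op R word).
Local Notation shift := (@Defs.shift R d).
Local Notation LL := (@Defs.LL R d).
Local Notation dl w := (delta w : ell2 R word).
Local Notation vac := (delta [::] : ell2 R word).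
Implicit Types (A B T : opF) (u v w : word) (x y : ell2 R word).

Lemma LL_ext A B : LL A -> LL B -> A vac = B vac -> A = B.
Proof.
move=> LA LB AB; apply: eq_bounded_op; try exact: LL_bounded.
by move=> w; rewrite (LL_delta w LA) (LL_delta w LB) AB.
Qed.

Lemma shift_vac u : shift u vac = dl u.
Proof. by rewrite shift_delta cats0. Qed.

Lemma hpart_vac n B v : LL B -> hpart n B vac v = if size v == n then B vac v else 0.
Proof. by move=> LB; rewrite hpartE //= addn0. Qed.

Lemma hpart_lin n a A B : hpart n (a *: A + B) = a *: hpart n A + hpart n B.
Proof.
rewrite /hpart scaler_sumr -big_split; apply: eq_bigr => w _.
by rewrite op_lin_appl ell2D ell2Z scalerDl scalerA.
Qed.

Lemma hpart0 n : hpart n (0 : opF) = 0.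
Proof. by rewrite /hpart big1 // => w _; rewrite ell20 scale0r. Qed.

Lemma hpart_shift n u : hpart n (shift u) = if size u == n then shift u else 0.
Proof.
have LR : LL (if size u == n then shift u else 0).
  by case: ifP => _; [exact: LL_shift | exact: LL0].
apply: LL_ext => //; first exact: LL_hpart.
apply: ell2_ext => v; rewrite hpart_vac; last exact: LL_shift.
case: (size u =P n) => [<-|un]; rewrite shift_vac deltaE.
  by case: eqP => // vu; case: eqP => // vw; case: vu; rewrite vw.
rewrite ell20; case: eqP => // vn; case: eqP => // vu.
by case: un; rewrite -vu.
Qed.

Lemma bounded_cutoff (p : pred word) : bounded_op R word (cutoff p).
Proof.
apply/bounded_opP; split=> [a x y|]; first exact: cutoff_linear.
by exists 1 => // x; rewrite mul1r l2norm_cutoff.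
Qed.

Lemma LL_low A x v : LL A ->
  A x v = A (cutoff (fun u => size u <= size v)%N x) v.
Proof.
move=> LA; have AB := LL_bounded LA; set p := fun u => _.
rewrite -(dot_delta (A x)) -(dot_delta (A (cutoff p x))).
apply: (eq_bounded_form (op_form AB (dl v))
  (op_form (bounded_comp AB (bounded_cutoff p)) (dl v))) => u.
rewrite !dot_delta /=; case: (boolP (p u)) => pu.
  congr (ell2_val (A _) v); apply: ell2_ext => w; rewrite cutoffE deltaE.
  by case: eqP => [->|_]; rewrite ?pu // if_same.
rewrite (_ : cutoff p _ = 0); last first.
  apply: ell2_ext => w; rewrite cutoffE deltaE ell20.
  by case: eqP => [->|_]; rewrite ?(negPf pu) // if_same.
by rewrite (op0 AB) (LL_lower LA) // ltnNge.
Qed.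

Lemma hpart_vac_sum n B : hpart n B vac =
  \sum_(w : n.-tuple 'I_d) B vac (tval w) *: dl (tval w) :> ell2 R word.
Proof.
rewrite /hpart op_sum_appl; apply: eq_bigr => w _.
by rewrite op_scale_appl shift_vac.
Qed.

Lemma hpart_on_hpart n i A B v : LL A -> LL B ->
  hpart n A (hpart i B vac) v = if size v == (n + i)%N then A (hpart i B vac) v else 0.
Proof.
move=> LA LB; rewrite hpart_vac_sum (op_sum (LL_bounded (LL_hpart n A))).
rewrite (op_sum (LL_bounded LA)) !ell2_sum (big_morph
  (fun z : C R => if size v == (n + i)%N then z else 0) (id1 := 0) (op1 := +%R)).
- apply: eq_bigr => w _; rewrite (opZ (LL_bounded (LL_hpart n A))) (opZ (LL_bounded LA)).
  by rewrite !ell2Z hpartE // size_tuple; case: ifP; rewrite ?mulr0.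
- by move=> y z; case: ifP; rewrite ?addr0.
- by rewrite if_same.
Qed.

(** Homogeneous components multiply by convolution of degrees: an operator of LL
    never lowers the degree, so only the part of B of degree at most n matters. *)
Lemma hpart_mul n A B : LL A -> LL B ->
  hpart n (A \o B) = \sum_(i < n.+1) (hpart (n - i) A \o hpart i B : opF).
Proof.
move=> LA LB; have LAB := alg_mul (LL_algebra R d) LA LB.
have LC i : LL (hpart (n - i) A \o hpart i B).
  by apply: (alg_mul (LL_algebra R d)); exact: LL_hpart.
apply: LL_ext; first exact: LL_hpart.
  have := @LL_sum R d _ (index_enum 'I_n.+1) (fun=> 1) _ (fun i : 'I_n.+1 => LC i).
  by congr Defs.LL; apply: eq_bigr => i _; rewrite scale1r.
apply: ell2_ext => v; rewrite hpart_vac // op_sum_appl ell2_sum.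
rewrite (eq_bigr (fun i : 'I_n.+1 => if size v == n then A (hpart i B vac) v else 0)).
  case: eqP => [vn|_]; last by rewrite big1.
  rewrite -[LHS]/(A (B vac) v) (LL_low (B vac) v LA).
  rewrite -ell2_sum -(op_sum (LL_bounded LA)); congr (ell2_val (A _) v).
  apply: ell2_ext => u; rewrite cutoffE ell2_sum.
  rewrite (eq_bigr (fun i : 'I_n.+1 => if size u == i then B vac u else 0)); last first.
    by move=> i _; rewrite hpart_vac.
  rewrite vn; case: leqP => un.
    have un' : (size u < n.+1)%N by rewrite ltnS.
    rewrite (bigD1 (Ordinal un')) //= eqxx big1 ?addr0 // => i iu.
    by case: eqP => // ui; case/eqP: iu; apply: val_inj; rewrite /= ui.
  rewrite big1 // => i _; case: eqP => // ui.
  by have := ltn_ord i; rewrite -ui ltnS leqNgt un.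
move=> i _; rewrite -[LHS]/(hpart (n - i) A (hpart i B vac) v) hpart_on_hpart //.
by rewrite subnK // -ltnS.
Qed.

(** Taking components is linear, convolutive by hpart_mul, and WOT-continuous. *)
Lemma hpart_ideal (J : set opF) : is_wot_ideal J ->
  is_wot_ideal [set A | LL A /\ forall n, J (hpart n A)].
Proof.
move=> JI; have Jsum (T : Type) (s : seq T) (f : T -> opF) :
    (forall t, J (f t)) -> J (\sum_(t <- s) f t).
  move=> Jf; elim: s => [|t s IH]; first by rewrite big_nil; exact: ideal_zero.
  by rewrite big_cons -[f t]scale1r; exact: (ideal_linear JI).
split.
- by move=> A [].
- by split=> [|n]; [exact: LL0 | rewrite hpart0; exact: ideal_zero].
- move=> a A B [LA JA] [LB JB]; split; first exact: (alg_linear (LL_algebra R d)).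
  by move=> n; rewrite hpart_lin; exact: (ideal_linear JI).
- move=> A B LA [LB JB]; split; first exact: (alg_mul (LL_algebra R d)).
  move=> n; rewrite hpart_mul //; apply: Jsum => i.
  by apply: (ideal_left JI) => //; exact: LL_hpart.
- move=> A B [LA JA] LB; split; first exact: (alg_mul (LL_algebra R d)).
  move=> n; rewrite hpart_mul //; apply: Jsum => i.
  by apply: (ideal_right JI) => //; exact: LL_hpart.
- move=> T clT; have LT : LL T.
    by apply: (alg_wot (LL_algebra R d)); apply: closureS_wot clT => A [].
  split; first exact: LT.
  move=> n; apply: (ideal_wot JI); split.
    by apply: LL_bounded; exact: LL_hpart.
  have hpart_cvg : hpart n @ nbhs (T : wot R word) --> (hpart n T : wot R word).
    apply: cvg_weakly => f [x [y ->]].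
    have E A : dot (hpart n A x) y =
        \sum_(w : n.-tuple 'I_d) dot (A vac) (dl (tval w)) * dot (shift w x) y.
      rewrite /hpart op_sum_appl dot_suml; apply: eq_bigr => w _.
      by rewrite op_scale_appl dotZl dot_delta.
    suff : (fun A : wot R word => dot (hpart n A x) y) @ nbhs (T : wot R word) -->
        dot (hpart n T x) y by [].
    rewrite E (funext E); apply: cvg_sumC => w; apply: cvgM; last exact: cvg_cst.
    apply: (@weakly_continuous R _ (@vector_functional R word)).
    by exists vac, (dl (tval w)).
  move=> U /hpart_cvg /(clT.2) [A [[_ JA] UA]].
  by exists (hpart n A).
Qed.

Section Homogeneous.
Variables (J : set opF) (JI : is_wot_ideal J) (JH : homogeneous J).

(** The ideal of hpart_ideal contains the homogeneous generators of J. *)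
Lemma homogeneous_hpart A n : J A -> J (hpart n A).
Proof.
have [G Ghom JE] := JH; have GJ : G `<=` J by rewrite JE; exact: sub_smallest.
suff /(_ A) h : J `<=` [set A | LL A /\ forall n, J (hpart n A)] by move=> /h[].
rewrite {1}JE; apply: smallest_sub; first exact: hpart_ideal.
move=> g Gg; have Lg : LL g by apply: (ideal_sub JI); exact: GJ.
split=> // m; have [k [c gE]] := Ghom g Gg.
suff -> : hpart m g = if m == k then g else 0.
  by case: ifP => _; [exact: GJ | exact: ideal_zero].
apply: LL_ext; first exact: LL_hpart.
  by case: ifP => // _; exact: LL0.
apply: ell2_ext => v; rewrite hpart_vac //.
have gv : size v != k -> g vac v = 0.
  move=> vk; rewrite gE op_sum_appl ell2_sum big1 // => w _.
  rewrite op_scale_appl ell2Z shift_vac deltaE; case: eqP => [vw|_]; last by rewrite mulr0.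
  by rewrite vw size_tuple eqxx in vk.
case: (m =P k) => [->|mk]; first by case: ifPn => // /gv ->.
by rewrite ell20; case: eqP => // vm; apply: gv; rewrite vm; apply/eqP.
Qed.

(** The components of degree n of elements of J again lie in J, so that hpart n A is
    outside a subspace of a finite-dimensional space. A separating form is given by a
    vector supported in degree n, and by homogeneity that vector is orthogonal to all
    of J vac. *)
Lemma NJ_separation A n : LL A -> ~ J (hpart n A) ->
  exists y, NJ J y /\ dot (A vac) y != 0.
Proof.
move=> LA nJA; pose N := #|{: n.-tuple 'I_d}|.
pose wd (i : 'I_N) : word := tval (enum_val i).
pose r B : 'rV[C R]_N := \row_i B vac (wd i).
have [|||c [cJ cA]] := @row_separation (C R) N (r @` J) (r A).
- by exists 0; [exact: ideal_zero | apply/rowP => i; rewrite !mxE ell20].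
- move=> a _ _ [S JS <-] [T JT <-]; exists (a *: S + T); first exact: (ideal_linear JI).
  by apply/rowP => i; rewrite !mxE op_lin_appl.
- move=> [B JB rBA]; apply: nJA; suff -> : hpart n A = hpart n B by exact: homogeneous_hpart.
  apply: eq_bigr => w _; congr (_ *: _).
  by have /rowP/(_ (enum_rank w)) := rBA; rewrite !mxE /wd enum_rankK.
pose y : ell2 R word := \sum_(i < N) (c i 0)^* *: dl (wd i).
have dy B : dot (B vac) y = (r B *m c) 0 0.
  rewrite /y dot_sumr mxE; apply: eq_bigr => i _.
  by rewrite dotZr conjCK dot_delta mxE mulrC.
exists y; split=> [B JB|].
  by rewrite dy cJ ?mxE //; exists B.
rewrite dy; apply: contra cA => /eqP h; apply/eqP/matrixP => i j.
by rewrite !ord1 h mxE.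
Qed.

End Homogeneous.
End Components.
(** * The quotient algebra and its semigroup *)

Section Compression.
Variables (R : realType) (d : nat).
Local Notation word := (seq 'I_d).
Local Notation opF := (op R word).
Local Notation shift := (@Defs.shift R d).
Local Notation shift0 := (@Defs.shift0 R d).
Local Notation LL := (@Defs.LL R d).
Local Notation dl w := (delta w : ell2 R word).
Local Notation vac := (delta [::] : ell2 R word).
Implicit Types (A B T : opF) (u v w : word0 d) (x y : ell2 R word).
Variables (J : set opF) (JI : is_wot_ideal J).
Local Notation P := (Defs.proj (NJ J)).

(** In the second alternative proj has its default value and all compressions vanish;
    carrying this trivial case along takes the place of constructing the projection
    onto NJ. *)
Lemma proj_cases : is_proj (NJ J) P \/ P = 0.
Proof. by rewrite /Defs.proj; case: xgetP; [left | right]. Qed.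

Lemma proj_bounded : bounded_op R word P.
Proof. by case: proj_cases => [[] //|->]; exact: bounded_0. Qed.

Lemma NJ_proj x : NJ J (P x).
Proof.
case: proj_cases => [[_ /(_ x)[] //]|->] A _.
by rewrite [X in dot _ X](_ : _ = 0) ?dot0r.
Qed.

Lemma dot_proj_l x y : NJ J y -> is_proj (NJ J) P -> dot (P x) y = dot x y.
Proof.
move=> Ny [_ /(_ x)[_ /(_ y Ny)]]; rewrite dotBl => /eqP.
by rewrite subr_eq0 => /eqP.
Qed.

Lemma proj_sym x y : dot (P x) y = dot x (P y).
Proof.
have [Pp|P0] := proj_cases; last by rewrite P0 dot0l dot0r.
by rewrite -(dot_proj_l x (NJ_proj y) Pp) dotC -(dot_proj_l y (NJ_proj x) Pp) -dotC.
Qed.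

(** NJ is invariant under the adjoints of LL, because J vac is invariant under LL;
    hence compression to NJ is multiplicative. *)
Lemma proj_LL_proj A x : LL A -> P (A (P x)) = P (A x).
Proof.
move=> LA; have [Pp|P0] := proj_cases; last by rewrite P0.
have AB := LL_bounded LA.
apply/eqP; rewrite eq_sym -subr_eq0 -(opB proj_bounded) -(opB AB); apply/eqP.
apply: dot_eq0 => y; rewrite proj_sym.
have [z zE] := adjoint_vector AB (P y); rewrite zE.
have Nz : NJ J z.
  by move=> B JB; rewrite -zE; apply: (NJ_proj y (A := A \o B)); exact: (ideal_left JI).
by have [_ /(_ x)[_ /(_ z Nz)]] := Pp.
Qed.

Lemma proj_J A x : J A -> P (A x) = 0.
Proof.
move=> JA; have AB := LL_bounded (ideal_sub JI JA).
apply: dot_eq0 => y; rewrite proj_sym.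
apply: (form_delta_eq0 (op_form AB (P y))) => w.
rewrite -shift_vac; apply: (NJ_proj y (A := A \o shift w)).
by apply: (ideal_right JI) => //; exact: LL_shift.
Qed.

Lemma compressionE A x : LL A -> compression J A x = P (A x).
Proof. exact: proj_LL_proj. Qed.

Lemma compression_lin a A B : LL A -> LL B ->
  compression J (a *: A + B) = a *: compression J A + compression J B.
Proof.
move=> LA LB; apply/funext => x; rewrite op_lin_appl !compressionE //; last first.
  exact: (alg_linear (LL_algebra R d)).
by rewrite op_lin_appl (opP proj_bounded).
Qed.

Lemma compression_mul A B : LL A -> LL B ->
  compression J A \o compression J B = compression J (A \o B).
Proof.
move=> LA LB; apply/funext => x.
rewrite -[LHS]/(compression J A (compression J B x)) !compressionE //.
  exact: proj_LL_proj.
exact: (alg_mul (LL_algebra R d)).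
Qed.

Lemma compression_J A : J A -> compression J A = 0.
Proof. by move=> JA; apply/funext => x; exact: proj_J. Qed.

Lemma LJ_bounded : LJ J `<=` bounded_op R word.
Proof.
move=> _ [A LA <-]; apply: bounded_comp proj_bounded.
by apply: (bounded_comp proj_bounded); exact: LL_bounded.
Qed.

Lemma compression0 : compression J 0 = 0.
Proof. by apply: compression_J; exact: ideal_zero. Qed.

Lemma LJ0 : LJ J 0.
Proof. by exists 0; [exact: LL0 | exact: compression0]. Qed.

Lemma LJ_lin a A B : LJ J A -> LJ J B -> LJ J (a *: A + B).
Proof.
move=> [S LS <-] [T LT <-]; exists (a *: S + T); last exact: compression_lin.
exact: (alg_linear (LL_algebra R d)).
Qed.

Lemma LJ_mul A B : LJ J A -> LJ J B -> LJ J (A \o B).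
Proof.
move=> [S LS <-] [T LT <-]; exists (S \o T); last by rewrite compression_mul.
exact: (alg_mul (LL_algebra R d)).
Qed.

Lemma LL_shift0 u : LL (shift0 u).
Proof. by case: u => [u|]; [exact: LL_shift | exact: LL0]. Qed.

Lemma shift0_mul u v : shift0 (word0_mul u v) = shift0 u \o shift0 v.
Proof.
case: u v => [u|] [v|] //=; last first.
  by apply/funext => x; rewrite /= (op0 (bounded_shift R u)).
apply: LL_ext; first exact: LL_shift.
  by apply: (alg_mul (LL_algebra R d)); exact: LL_shift.
by rewrite shift_vac -[RHS]/(shift u (shift v vac)) shift_vac shift_delta.
Qed.

Local Notation "u =~ v" := (word_equiv J u v) (at level 70).

Lemma wequiv_refl u : u =~ u.
Proof. by rewrite /word_equiv subrr; exact: ideal_zero. Qed.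

Lemma wequiv_sym u v : u =~ v -> v =~ u.
Proof.
rewrite /word_equiv => h; rewrite -opprB -scaleN1r -[_ *: _]addr0.
by apply: (ideal_linear JI) => //; exact: ideal_zero.
Qed.

Lemma wequiv_trans u v w : u =~ v -> v =~ w -> u =~ w.
Proof.
rewrite /word_equiv => h1 h2.
have -> : shift0 u - shift0 w =
    1 *: (shift0 u - shift0 v) + (shift0 v - shift0 w).
  by rewrite scale1r addrA subrK.
exact: (ideal_linear JI).
Qed.

Lemma wequiv_mul u u' v v' : u =~ u' -> v =~ v' -> word0_mul u v =~ word0_mul u' v'.
Proof.
rewrite /word_equiv => h1 h2; rewrite !shift0_mul.
have uB := LL_bounded (LL_shift0 u).
rewrite (_ : _ - _ = 1 *: (shift0 u \o (shift0 v - shift0 v') : opF) +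
    ((shift0 u - shift0 u') \o shift0 v' : opF)); last first.
  apply/funext => x; rewrite scale1r.
  rewrite -[LHS]/(shift0 u (shift0 v x) - shift0 u' (shift0 v' x)).
  rewrite -[RHS]/(shift0 u (shift0 v x - shift0 v' x) +
    (shift0 u (shift0 v' x) - shift0 u' (shift0 v' x))).
  by rewrite (opB uB) addrA subrK.
apply: (ideal_linear JI).
  by apply: (ideal_left JI) => //; exact: LL_shift0.
by apply: (ideal_right JI) => //; exact: LL_shift0.
Qed.

Lemma word_class_eq u v : u =~ v -> word_class J u = word_class J v.
Proof.
move=> uv; apply/seteqP; split=> w; first exact: wequiv_trans (wequiv_sym uv).
exact: wequiv_trans.
Qed.

Lemma word_class_inv u v : word_class J u = word_class J v -> u =~ v.
Proof.
move=> uv; have : word_class J v v by exact: wequiv_refl.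
by rewrite -uv.
Qed.

Lemma class_reprP u : u =~ class_repr (word_class J u).
Proof.
rewrite /class_repr; case: xgetP => [v _ //|/(_ u)[]]; exact: wequiv_refl.
Qed.

Lemma SJ_class u : SJ J (word_class J u). Proof. by exists u. Qed.

Lemma mulS_class u v :
  mulS J (word_class J u) (word_class J v) = word_class J (word0_mul u v).
Proof.
by apply: word_class_eq; apply: wequiv_mul; apply: wequiv_sym; exact: class_reprP.
Qed.

Definition Lw u : opF := compression J (shift0 u).

Lemma Lw_equiv u v : u =~ v -> Lw u = Lw v.
Proof.
move=> uv; rewrite /Lw -[shift0 u](subrK (shift0 v)) -[_ - _]scale1r.
rewrite compression_lin ?scale1r; first by rewrite (compression_J uv) add0r.
  exact: (ideal_sub JI).
exact: LL_shift0.
Qed.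

Lemma LS_class u : LS J (word_class J u) = Lw u.
Proof. by apply: Lw_equiv; apply: wequiv_sym; exact: class_reprP. Qed.

Lemma LJ_Lw u : LJ J (Lw u).
Proof. by exists (shift0 u) => //; exact: LL_shift0. Qed.

Lemma Lw_mul u v : Lw u \o Lw v = Lw (word0_mul u v).
Proof. by rewrite /Lw compression_mul ?shift0_mul //; exact: LL_shift0. Qed.

Lemma Lw0 : Lw None = 0. Proof. exact: compression0. Qed.

Lemma predLJ_nform phi : predLJ J phi ->
  exists X Y : ell2 R (word * nat)%type,
    forall A, LL A -> phi (compression J A) = nform X Y A.
Proof.
move=> /(predualP LJ_bounded)[X [Y ->]].
have [Z ZE] := adjoint_vector (bounded_amp _ proj_bounded) Y.
exists (amp P X), Z => A LA; rewrite patch_in; last by exists A.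
have AB := LL_bounded LA.
rewrite /nform /compression (amp_comp _ proj_bounded (bounded_comp AB proj_bounded)).
by rewrite (amp_comp _ AB proj_bounded) ZE.
Qed.

Lemma predLJ_sum phi (T : Type) (s : seq T) (a : T -> C R) (f : T -> opF) :
  predLJ J phi -> (forall t, LL (f t)) ->
  phi (compression J (\sum_(t <- s) a t *: f t)) =
  \sum_(t <- s) a t * phi (compression J (f t)).
Proof.
move=> /predLJ_nform[X [Y phiE]] fL; rewrite phiE; last exact: LL_sum.
rewrite nform_sum => [|t]; last exact: LL_bounded.
by apply: eq_bigr => t _; rewrite phiE.
Qed.

Lemma predLJ_hpart phi B : predLJ J phi -> LL B ->
  (forall n, phi (compression J (hpart n B)) = 0) -> phi (compression J B) = 0.
Proof.
move=> /predLJ_nform[X [Y phiE]] LB h; rewrite phiE //.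
by apply: LL_normal_vanish => // n; rewrite -phiE ?h //; exact: LL_hpart.
Qed.

(** Weak-star density of the span of the L_s in LJ, seen from the predual. *)
Lemma predLJ_ext phi psi : predLJ J phi -> predLJ J psi ->
  (forall w : word, phi (Lw (Some w)) = psi (Lw (Some w))) -> phi = psi.
Proof.
move=> pP qP h; apply: (predual_ext pP qP) => _ [B LB <-].
have dP := predual_lin LJ_bounded (-1) pP qP.
have : - 1 * phi (compression J B) + psi (compression J B) = 0.
  apply: (predLJ_hpart dP LB) => n; rewrite (predLJ_sum _ _ dP) => [|w].
    rewrite big1 // => w _; rewrite -[compression J _]/(Lw (Some (tval w))) h.
    by rewrite mulN1r addNr mulr0.
  exact: LL_shift.
by move=> /eqP; rewrite mulN1r addrC subr_eq0 => /eqP.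
Qed.

Section Faithful.
Hypotheses (JH : homogeneous J) (Pp : is_proj (NJ J) P).

(** If A vac is orthogonal to NJ, then no vector of NJ separates a component of A
    from J. *)
Lemma compression_faithful A n : LL A -> compression J A = 0 -> J (hpart n A).
Proof.
move=> LA A0; apply: contrapT => /(NJ_separation JI JH LA)[y [Ny /eqP]]; apply.
rewrite -(dot_proj_l _ Ny Pp) -compressionE // A0.
exact: dot0l.
Qed.

(** If the lengths differ, each of the two words is a homogeneous component of the
    difference. *)
Lemma wequiv_size (u v : word) : Some u =~ Some v -> ~ (Some u =~ None) ->
  size u = size v.
Proof.
move=> uv u0; apply/eqP/negPn/negP => suv; apply: u0.
have := homogeneous_hpart JI JH (size u) uv.
rewrite /= -scaleN1r addrC hpart_lin !hpart_shift eqxx eq_sym (negPf suv).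
by rewrite scaler0 add0r /word_equiv /= subr0.
Qed.

Lemma Lw_inj u v : Lw u = Lw v -> u =~ v.
Proof.
move=> uv; have c0 : compression J (shift0 u - shift0 v) = 0.
  rewrite -scaleN1r addrC compression_lin; try exact: LL_shift0.
  by rewrite -[compression J _]/(Lw v) -[X in _ + X]/(Lw u) uv scaleN1r addNr.
have LD : LL (shift0 u - shift0 v).
  by rewrite -scaleN1r addrC; apply: (alg_linear (LL_algebra R d)); exact: LL_shift0.
have hD n := compression_faithful n LD c0.
have hE n : hpart n (shift0 u - shift0 v) = hpart n (shift0 u) - hpart n (shift0 v).
  by rewrite -scaleN1r addrC hpart_lin scaleN1r addrC.
case: u v uv {c0 LD} hD hE => [u|] [v|] uv hD hE.
- have [suv|suv] := eqVneq (size u) (size v).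
    by have := hD (size u); rewrite hE /= !hpart_shift suv eqxx.
  have Ju : Some u =~ None.
    have := hD (size u); rewrite hE /= !hpart_shift eqxx eq_sym (negPf suv) subr0.
    by rewrite /word_equiv /= subr0.
  apply: wequiv_trans Ju _; apply: wequiv_sym.
  have := hD (size v); rewrite hE /= !hpart_shift eqxx (negPf suv) sub0r.
  rewrite /word_equiv /= subr0 => h; rewrite -[shift v]opprK -scaleN1r -[_ *: _]addr0.
  by apply: (ideal_linear JI) => //; exact: ideal_zero.
- have := hD (size u); rewrite hE /= hpart_shift hpart0 eqxx subr0.
  by rewrite /word_equiv /= subr0.
- have := hD (size v); rewrite hE /= hpart_shift hpart0 eqxx sub0r.
  by rewrite /word_equiv /= sub0r.
- exact: wequiv_refl.
Qed.

End Faithful.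
End Compression.
(** * Convolution and group-like elements *)

Section GroupLike.
Variables (R : realType) (d : nat).
Local Notation word := (seq 'I_d).
Local Notation opF := (op R word).
Local Notation shift := (@Defs.shift R d).
Local Notation shift0 := (@Defs.shift0 R d).
Local Notation LL := (@Defs.LL R d).
Local Notation dl w := (delta w : ell2 R word).
Local Notation vac := (delta [::] : ell2 R word).
Implicit Types (A B T : opF) (x y : ell2 R word).
Variables (J : set opF) (JI : is_wot_ideal J) (JH : homogeneous J).
Local Notation P := (Defs.proj (NJ J)).
Local Notation Lw := (@Lw R d J).
Local Notation "u =~ v" := (word_equiv J u v) (at level 70).
Variable Delta : opF -> op R (word * word)%type.
Local Notation conv := (@Defs.conv R d J Delta).
Hypothesis DS : comultiplication_LJ J Delta.

Lemma Delta_Lw u : Delta (Lw u) = tensor_op (Lw u) (Lw u).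
Proof. by rewrite -(LS_class JI); have [_ _ ->] := DS; last exact: SJ_class. Qed.

Lemma conv_in phi psi A : LJ J A ->
  conv phi psi A = tensor_functional (LJ J) (LJ J) phi psi (Delta A).
Proof. by move=> JA; rewrite /Defs.conv patch_in. Qed.

Lemma conv_Lw phi psi u : predLJ J phi -> predLJ J psi ->
  conv phi psi (Lw u) = phi (Lw u) * psi (Lw u).
Proof.
move=> pP qP; rewrite conv_in ?Delta_Lw; last exact: LJ_Lw.
have [_ ->] := tensor_functionalP (@LJ_bounded R d J) pP qP => //; exact: LJ_Lw.
Qed.

(** By weak-star continuity of Delta the product is a weak-star continuous functional
    on LJ, and those come from normal functionals. *)
Lemma conv_predual phi psi : predLJ J phi -> predLJ J psi ->
  predLJ J (conv phi psi).
Proof.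
move=> pP qP; have [[f fn fE] _] := tensor_functionalP (@LJ_bounded R d J) pP qP.
have [[Dmaps Dlin _ _ Dwst _] _ _] := DS.
have -> : conv phi psi = patch (fun=> 0) (LJ J) (f \o Delta).
  apply/funext => A; rewrite /Defs.conv /patch; case: ifPn => // /set_mem JA.
  by rewrite -fE /patch mem_set //; exact: Dmaps.
apply: (wstar_continuous_predual (@LJ_bounded R d J) (LJ0 JI) (LJ_lin JI)).
  have [X [Y fXY]] := normal_nform fn.
  have DB A : LJ J A -> bounded_op R (word * word)%type (Delta A).
    by move=> /Dmaps[].
  move=> a A B JA JB; rewrite /= (Dlin a A B JA JB).
  have [dA dB] := (DB A JA, DB B JB); rewrite fXY; last exact: bounded_lin.
  by rewrite nform_lin // !fXY.
exact: (normal_comp_cvg Dwst (LJ0 JI) fn).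
Qed.

(** This is Delta A = A (x) A, tested against products of functionals. *)
Definition group_like A := LJ J A /\ forall phi psi, predLJ J phi -> predLJ J psi ->
  conv phi psi A = phi A * psi A.

Section Faithful.
Hypothesis Pp : is_proj (NJ J) P.

Lemma predLJ_zero phi : predLJ J phi -> phi 0 = 0.
Proof.
move=> pP; have := predual_linear (@LJ_bounded R d J) pP (a := -1) (LJ0 JI) (LJ0 JI).
rewrite scaler0 addr0 mulN1r addNr => -> //; exact: LJ0.
Qed.

(** The L_u are characters of the convolution algebra. If phi separates the values
    a = phi (Lw u) and b = phi (Lw t), with a non-zero, then phi * phi - b phi takes
    the values a (a - b) and 0 there. *)
Lemma interpolate1 u t : ~ (u =~ None) -> ~ (t =~ u) ->
  exists phi, [/\ predLJ J phi, phi (Lw u) = 1 & phi (Lw t) = 0].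
Proof.
move=> u0 tu.
suff [phi [pP pu pt]] : exists phi, [/\ predLJ J phi, phi (Lw u) != 0 & phi (Lw t) = 0].
  exists (fun A => (phi (Lw u))^-1 * phi A); split.
  - exact: (predual_scale (@LJ_bounded R d J)).
  - by rewrite mulVf.
  - by rewrite pt mulr0.
have sep v : ~ (v =~ u) -> exists2 phi, predLJ J phi & phi (Lw u) != phi (Lw v).
  move=> vu; apply: contrapT => h; apply: vu; apply: (wequiv_sym JI).
  apply: (Lw_inj JI JH Pp).
  apply: (predual_separates (@LJ_bounded R d J)); try exact: LJ_Lw.
  move=> phi pP; apply/eqP/negPn/negP => ne; apply: h; by exists phi.
have [phi pP put] := sep t tu.
have [pu0|pu0] := eqVneq (phi (Lw u)) 0; last first.
  exists (fun A => - phi (Lw t) * phi A + conv phi phi A); split.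
  - by apply: (predual_lin (@LJ_bounded R d J)) => //; exact: conv_predual.
  - rewrite conv_Lw // -mulrDl mulf_neq0 // addrC subr_eq0 //.
  - by rewrite conv_Lw // -mulrDl addNr mul0r.
have [psi qP] := sep None (fun h => u0 (wequiv_sym JI h)).
rewrite (Lw0 JI) (predLJ_zero qP) => qu.
have pt0 : phi (Lw t) != 0 by rewrite -pu0 eq_sym.
exists (fun A => - (psi (Lw t) / phi (Lw t)) * phi A + psi A); split.
- exact: (predual_lin (@LJ_bounded R d J)).
- by rewrite pu0 mulr0 add0r.
- by rewrite mulNr divfK // addNr.
Qed.

Lemma interpolate u (ts : seq (word0 d)) : ~ (u =~ None) ->
  (forall t, t \in ts -> ~ (t =~ u)) ->
  exists phi, [/\ predLJ J phi, phi (Lw u) = 1 &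
    forall t, t \in ts -> phi (Lw t) = 0].
Proof.
move=> u0; elim: ts => [|t ts IH] tsu.
  have [phi [pP pu _]] := interpolate1 u0 (fun h => u0 (wequiv_sym JI h)).
  by exists phi.
have [|phi [pP pu pts]] := IH; first by move=> s sts; apply: tsu; rewrite in_cons sts orbT.
have [psi [qP qu qt]] := interpolate1 u0 (tsu t (mem_head _ _)).
exists (conv phi psi); split; first exact: conv_predual.
  by rewrite conv_Lw // pu qu mulr1.
move=> s; rewrite in_cons conv_Lw // => /orP[/eqP ->|/pts ->].
  by rewrite qt mulr0.
by rewrite mul0r.
Qed.

Definition same_class (u w : word) := `[< Some w =~ Some u >].

Definition eta (u : word) : ell2 R word :=
  \sum_(w : (size u).-tuple 'I_d | same_class u w) dl (tval w).

Lemma dot_eta y u : dot y (eta u) =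
  \sum_(w : (size u).-tuple 'I_d | same_class u w) y (tval w).
Proof.
rewrite /eta; elim/big_rec2: _ => [|w s z _ IH]; first by rewrite dot0r.
by rewrite dotDr dot_delta IH.
Qed.

(** The indicator vectors of the classes are orthogonal to J vac: for A in J the
    interpolating functional computes the sum of the coefficients of A over the
    class. *)
Lemma NJ_eta (u : word) : ~ (Some u =~ None) -> NJ J (eta u).
Proof.
move=> u0 A JA; rewrite dot_eta.
have [|phi [pP pu pts]] := @interpolate (Some u)
  (map (fun w : (size u).-tuple 'I_d => Some (tval w) : word0 d)
    (seq.filter (fun w => ~~ same_class u (tval w)) (enum {: (size u).-tuple 'I_d}))) u0.
  by move=> t /mapP[w]; rewrite mem_filter => /andP[/asboolPn nwu _] ->.
have h0 : phi (compression J (hpart (size u) A)) = 0.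
  by rewrite compression_J ?predLJ_zero //; exact: homogeneous_hpart.
rewrite -[RHS]h0 predLJ_sum // => [|w]; last exact: LL_shift.
rewrite big_mkcond /=; apply: eq_bigr => w _.
rewrite -[compression J _]/(Lw (Some (tval w))); case: ifPn => wu.
  by rewrite (Lw_equiv JI (asboolP _ wu)) pu mulr1.
by rewrite pts ?mulr0 //; apply: map_f; rewrite mem_filter wu mem_enum.
Qed.

(** The functional reading off the sum of the coefficients over the class of u. *)
Definition phi_class (u : word) : opF -> C R :=
  patch (fun=> 0) (LJ J) (fun A => dot (A vac) (eta u)).

Lemma phi_class_predual u : predLJ J (phi_class u).
Proof. exact: (predual_vector (@LJ_bounded R d J)). Qed.

Lemma phi_class_compression u B : ~ (Some u =~ None) -> LL B ->
  phi_class u (compression J B) =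
  \sum_(w : (size u).-tuple 'I_d | same_class u w) B vac (tval w).
Proof.
move=> u0 LB; rewrite /phi_class patch_in; last by exists B.
by rewrite compressionE // (dot_proj_l _ (NJ_eta u0) Pp) dot_eta.
Qed.

Lemma phi_class_Lw (u v : word) : ~ (Some u =~ None) ->
  phi_class u (Lw (Some v)) = if same_class u v then 1 else 0.
Proof.
move=> u0; rewrite -[Lw _]/(compression J (shift v)) phi_class_compression //; last first.
  exact: LL_shift.
case: ifPn => [/asboolP vu|/asboolPn vu]; last first.
  rewrite big1 // => w /asboolP wu; rewrite shift_vac deltaE.
  by case: eqP => // wv; case: vu; rewrite -wv.
have sv : size v == size u.
  apply/eqP; apply: (wequiv_size JI JH vu) => v0; apply: u0.
  by apply: (wequiv_trans JI) v0; exact: (wequiv_sym JI).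
rewrite (eq_bigr (fun w : (size u).-tuple 'I_d => (tval w == v)%:R)); last first.
  by move=> w _; rewrite shift_vac deltaE.
rewrite (bigD1 (Tuple sv)) /=; last exact/asboolP.
rewrite eqxx big1 ?addr0 // => w /andP[_ wv].
by case: eqP => // wE; case/eqP: wv; apply: val_inj.
Qed.

Lemma phi_class_null u : phi_class u (Lw None) = 0.
Proof. by rewrite (Lw0 JI) predLJ_zero //; exact: phi_class_predual. Qed.

(** It suffices that every functional phi of the predual vanishes on the components
    of A. The function w |-> phi (Lw w) is constant on classes and zero on the zero
    class, so replacing it by its average over classes rewrites phi on a component as
    a combination of class sums of coefficients, which are the values of phi_class. *)
Lemma phi_class_separates A : LJ J A ->
  (forall u : word, ~ (Some u =~ None) -> phi_class u A = 0) -> A = 0.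
Proof.
move=> [B LB <-] h; apply: (predual_separates (@LJ_bounded R d J)); first by exists B.
  exact: LJ0.
move=> phi pP; rewrite predLJ_zero //; apply: predLJ_hpart => // n.
rewrite predLJ_sum // => [|w]; last exact: LL_shift.
pose F (w : n.-tuple 'I_d) := phi (Lw (Some (tval w))).
pose N (w : n.-tuple 'I_d) := #|[set v : n.-tuple 'I_d | same_class w v]%SET|.
have N0 w : (N w)%:R != 0 :> C R.
  rewrite pnatr_eq0 -lt0n; apply/card_gt0P; exists w.
  by rewrite inE; apply/asboolP; exact: wequiv_refl.
have sym v w : same_class v w = same_class w v.
  by apply/asboolP/asboolP => /(wequiv_sym JI).
have FE (w v : n.-tuple 'I_d) : same_class w v -> F v = F w.
  by move=> /asboolP vw; rewrite /F (Lw_equiv JI vw).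
have NE (w v : n.-tuple 'I_d) : same_class w v -> N v = N w.
  move=> /asboolP vw; congr #|pred_of_set _|; apply/setP => t; rewrite !inE.
  apply/asboolP/asboolP => tv; apply: (wequiv_trans JI tv) => //.
  exact: (wequiv_sym JI).
(* N w is the number of words of length n in the class of w. *)
have avg (w : n.-tuple 'I_d) :
    F w = \sum_(v : n.-tuple 'I_d | same_class w v) F v / (N v)%:R.
  rewrite (eq_bigr (fun=> F w / (N w)%:R)) => [|v wv]; last by rewrite (FE w) ?(NE w).
  rewrite sumr_const -cardsE -[RHS]mulr_natr -mulrA -/(N w).
  by rewrite mulVf ?mulr1.
rewrite (eq_bigr (fun w : n.-tuple 'I_d => \sum_(v : n.-tuple 'I_d | same_class w v)
    B vac (tval w) * (F v / (N v)%:R))); last first.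
  by move=> w _; rewrite -mulr_sumr -avg.
rewrite (exchange_big_dep xpredT) //= big1 // => v _.
rewrite -mulr_suml.
have [v0|v0] := pselect (Some (tval v) =~ None).
  by rewrite /F (Lw_equiv JI v0) (Lw0 JI) predLJ_zero // mul0r mulr0.
have := h _ v0; rewrite phi_class_compression //.
have -> : \sum_(w : (size v).-tuple 'I_d | same_class v w) B vac (tval w) =
    \sum_(w : n.-tuple 'I_d | same_class v w) B vac (tval w).
  by move: (size_tuple v) => E; rewrite E.
move=> bv; rewrite [X in X * _](_ : _ = 0) ?mul0r //.
by rewrite -[RHS]bv; apply: eq_bigl => w; rewrite sym.
Qed.

(** The functionals phi_class of the non-zero classes are orthogonal idempotents of the
    convolution algebra, so a group-like element, being multiplicative on them, takes the value 1 on at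
    most one of them and 0 on the others. *)
Lemma group_like_Lw A : group_like A -> exists u, A = Lw u.
Proof.
move=> [JA Agl].
have orth u v : ~ (Some u =~ None) -> ~ (Some v =~ None) -> ~~ same_class u v ->
    conv (phi_class u) (phi_class v) = fun=> 0.
  move=> u0 v0 uv; apply: predLJ_ext.
  - by apply: conv_predual; exact: phi_class_predual.
  - exact: (predual0 (@LJ_bounded R d J)).
  - move=> w; rewrite conv_Lw; try exact: phi_class_predual.
    rewrite !phi_class_Lw //; case: ifPn => [/asboolP wu|_]; last by rewrite mul0r.
    case: ifPn => [/asboolP wv|_]; last by rewrite mulr0.
    case/asboolP: uv; exact: (wequiv_trans JI (wequiv_sym JI wv)).
have idem u : ~ (Some u =~ None) -> conv (phi_class u) (phi_class u) = phi_class u.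
  move=> u0; apply: predLJ_ext.
  - by apply: conv_predual; exact: phi_class_predual.
  - exact: phi_class_predual.
  - move=> w; rewrite conv_Lw; try exact: phi_class_predual.
    by rewrite !phi_class_Lw //; case: ifP; rewrite ?mulr1 ?mulr0.
have [[u [u0 uA]]|nu] := pselect (exists u : word, ~ (Some u =~ None) /\
    phi_class u A <> 0); last first.
  exists None; rewrite (Lw0 JI); apply: phi_class_separates => // u u0.
  by apply: contrapT => uA; apply: nu; exists u.
have uA1 : phi_class u A = 1.
  have := Agl _ _ (phi_class_predual u) (phi_class_predual u); rewrite idem // => h.
  have /eqP uA' := uA; apply: (mulfI uA').
  by rewrite mulr1 -h.
exists (Some u); apply/eqP; rewrite -subr_eq0 addrC -scaleN1r; apply/eqP.
have Ju := LJ_Lw J (Some u).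
apply: phi_class_separates => [|v v0]; first exact: (LJ_lin JI).
rewrite (predual_linear (@LJ_bounded R d J)) //; last 2 first.
- exact: phi_class_predual.
- exact: (LJ_lin JI).
rewrite phi_class_Lw //; case: ifPn => [/asboolP uv|uv].
  have -> : phi_class v = phi_class u.
    apply: predLJ_ext; try exact: phi_class_predual.
    move=> w; rewrite !phi_class_Lw //; congr (if _ then _ else _).
    apply/asboolP/asboolP => wv; apply: (wequiv_trans JI wv) => //.
    exact: (wequiv_sym JI).
  by rewrite uA1 mulr1 addNr.
rewrite mulr0 add0r.
have := Agl _ _ (phi_class_predual v) (phi_class_predual u); rewrite orth //.
by rewrite uA1 mulr1.
Qed.

End Faithful.
End GroupLike.
(** * Automorphisms of the semigroup *)

Section SemigroupAutomorphisms.
Variables (R : realType) (d : nat).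
Local Notation word := (seq 'I_d).
Local Notation opF := (op R word).
Variables (J : set opF) (JI : is_wot_ideal J) (JH : homogeneous J).
Local Notation cls u := (word_class J (u : word0 d)).
Local Notation "u =~ v" := (word_equiv J u v) (at level 70).
Implicit Types s t : set (word0 d).

Lemma mulS_SJ s t : SJ J (mulS J s t).
Proof. exact: SJ_class. Qed.

Lemma wequiv_unit_letter (w : word) : ~ (Some w =~ None) -> (0 < size w)%N ->
  cls (Some w) <> cls (Some [::]).
Proof.
move=> w0 sw /(word_class_inv JI) h.
by move: sw; rewrite (wequiv_size JI JH h w0).
Qed.

Lemma null_cat_l (u v : word) : Some u =~ None -> Some (u ++ v) =~ None.
Proof.
move=> u0; apply: (wequiv_mul JI (v := Some v) (v' := Some v) u0).
exact: wequiv_refl.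
Qed.

Lemma null_cat_r (u v : word) : Some v =~ None -> Some (u ++ v) =~ None.
Proof.
move=> v0; apply: (wequiv_mul JI (u := Some u) (u' := Some u) _ v0).
exact: wequiv_refl.
Qed.

Section Automorphism.
Variables (sigma : set (word0 d) -> set (word0 d)) (sA : semigroup_automorphism J sigma).

Lemma sigma_SJ s : SJ J s -> SJ J (sigma s).
Proof. by case: sA => -[h _ _] _ _ _; exact: h. Qed.

Lemma sigma_inj s t : SJ J s -> SJ J t -> sigma s = sigma t -> s = t.
Proof. by case: sA => -[_ h _] _ _ _ Ss St; apply: h; exact: mem_set. Qed.

Lemma sigma_surj t : SJ J t -> exists2 s, SJ J s & sigma s = t.
Proof. by case: sA => -[_ _ h] _ _ _ /h. Qed.

(** The non-zero classes of letters are the elements, other than 0 and 1, without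
    non-trivial factorization; this description is invariant under automorphisms. *)
Lemma sigma_letter (i : 'I_d) : exists j : 'I_d, sigma (cls (Some [:: i])) = cls (Some [:: j]).
Proof.
have [i0|i0] := pselect (Some [:: i] =~ None).
  by exists i; rewrite (word_class_eq JI i0) (sg_zero sA).
have [[w|] _ wE] := sigma_SJ (SJ_class J (Some [:: i])); last first.
  case: i0; apply: (word_class_inv JI).
  by apply: sigma_inj; try exact: SJ_class; rewrite (sg_zero sA).
have w0 : ~ (Some w =~ None).
  move=> w0; case: i0; apply: (word_class_inv JI).
  by apply: sigma_inj; try exact: SJ_class; rewrite (sg_zero sA) -wE; exact: word_class_eq.
case: w wE w0 => [|a [|b w]] wE w0; last 1 first.
- have [s Ss sa] := sigma_surj (SJ_class J (Some [:: a])).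
  have [t St tb] := sigma_surj (SJ_class J (Some (b :: w))).
  have [[u|] _ us] := Ss; last first.
    case: w0; apply: (null_cat_l (u := [:: a])); apply: (word_class_inv JI).
    by rewrite -sa -us (sg_zero sA).
  have [[v|] _ vt] := St; last first.
    case: w0; apply: (null_cat_r [:: a]); apply: (word_class_inv JI).
    by rewrite -tb -vt (sg_zero sA).
  have uvi : Some (u ++ v) =~ Some [:: i].
    apply: (word_class_inv JI); apply: sigma_inj; try exact: SJ_class.
    rewrite -[Some (u ++ v)]/(word0_mul (Some u) (Some v)) -(mulS_class JI) (sg_mul sA);
      try exact: SJ_class.
    by rewrite us vt sa tb (mulS_class JI) wE.
  have uv0 : ~ (Some (u ++ v) =~ None).
    by move=> h; apply: i0; apply: (wequiv_trans JI) h; exact: (wequiv_sym JI).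
  have := wequiv_size JI JH uvi uv0; rewrite size_cat /=.
  case: u us {uvi uv0} => [|x u] us suv.
    have a0 : ~ (Some [:: a] =~ None) by move=> /(null_cat_l (b :: w)).
    case: (wequiv_unit_letter a0 isT).
    by rewrite -sa -us (sg_unit sA).
  case: v vt suv => [|y v] vt suv; last by move: suv; rewrite /= addnS.
  have b0 : ~ (Some (b :: w) =~ None) by move=> /(null_cat_r [:: a]).
  case: (wequiv_unit_letter b0 isT).
  by rewrite -tb -vt (sg_unit sA).
- case: (wequiv_unit_letter i0 isT).
  by apply: sigma_inj; try exact: SJ_class; rewrite (sg_unit sA).
- by exists a.
Qed.

Lemma iter_sigma_letter (i : 'I_d) n :
  exists j : 'I_d, iter n sigma (cls (Some [:: i])) = cls (Some [:: j]).
Proof.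
elim: n => [|n [j IH]]; first by exists i.
by have [k jk] := sigma_letter j; exists k; rewrite iterS IH.
Qed.

Lemma iter_sigma_SJ n s : SJ J s -> SJ J (iter n sigma s).
Proof. by elim: n => // n IH /IH; rewrite iterS => /sigma_SJ. Qed.

Lemma iter_sigma_inj n s t : SJ J s -> SJ J t ->
  iter n sigma s = iter n sigma t -> s = t.
Proof.
move=> Ss St; elim: n => // n IH; rewrite !iterS => h; apply: IH.
by apply: sigma_inj h; exact: iter_sigma_SJ.
Qed.

Lemma iter_sigma_mul n s t : SJ J s -> SJ J t ->
  iter n sigma (mulS J s t) = mulS J (iter n sigma s) (iter n sigma t).
Proof.
move=> Ss St; elim: n => // n IH.
by rewrite !iterS IH (sg_mul sA) //; exact: iter_sigma_SJ.
Qed.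

(** An automorphism maps each of the finitely many generating classes of letters to
    such a class, so two of its powers agree on the generators. *)
Lemma sigma_finite_order : exists2 m, (0 < m)%N & forall s, SJ J s -> iter m sigma s = s.
Proof.
pose h n := [ffun i => projT1 (cid (iter_sigma_letter i n))] : {ffun 'I_d -> 'I_d}.
have hE n i : iter n sigma (cls (Some [:: i])) = cls (Some [:: h n i]).
  by rewrite ffunE; exact: (projT2 (cid (iter_sigma_letter i n))).
have [a [b [ab hab]]] : exists a b, (a < b)%N /\ h a = h b.
  apply: contrapT => nab.
  (* One more power than there are maps from letters to letters. *)
  pose g (k : 'I_#|{ffun 'I_d -> 'I_d}|.+1) := h k.
  have gI : injective g.
    move=> k l kl; apply: val_inj; apply: contrapT => /eqP; rewrite neq_ltn.
    by move=> /orP[] kl'; apply: nab; [exists k, l | exists l, k].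
  by have := leq_card g gI; rewrite card_ord ltnn.
exists (b - a)%N; first by rewrite subn_gt0.
have letter i : iter (b - a) sigma (cls (Some [:: i])) = cls (Some [:: i]).
  apply: (@iter_sigma_inj a); try exact: SJ_class.
    by apply: iter_sigma_SJ; exact: SJ_class.
  by rewrite -iterD subnKC ?(ltnW ab) // !hE hab.
have nul n : iter n sigma (cls None) = cls None.
  by elim: n => // n IH; rewrite iterS IH (sg_zero sA).
have unit n : iter n sigma (cls (Some [::])) = cls (Some [::]).
  by elim: n => // n IH; rewrite iterS IH (sg_unit sA).
move=> _ [[w|] _ <-]; last exact: nul.
elim: w => [|i w IH]; first exact: unit.
have -> : cls (Some (i :: w)) = mulS J (cls (Some [:: i])) (cls (Some w)).
  by rewrite (mulS_class JI).
by rewrite iter_sigma_mul ?IH ?letter //; exact: SJ_class.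
Qed.

End Automorphism.
End SemigroupAutomorphisms.

(** * Hopf automorphisms *)

Section HopfAutomorphisms.
Variables (R : realType) (d : nat).
Local Notation word := (seq 'I_d).
Local Notation opF := (op R word).
Variables (J : set opF) (JI : is_wot_ideal J) (JH : homogeneous J).
Local Notation P := (Defs.proj (NJ J)).
Local Notation Lw := (@Lw R d J).
Local Notation cls u := (word_class J (u : word0 d)).
Local Notation "u =~ v" := (word_equiv J u v) (at level 70).
Variable Delta : opF -> op R (word * word)%type.
Hypothesis DS : comultiplication_LJ J Delta.
Local Notation conv := (@Defs.conv R d J Delta).
Variables (theta : (opF -> C R) -> (opF -> C R)) (Theta : opF -> opF).
Hypotheses (tB : bounded_linear_predual J theta) (adj : is_adjoint J theta Theta).

Let LJB := @LJ_bounded R d J.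

Lemma Theta_LJ A : LJ J A -> LJ J (Theta A). Proof. by case: adj => h _; exact: h. Qed.

Lemma thetaE phi A : predLJ J phi -> LJ J A -> theta phi A = phi (Theta A).
Proof. by case: adj => _ h; exact: h. Qed.

Lemma theta_pred phi : predLJ J phi -> predLJ J (theta phi).
Proof. exact: theta_maps. Qed.

Lemma Theta_lin a A B : LJ J A -> LJ J B ->
  Theta (a *: A + B) = a *: Theta A + Theta B.
Proof.
move=> JA JB; have JAB := LJ_lin JI a JA JB.
have TA := Theta_LJ JA; have TB := Theta_LJ JB.
have TAB := LJ_lin JI a TA TB.
apply: (predual_separates LJB) => // [|phi pP]; first exact: Theta_LJ.
rewrite -thetaE // (predual_linear LJB) //; last exact: theta_pred.
by rewrite (predual_linear LJB) // !thetaE.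
Qed.

Lemma Theta0 : Theta 0 = 0.
Proof.
have := Theta_lin (-1) (LJ0 JI) (LJ0 JI).
by rewrite scaler0 addr0 scaleN1r addNr.
Qed.

(** What the convolution and the dual automorphisms have in common, and what is
    needed to produce an automorphism of the semigroup. *)
Definition grouplike_preserving :=
  [/\ multiplicative_on (LJ J) Theta,
      forall A B, LJ J A -> LJ J B -> Theta A = Theta B -> A = B,
      forall phi psi, predLJ J phi -> predLJ J psi -> theta phi = theta psi -> phi = psi
    & forall u, group_like J Delta (Theta (Lw u))].

Lemma LS_LJ s : LJ J (LS J s). Proof. exact: LJ_Lw. Qed.

(** The group-like elements being the L_s, Theta induces a map sigma of the semigroup.
    A class u missed by sigma would make theta (phi_class u) vanish on all L_s, hence be zero. *)
Lemma semigroup_automorphism_of_grouplike : grouplike_preserving ->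
  exists sigma, semigroup_automorphism J sigma /\
    forall s, SJ J s -> Theta (LS J s) = LS J (sigma s).
Proof.
move=> [Tmul Tinj tinj Tgl]; have [Pp|P0] := proj_cases J; last first.
  have LS0 s : LS J s = 0 by rewrite /LS /compression P0.
  exists id; split; last by move=> s _; rewrite LS0 Theta0.
  by split=> //; split=> // s Ss; exists s.
have inj u v : Lw u = Lw v -> cls u = cls v.
  by move=> /(Lw_inj JI JH Pp); exact: word_class_eq.
pose sigma s := cls (xget None [set w | Theta (LS J s) = Lw w]).
have sigmaS s : SJ J (sigma s) by exact: SJ_class.
have sigmaE s : SJ J s -> Theta (LS J s) = LS J (sigma s).
  move=> [u _ <-]; rewrite (LS_class JI (xget _ _)).
  have [w uw] := group_like_Lw JI JH DS Pp (Tgl u).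
  by case: xgetP => [//|/(_ w)]; rewrite /= (LS_class JI) uw => /(_ erefl).
have LS_inj s t : SJ J s -> SJ J t -> LS J s = LS J t -> s = t.
  by move=> [u _ <-] [v _ <-]; rewrite !(LS_class JI); exact: inj.
have LS_mul s t : SJ J s -> SJ J t -> LS J (mulS J s t) = LS J s \o LS J t.
  move=> [u _ <-] [v _ <-].
  by rewrite (mulS_class JI) !(LS_class JI) (Lw_mul JI).
have s0 : sigma (cls None) = cls None.
  apply: LS_inj; [exact: sigmaS | exact: SJ_class | rewrite -sigmaE; last exact: SJ_class].
  by rewrite !(LS_class JI) (Lw0 JI) Theta0.
have sM s t : SJ J s -> SJ J t -> sigma (mulS J s t) = mulS J (sigma s) (sigma t).
  move=> Ss St; apply: LS_inj => //; first exact: mulS_SJ.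
  rewrite -sigmaE; last exact: mulS_SJ.
  by rewrite !LS_mul // Tmul; [rewrite !sigmaE | exact: LS_LJ | exact: LS_LJ].
have sI s t : SJ J s -> SJ J t -> sigma s = sigma t -> s = t.
  move=> Ss St st; apply: LS_inj => //; apply: Tinj; try exact: LS_LJ.
  by rewrite !sigmaE // st.
have sS r : SJ J r -> exists2 s, SJ J s & sigma s = r.
  move=> [[u|] _ <-]; last by exists (cls None); first exact: SJ_class.
  have [u0|u0] := pselect (Some u =~ None).
    by exists (cls None); [exact: SJ_class | rewrite s0; apply/esym; exact: word_class_eq].
  apply: contrapT => nr; have pu := phi_class_predual J u.
  have z : predLJ J (fun=> 0) by exact: (predual0 LJB).
  have tu0 : theta (phi_class J u) = theta (fun=> 0).
    apply: (predual_ext (theta_pred pu) (theta_pred z)) => A JA.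
    rewrite (thetaE z JA); move: A JA.
    suff : theta (phi_class J u) = fun=> 0 by move=> ->.
    apply: predLJ_ext; [exact: theta_pred | exact: z | move=> w].
    rewrite (thetaE pu (LJ_Lw _ _)) -(LS_class JI) sigmaE; last exact: SJ_class.
    rewrite /sigma; set v := xget _ _; rewrite (LS_class JI).
    case vE : v => [v'|]; last exact: phi_class_null.
    rewrite (phi_class_Lw JI JH DS Pp) //; case: ifPn => // /asboolP vu.
    case: nr; exists (cls (Some w)); first exact: SJ_class.
    by rewrite /sigma -/v vE; exact: word_class_eq.
  have := tinj _ _ pu z tu0 => /(congr1 (fun f => f (Lw (Some u)))).
  rewrite (phi_class_Lw JI JH DS Pp) // ifT; last by apply/asboolP; exact: wequiv_refl.
  by move/eqP; rewrite oner_eq0.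
exists sigma; split=> //; split=> //.
- split=> [s Ss|s t|r /sS[s Ss sr]]; first exact: sigmaS.
    by move=> /set_mem Ss /set_mem St; exact: sI.
  by exists s.
(* Since sigma is onto, the image of the unit is again a unit. *)
- have e1 s : SJ J s -> mulS J (cls (Some [::])) s = s.
    by move=> [[u|] _ <-]; rewrite (mulS_class JI).
  have e2 s : SJ J s -> mulS J s (cls (Some [::])) = s.
    by move=> [[u|] _ <-]; rewrite (mulS_class JI) //= cats0.
  have Se : SJ J (cls (Some [::])) by exact: SJ_class.
  have [s Ss se] := sS _ Se.
  by rewrite -[LHS]e2 // -{2}se -sM // e1.
Qed.

Lemma grouplike_of_convolution :
  Hopf_convolution_automorphism J Delta theta Theta -> grouplike_preserving.
Proof.
move=> [[tmap tinj tsurj] _ tmul tcom].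
have TM : multiplicative_on (LJ J) Theta.
  move=> A B JA JB; have JAB := LJ_mul JI JA JB.
  have TAB := LJ_mul JI (Theta_LJ JA) (Theta_LJ JB).
  apply: (predual_separates LJB) => // [|phi pP]; first exact: Theta_LJ.
  by rewrite -thetaE //; exact: (tcom phi A B pP JA JB).
split=> // [A B JA JB AB|phi psi pP qP|u].
- apply: (predual_separates LJB) => // phi /tsurj[psi qP <-].
  by rewrite !thetaE // AB.
- by apply: tinj; exact: mem_set.
- split=> [|phi psi pP qP]; first by apply: Theta_LJ; exact: LJ_Lw.
  have JL := LJ_Lw J u; have cP := conv_predual JI DS pP qP.
  by rewrite -thetaE // tmul // (conv_Lw JI DS) ?thetaE //; exact: theta_pred.
Qed.

(** A functional composed with Theta agrees on LJ with its image under theta. *)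
Lemma grouplike_of_dual : Hopf_dual_automorphism J Delta Theta -> grouplike_preserving.
Proof.
move=> [[Tmap Tinj Tsurj] _ TM _ Tcom]; split=> // [A B JA JB|phi psi pP qP tt|u].
- by apply: Tinj; exact: mem_set.
- apply: (predual_ext pP qP) => A /Tsurj[B JB <-].
  by rewrite -!thetaE // tt.
- have JL := LJ_Lw J u; have TL := Theta_LJ JL.
  split=> // phi psi pP qP; rewrite conv_in // Tcom //.
  rewrite (@eq_tensor_functional _ _ _ _ (theta phi) _ (theta psi)).
  + rewrite -conv_in // (conv_Lw JI DS) ?thetaE //; exact: theta_pred.
  + by move=> A JA; rewrite thetaE.
  + by move=> A JA; rewrite thetaE.
Qed.

Section FromSemigroup.
Variables (sigma : set (word0 d) -> set (word0 d)).
Hypotheses (sA : semigroup_automorphism J sigma).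
Hypothesis (sT : forall s, SJ J s -> Theta (LS J s) = LS J (sigma s)).

Lemma predLJ_eq phi psi : predLJ J phi -> predLJ J psi ->
  (forall s, SJ J s -> phi (LS J s) = psi (LS J s)) -> phi = psi.
Proof.
move=> pP qP h; apply: (predLJ_ext pP qP) => w.
by rewrite -(LS_class JI) h //; exact: SJ_class.
Qed.

Lemma iter_theta_pred n phi : predLJ J phi -> predLJ J (iter n theta phi).
Proof. by move=> pP; elim: n => // n IH; rewrite iterS; exact: theta_pred. Qed.

Lemma iter_Theta_LJ n A : LJ J A -> LJ J (iter n Theta A).
Proof. by move=> JA; elim: n => // n IH; rewrite iterS; exact: Theta_LJ. Qed.

Lemma iter_thetaE n phi A : predLJ J phi -> LJ J A ->
  iter n theta phi A = phi (iter n Theta A).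
Proof.
move=> pP; elim: n A => // n IH A JA.
rewrite iterS thetaE //; last exact: iter_theta_pred.
by rewrite IH ?iterSr //; exact: Theta_LJ.
Qed.

Lemma iter_Theta_LS n s : SJ J s -> iter n Theta (LS J s) = LS J (iter n sigma s).
Proof.
move=> Ss; elim: n => // n IH.
by rewrite !iterS IH sT //; exact: iter_sigma_SJ.
Qed.

(** Invertibility of theta and Theta cannot be read off from sigma directly, since
    the linear extension of the inverse of sigma might be unbounded; but sigma has
    finite order, and then so have theta and Theta, by density. *)
Lemma Theta_finite_order : exists2 m, (0 < m)%N &
  (forall A, LJ J A -> iter m Theta A = A) /\
  (forall phi, predLJ J phi -> iter m theta phi = phi).
Proof.
have [m m0 sm] := sigma_finite_order JI JH sA; exists m => //.
have tm phi : predLJ J phi -> iter m theta phi = phi.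
  move=> pP; apply: predLJ_eq => // [|s Ss]; first exact: iter_theta_pred.
  by rewrite iter_thetaE ?iter_Theta_LS ?sm //; exact: LS_LJ.
split=> // A JA; apply: (predual_separates LJB) => // [|phi pP].
  exact: iter_Theta_LJ.
by rewrite -iter_thetaE // tm.
Qed.

(** Both sides are separately weak-star continuous in A and B, and they agree on the
    L_s; density is applied to one variable at a time. *)
Lemma Theta_mul : multiplicative_on (LJ J) Theta.
Proof.
have LSm s t : SJ J s -> SJ J t -> LS J s \o LS J t = LS J (mulS J s t).
  by move=> [u _ <-] [v _ <-]; rewrite (mulS_class JI) !(LS_class JI) (Lw_mul JI).
have mulr phi B : predLJ J phi -> LJ J B ->
    predLJ J (patch (fun=> 0) (LJ J) (fun A => phi (A \o B))).
  move=> pP JB; apply: (predual_mulr LJB) => //; first exact: LJB.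
  by move=> A JA; exact: (LJ_mul JI).
have mull phi B : predLJ J phi -> LJ J B ->
    predLJ J (patch (fun=> 0) (LJ J) (fun A => phi (B \o A))).
  move=> pP JB; apply: (predual_mull LJB) => //; first exact: LJB.
  by move=> A JA; exact: (LJ_mul JI).
have step1 A t : LJ J A -> SJ J t -> Theta (A \o LS J t) = Theta A \o Theta (LS J t).
  move=> JA St; have Jt := LS_LJ t; have TA := Theta_LJ JA; have Tt := Theta_LJ Jt.
  have JAt := LJ_mul JI JA Jt.
  apply: (predual_separates LJB); [exact: Theta_LJ | exact: LJ_mul | move=> phi pP].
  have tP := theta_pred pP.
  have := @predLJ_eq _ _ (mulr _ _ tP Jt) (theta_pred (mulr _ _ pP Tt)).
  move=> h; have := congr1 (fun f => f A) (h _).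
  rewrite patch_in // thetaE // (thetaE (mulr _ _ pP Tt)) // patch_in //; apply.
  move=> s Ss; have Js := LS_LJ s.
  rewrite patch_in // (thetaE (mulr _ _ pP Tt)) // patch_in; last exact: Theta_LJ.
  rewrite thetaE ?LSm //; last exact: LS_LJ.
  rewrite !sT ?LSm //; try exact: (sigma_SJ sA); last exact: mulS_SJ.
  by rewrite (sg_mul sA).
move=> A B JA JB; have TA := Theta_LJ JA; have TB := Theta_LJ JB.
have JAB := LJ_mul JI JA JB.
apply: (predual_separates LJB); [exact: Theta_LJ | exact: LJ_mul | move=> phi pP].
have tP := theta_pred pP.
have := @predLJ_eq _ _ (mull _ _ tP JA) (theta_pred (mull _ _ pP TA)).
move=> h; have := congr1 (fun f => f B) (h _).
rewrite patch_in // thetaE // (thetaE (mull _ _ pP TA)) // patch_in //; apply.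
move=> s Ss; have Js := LS_LJ s; have JAs := LJ_mul JI JA Js.
rewrite patch_in // (thetaE (mull _ _ pP TA)) // patch_in; last exact: Theta_LJ.
by rewrite thetaE // step1.
Qed.

Lemma Theta_comult A phi psi : LJ J A -> predLJ J phi -> predLJ J psi ->
  conv phi psi (Theta A) = conv (theta phi) (theta psi) A.
Proof.
move=> JA pP qP; have cP := conv_predual JI DS pP qP.
have tc : theta (conv phi psi) = conv (theta phi) (theta psi).
  apply: predLJ_eq; [exact: theta_pred | by apply: (conv_predual JI DS); exact: theta_pred |].
  move=> s Ss; rewrite thetaE ?sT //; last exact: LS_LJ.
  rewrite !(conv_Lw JI DS) //; try exact: theta_pred.
  by rewrite -![Lw _]/(LS J _) !thetaE ?sT //; exact: LS_LJ.
by rewrite -thetaE // tc.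
Qed.

Lemma Hopf_dual_of_semigroup : Hopf_dual_automorphism J Delta Theta.
Proof.
have [m m0 [Tm tm]] := Theta_finite_order.
have mE : m = m.-1.+1 by rewrite prednK.
split.
- split=> [A JA|A B|A JA]; first exact: Theta_LJ.
    move=> /set_mem JA /set_mem JB AB; rewrite -(Tm A JA) -(Tm B JB) mE !iterSr.
    by rewrite AB.
  by exists (iter m.-1 Theta A); [exact: iter_Theta_LJ | rewrite -iterS -mE Tm].
- by move=> a A B JA JB; exact: Theta_lin.
- exact: Theta_mul.
- apply/subspace_continuousP => A JA; apply: cvg_weakly => f fn.
  have fP : predLJ J (patch (fun=> 0) (LJ J) f) by exists f.
  have [g gn gE] := theta_pred fP.
  have gf B : LJ J B -> f (Theta B) = g B.
    move=> JB; rewrite -(patch_in g JB) gE thetaE // patch_in //; exact: Theta_LJ.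
  apply/cvgCP => e e0; rewrite gf //.
  have FF : Filter (nbhs (A : wstar R word)) by apply: nbhs_filter.
  have := (cvgCP FF g (g A)).1 (weakly_continuous gn (x := A)) e e0.
  by apply: filterS => B; rewrite /= => h JB; rewrite gf.
- move=> A phi psi JA pP qP; rewrite -conv_in; last exact: Theta_LJ.
  rewrite Theta_comult // conv_in //.
  congr (_ _); apply: eq_tensor_functional => B JB; by rewrite thetaE.
Qed.

Lemma Hopf_convolution_of_semigroup : Hopf_convolution_automorphism J Delta theta Theta.
Proof.
have [m m0 [Tm tm]] := Theta_finite_order.
have mE : m = m.-1.+1 by rewrite prednK.
split.
- split=> [phi pP|phi psi|phi pP]; first exact: theta_pred.
    move=> /set_mem pP /set_mem qP pq; rewrite -(tm phi pP) -(tm psi qP) mE !iterSr.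
    by rewrite pq.
  by exists (iter m.-1 theta phi); [exact: iter_theta_pred | rewrite -iterS -mE tm].
- exact: (theta_linear tB).
- move=> phi psi pP qP; have cP := conv_predual JI DS pP qP.
  apply: (predual_ext (theta_pred cP)).
    by apply: (conv_predual JI DS); exact: theta_pred.
  by move=> A JA; rewrite thetaE // Theta_comult.
- move=> phi A B pP JA JB; have JAB := LJ_mul JI JA JB.
  by rewrite /predual_comult (thetaE pP JAB) (Theta_mul JA JB).
Qed.

End FromSemigroup.
End HopfAutomorphisms.

Theorem theorem6p3 (R : realType) (d : nat) (d_gt0 : (0 < d)%N)
    (DeltaL : op R (seq 'I_d) -> op R (seq 'I_d * seq 'I_d)%type)
    (DeltaL_comult : comultiplication_LL DeltaL)
    (J : set (op R (seq 'I_d)))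
    (J_Hopf : Hopf_ideal DeltaL J) (J_homogeneous : homogeneous J)
    (DeltaS : op R (seq 'I_d) -> op R (seq 'I_d * seq 'I_d)%type)
    (DeltaS_comult : comultiplication_LJ J DeltaS)
    (theta : (op R (seq 'I_d) -> C R) -> (op R (seq 'I_d) -> C R))
    (theta_bounded : bounded_linear_predual J theta)
    (theta_star : op R (seq 'I_d) -> op R (seq 'I_d))
    (theta_adjoint : is_adjoint J theta theta_star) :
  (Hopf_convolution_automorphism J DeltaS theta theta_star <->
   Hopf_dual_automorphism J DeltaS theta_star) /\
  (Hopf_dual_automorphism J DeltaS theta_star <->
   exists sigma : set (word0 d) -> set (word0 d),
     semigroup_automorphism J sigma /\
     forall s, SJ J s -> theta_star (LS J s) = LS J (sigma s)).
Proof.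
have [JI _] := J_Hopf; have JH := J_homogeneous; have DS := DeltaS_comult.
have of_semigroup : (exists sigma : set (word0 d) -> set (word0 d),
     semigroup_automorphism J sigma /\
     forall s, SJ J s -> theta_star (LS J s) = LS J (sigma s)) ->
   Hopf_convolution_automorphism J DeltaS theta theta_star /\
   Hopf_dual_automorphism J DeltaS theta_star.
  move=> [sigma [sA sT]]; split.
    exact: (Hopf_convolution_of_semigroup JI JH DS theta_bounded theta_adjoint sA sT).
  exact: (Hopf_dual_of_semigroup JI JH DS theta_bounded theta_adjoint sA sT).
have to_semigroup := semigroup_automorphism_of_grouplike JI JH DS theta_bounded theta_adjoint.
split; split=> [h|h].
- apply: (of_semigroup (to_semigroup _)).2.
  exact: (grouplike_of_convolution JI DS theta_bounded theta_adjoint h).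
- apply: (of_semigroup (to_semigroup _)).1.
  exact: (grouplike_of_dual JI DS theta_bounded theta_adjoint h).
- apply: to_semigroup.
  exact: (grouplike_of_dual JI DS theta_bounded theta_adjoint h).
- exact: (of_semigroup h).2.
Qed.
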